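(* Let $P_A$ be a combinatorial decision problem with $P_A \in \mathsf{NP}$. If the set of scenarios $\mathsf{S}$ of $P_A^{HDRR}$ is polynomially computable, then $P_A^{HDRR} \in \mathsf{NP}$.
   Context: A combinatorial decision problem $P_A$ has instances given by a finite ground set (universe) $U$ and a tuple of relations $R=(R_1,\dots,R_r)$ with $R_1=U$, each $R_i$ a relation built from $U$ (subsets and Cartesian products of such relations), together with a set $F(R)$ of feasible solutions (tuples of relations over $U$); the instance is a YES-instance iff $F(R)\neq\emptyset$. Universe elements and tuples of relations are called combinatorial elements. A scenario is an instance of $P_A$; scenarios are obtained by activating/deactivating combinatorial elements, where deactivating an element also removes every relation element containing it. For sets $A,B$ the Hamming distance is $H(A,B)=|A\triangle B|$. The Hamming distance recoverable robust problem $P_A^{HDRR}$: the input consists of a base scenario $\sigma_0$, a set $\mathsf S$ of recovery scenarios (instances of $P_A$) and an integer $\kappa$; the question is whether there exist a feasible solution $s_0$ of $\sigma_0$ and, for every $\sigma\in\mathsf S$, a feasible solution $s_\sigma$ of $\sigma$ such that $H(s_0,s_\sigma)\le\kappa$ for all $\sigma\in\mathsf S$, the Hamming distance being taken over the universe elements occurring in the solutions. The scenario set is polynomially computable if an explicit encoding of all scenarios (as full instances) can be computed from the input in polynomial time.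
   Formalization: ''P_A in NP'' is taken to include that feasible solutions have polynomial length and that feasibility of a given solution is verifiable in NP; with F(R) nonempty in NP alone the claim fails (solutions could encode halting). The integer kappa is taken nonnegative. *)

(* Defs.v *)
From HB Require Import structures.
From mathcomp Require Import all_boot all_order all_algebra.
From mathcomp Require Import finmap.
Set Implicit Arguments.
Unset Strict Implicit.
Unset Printing Implicit Defensive.
Local Open Scope fset_scope.

Inductive token := Bit of bool | Hash | Open | Close.

Definition token_code (a : token) : bool + 'I_3 :=
  match a with
  | Bit b => inl b
  | Hash => inr (inord 0) | Open => inr (inord 1) | Close => inr (inord 2)
  end.
Definition token_decode (c : bool + 'I_3) : token :=
  match c with
  | inl b => Bit b
  | inr i => nth Hash [:: Hash; Open; Close] i
  end.
Lemma token_codeK : cancel token_code token_decode.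
Proof. by case=> //=; rewrite inordK. Qed.
HB.instance Definition _ := Finite.copy token (can_type token_codeK).

Definition string := seq token.

Inductive move := Left | Stay | Right.

(* [None] is the blank; [inl a] is a letter of the input alphabet and [inr g]
   one of the machine's own auxiliary tape letters. *)
Definition symbol (G : finType) := option (token + G)%type.

(* [(l, r)]: the scanned cell is the head of [r], [l] is the part to its left
   (nearest cell first), and both lists continue with blanks. *)
Definition tape (G : finType) := (seq (symbol G) * seq (symbol G))%type.

Definition scan (G : finType) (t : tape G) : symbol G := head None t.2.

Definition update (G : finType) (t : tape G) (a : symbol G * move) : tape G :=
  let: (l, r) := (t.1, a.1 :: behead t.2) in
  match a.2 with
  | Left => (behead l, head None l :: r)
  | Stay => (l, r)
  | Right => (head None r :: l, behead r)
  end.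

Record machine := Machine {
  ntapes : nat;
  aux : finType;
  state : finType;
  start : state;
  halted : pred state;
  accepting : pred state;
  delta : state -> {ffun 'I_ntapes.+1 -> symbol aux} ->
          state * {ffun 'I_ntapes.+1 -> symbol aux * move}
}.

Record config (M : machine) := Config {
  control : state M;
  tapes : {ffun 'I_(ntapes M).+1 -> tape (aux M)}
}.

Definition step (M : machine) (c : config M) : config M :=
  if halted (control c) then c else
  let: (q, a) := delta (control c) [ffun i => scan (tapes c i)] in
  Config q [ffun i => update (tapes c i) (a i)].

(* The i-th argument is written on the i-th tape, the head being on its first
   letter; the other tapes are blank. *)
Definition init (M : machine) (xs : seq string) : config M :=
  Config (start M)
    [ffun i : 'I_(ntapes M).+1 =>
       ([::], [seq Some (inl a) | a <- nth [::] xs i])].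

Definition run (M : machine) (xs : seq string) (n : nat) : config M :=
  iter n (@step M) (init M xs).

Fixpoint read (G : finType) (r : seq (symbol G)) : string :=
  if r is Some (inl a) :: r' then a :: read r' else [::].

(* The result is read off the last tape, from the head up to the first cell
   that does not hold a letter of the input alphabet. *)
Definition output (M : machine) (c : config M) : string :=
  read (tapes c ord_max).2.

Definition polytime_computable (g : string -> string) : Prop :=
  exists (M : machine) (p : {poly nat}), forall x,
    let c := run M [:: x] p.[size x]%R in
    halted (control c) /\ output c = g x.

Definition polytime_decidable2 (Q : string -> string -> Prop) : Prop :=
  exists (M : machine) (p : {poly nat}), forall x y,
    let c := run M [:: x; y] p.[size x + size y]%R in
    halted (control c) /\ (accepting (control c) <-> Q x y).

Definition in_NP (L : string -> Prop) : Prop :=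
  exists (V : string -> string -> Prop) (p : {poly nat}),
    polytime_decidable2 V /\
    forall x, L x <-> exists2 y, size y <= p.[size x]%R & V x y.

(* Universe elements are named by natural numbers, so that the solutions of
   different scenarios can be compared. *)
Inductive term := Atom of nat | Tup of seq term.

Fixpoint term_code (t : term) : GenTree.tree nat :=
  match t with
  | Atom n => GenTree.Leaf n
  | Tup ts => GenTree.Node 0 (map term_code ts)
  end.
Fixpoint term_decode (t : GenTree.tree nat) : term :=
  match t with
  | GenTree.Leaf n => Atom n
  | GenTree.Node _ ts => Tup (map term_decode ts)
  end.
Lemma term_codeK : cancel term_code term_decode.
Proof.
rewrite /cancel; fix IH 1; case=> [n|ts] //=; congr Tup.
by elim: ts => [|t ts IHts] //=; rewrite IH IHts.
Qed.
HB.instance Definition _ := Choice.copy term (can_type term_codeK).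

Fixpoint pos_bits (n : BinNums.positive) : seq bool :=
  match n with
  | BinNums.xH => [:: true]
  | BinNums.xO m => false :: pos_bits m
  | BinNums.xI m => true :: pos_bits m
  end.

Definition bits (n : nat) : seq bool :=
  if bin_of_nat n is BinNums.Npos m then pos_bits m else [::].

Fixpoint str (t : term) : string :=
  match t with
  | Atom n => Hash :: map Bit (bits n)
  | Tup ts => Open :: flatten (map str ts) ++ [:: Close]
  end.

(* Sets have no canonical listing: every duplicate-free listing of a set is an
   encoding of it. *)
Definition encodes_set (A : {fset term}) (t : term) : Prop :=
  exists2 l, t = Tup l & uniq l /\ l =i A.

Definition rel_tuple := seq {fset term}.

Definition encodes (R : rel_tuple) (t : term) : Prop :=
  exists2 ts, t = Tup ts &
    size ts = size R /\
    forall i, i < size R -> encodes_set (nth fset0 R i) (nth (Atom 0) ts i).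

Definition cartesian_product (As : seq {fset term}) (B : {fset term}) : Prop :=
  forall x, x \in B <->
    exists2 ts, x = Tup ts & all2 (fun t (A : {fset term}) => t \in A) ts As.

Inductive relation_over (U : {fset term}) : {fset term} -> Prop :=
  | rel_universe : relation_over U U
  | rel_subset (A B : {fset term}) :
      relation_over U B -> A `<=` B -> relation_over U A
  | rel_product (As : seq {fset term}) (B : {fset term}) :
      (forall A, A \in As -> relation_over U A) ->
      cartesian_product As B -> relation_over U B.

Definition universe (R : rel_tuple) : {fset term} := head fset0 R.

Definition well_formed (R : rel_tuple) : Prop :=
  [/\ 0 < size R,
      forall t, t \in universe R -> exists n, t = Atom n &
      forall A, A \in R -> relation_over (universe R) A].

Record comb_problem := CombProblem {
  is_instance : rel_tuple -> Prop;
  feasible : rel_tuple -> rel_tuple -> Prop;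
  instance_wf : forall R, is_instance R -> well_formed R;
  feasible_wf : forall R s, is_instance R -> feasible R s ->
    forall A, A \in s -> relation_over (universe R) A
}.

Definition yes_language (P : comb_problem) (x : string) : Prop :=
  exists R t, [/\ encodes R t, x = str t, is_instance P R &
                  exists s, feasible P R s].

Definition solution_language (P : comb_problem) (x : string) : Prop :=
  exists R t s u, [/\ encodes R t, encodes s u, x = str (Tup [:: t; u]),
                      is_instance P R & feasible P R s].

Definition short_solutions (P : comb_problem) : Prop :=
  exists p : {poly nat}, forall R t s u,
    encodes R t -> encodes s u -> is_instance P R -> feasible P R s ->
    size (str u) <= p.[size (str t)]%R.

(* For a combinatorial problem, membership in NP is understood with the feasible
   solutions being (part of) the certificates: they have polynomial length and
   feasibility of a given solution is verifiable, an additional witness being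
   allowed.  The first condition alone constrains only whether F(R) is empty and
   says nothing about which solutions are feasible, on which Hamming distances
   depend. *)
Definition comb_in_NP (P : comb_problem) : Prop :=
  [/\ in_NP (yes_language P), short_solutions P &
      in_NP (solution_language P)].

Fixpoint leaves (t : term) : seq nat :=
  match t with
  | Atom n => [:: n]
  | Tup ts => flatten (map leaves ts)
  end.

Definition occurring (s : rel_tuple) : {fset nat} :=
  [fset n in flatten [seq leaves t | A : {fset term} <- s, t <- enum_fset A]].

Definition hamming (A B : {fset nat}) : nat := #|` (A `\` B) `|` (B `\` A)|.

(* How the scenario set is given in the input: [scenarios E R0 c] is the set
   described by the (possibly succinct) string [c] when the base scenario is
   [R0], and [None] if [c] is not a description.  A scenario can be any instance
   of the problem; sets obtained by switching combinatorial elements on and off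
   are particular cases. *)
Record scenario_encoding (P : comb_problem) := ScenarioEncoding {
  scenarios : rel_tuple -> string -> option {fset rel_tuple};
  scenarios_instance : forall R0 c S, is_instance P R0 ->
    scenarios R0 c = Some S -> forall R, R \in S -> is_instance P R
}.

Definition hdrr_input (t0 : term) (kappa : nat) (c : string) : string :=
  str (Tup [:: t0; Atom kappa]) ++ c.

Definition hdrr (P : comb_problem) (E : scenario_encoding P) (x : string) :
    Prop :=
  exists R0 t0 kappa c S,
    [/\ encodes R0 t0, is_instance P R0, x = hdrr_input t0 kappa c,
        scenarios E R0 c = Some S &
        exists2 s0, feasible P R0 s0 &
          forall R, R \in S -> exists2 s, feasible P R s &
            hamming (occurring s0) (occurring s) <= kappa].

Definition encodes_scenarios (S : {fset rel_tuple}) (x : string) : Prop :=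
  exists ts, [/\ x = str (Tup ts),
    forall t, t \in ts -> exists2 R, R \in S & encodes R t &
    forall R, R \in S -> exists2 t, t \in ts & encodes R t].

(* The empty output signals that [c] is not a description. *)
Definition polynomially_computable (P : comb_problem)
    (E : scenario_encoding P) : Prop :=
  exists2 g, polytime_computable g &
    forall R0 t0 kappa c, encodes R0 t0 -> is_instance P R0 ->
      if scenarios E R0 c is Some scs
      then encodes_scenarios scs (g (hdrr_input t0 kappa c))
      else g (hdrr_input t0 kappa c) = [::].

(* Main.v *)
(** A certificate for an input [x] of the robust problem consists of a base
    solution, a solution of every scenario, and witnesses for the solution
    language.  For scenario solutions it also lists a set [W] of atoms such that
    the two solutions have the same atoms up to [W]; then the symmetric difference
    has at most [#W] elements, and no set has to be computed.  The instances
    themselves are not part of the certificate: they are cut out of [x] and out of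
    the computed list of scenarios at guessed positions.  A cut [t] is correct
    because [t] is checked to belong to the yes-language, so it encodes a term,
    and encodings of tuples form a prefix code.

    The verifier is a while-program on finitely many stacks, run by a machine
    with one tape per stack.  The given machines are simulated by such programs,
    each half tape on a stack, so that their tapes can be erased and the machines
    restarted for each scenario.  A witness [w] for [z] counts only if
    [size w <= p.[size z]], so the verifier also evaluates [p] in unary. *)

From Stdlib Require Import FunctionalExtensionality.
From mathcomp Require Import all_boot all_order all_algebra.
From mathcomp Require Import finmap zify.
Require Import Defs.
Set Implicit Arguments.
Unset Strict Implicit.
Unset Printing Implicit Defensive.

(** * Stack programs *)

(** The verifier must halt in polynomial time on every certificate, even a meaningless one, and must
    succeed on some certificate for each yes-input. Hence most routines have two lemmas: a [sound_]
    lemma bounds the time on arbitrary data and says what success guarantees, and a [succ_] lemma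
    exhibits data on which the routine succeeds, without counting steps. Programs are deterministic,
    so the two runs coincide, and success becomes a decided relation. A further obstacle is that
    [kappa] is written in binary and may be exponentially large, whereas differences are counted in
    unary. The certificate therefore supplies a unary bound, each unit of which is paid for by
    decrementing the binary number. Capping this bound at twice the maximal length of an encoded
    solution loses nothing, because two solutions do not contain more atoms. The loop over the
    scenarios is driven by the certificate: each round consumes part of it, so its length bounds the
    number of rounds whatever the list of scenarios looks like. *)

Fixpoint hval (cs : seq nat) (x : nat) : nat :=
  if cs is a :: cs' then hval cs' x * x + a else 0.

Lemma hornerE_nat (p : {poly nat}) x : p.[x]%R = hval p x.
Proof. by rewrite /horner; elim: (polyseq p) => //= a cs ->. Qed.

Lemma leq_hval cs m n : m <= n -> hval cs m <= hval cs n.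
Proof. by move=> le_mn; elim: cs => //= a cs IH; rewrite leq_add2r leq_mul. Qed.

(** Running times are only majorized, whereas the clock in [polytime_decidable2] is a polynomial;
    coefficients in [nat] make polynomials monotone, so majorants can be composed. *)
Definition pbounded (f : nat -> nat) :=
  exists p : {poly nat}, forall n, f n <= p.[n]%R.

Lemma pbounded_le f g : (forall n, f n <= g n) -> pbounded g -> pbounded f.
Proof. by move=> le_fg [p le_p]; exists p => n; apply: leq_trans (le_p n). Qed.

Lemma pbounded_const c : pbounded (fun=> c).
Proof. by exists (c%:P)%R => n; rewrite hornerC. Qed.

Lemma pbounded_id : pbounded id.
Proof. by exists ('X)%R => n; rewrite hornerX. Qed.

Lemma pbounded_add f g :
  pbounded f -> pbounded g -> pbounded (fun n => f n + g n).
Proof.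
by move=> [p le_p] [q le_q]; exists (p + q)%R => n; rewrite hornerD leq_add.
Qed.

Lemma pbounded_mul f g :
  pbounded f -> pbounded g -> pbounded (fun n => f n * g n).
Proof.
by move=> [p le_p] [q le_q]; exists (p * q)%R => n; rewrite hornerM leq_mul.
Qed.

Lemma pbounded_hval cs f : pbounded f -> pbounded (fun n => hval cs (f n)).
Proof.
move=> bf; elim: cs => [|a cs IH] /=; first exact: pbounded_const.
by apply: pbounded_add (pbounded_const a); apply: pbounded_mul.
Qed.

Section StackPrograms.

Variables (I : finType) (A : Type).

(** Enough to write a cell and move the head when a tape is split at the head into two stacks:
    [Put2] gives the right half after a left move, where the written cell is covered by the one
    coming from the left. *)
Inductive op := Keep | Pop | Put of A | Push of A | Put2 of A & A.

Definition act (o : op) (w : seq A) : seq A :=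
  match o with
  | Keep => w
  | Pop => behead w
  | Put a => a :: behead w
  | Push a => a :: w
  | Put2 b a => b :: a :: behead w
  end.

Definition store := I -> seq A.
Definition heads (s : store) : I -> option A := fun i => ohead (s i).

(* [Act f] fails when [f] returns [None]. *)
Inductive cmd :=
  | Act of ((I -> option A) -> option (I -> op))
  | Seq of cmd & cmd
  | Cond of ((I -> option A) -> bool) & cmd & cmd
  | While of ((I -> option A) -> bool) & cmd.

(** Control points inside a program; being finitely many, they can serve as machine states. Leaving
    the program is recorded by the [bool] in [pos c + bool], [true] for success. *)
Fixpoint pos (c : cmd) : finType :=
  match c with
  | Act _ => unit
  | Seq c1 c2 => (pos c1 + pos c2)%type
  | Cond _ c1 c2 => option (pos c1 + pos c2)
  | While _ c1 => option (pos c1)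
  end.

Fixpoint entry (c : cmd) : pos c :=
  match c with
  | Act _ => tt
  | Seq c1 c2 => inl (entry c1)
  | Cond _ c1 c2 => None
  | While _ c1 => None
  end.

(** Exits of a subprogram are redirected within the transition that reaches them: success to [k],
    failure straight out of the whole program. *)
Definition relink (Q Q' : Type) (e : Q -> Q') (k : Q' + bool)
    (x : Q + bool) : Q' + bool :=
  match x with inl q => inl (e q) | inr true => k | inr false => inr false end.

Fixpoint trans (c : cmd) :
    pos c -> (I -> option A) -> (pos c + bool) * (I -> op) :=
  match c with
  | Act f => fun _ h =>
      if f h is Some o then (inr true, o) else (inr false, fun=> Keep)
  | Seq c1 c2 => fun p h =>
      match p with
      | inl p1 => let: (x, o) := trans p1 h in (relink inl (inl (inr (entry c2))) x,
        o)
      | inr p2 => let: (x, o) := trans p2 h in (relink inr (inr true) x, o)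
      end
  | Cond b c1 c2 => fun p h =>
      match p with
      | None => (inl (Some (if b h then inl (entry c1) else inr (entry c2))), fun=>
        Keep)
      | Some (inl p1) => let: (x, o) := trans p1 h in (relink (Some \o inl) (inr
        true) x, o)
      | Some (inr p2) => let: (x, o) := trans p2 h in (relink (Some \o inr) (inr
        true) x, o)
      end
  | While b c1 => fun p h =>
      match p with
      | None => (if b h then inl (Some (entry c1)) else inr true, fun=> Keep)
      | Some p1 => let: (x, o) := trans p1 h in (relink Some (inl None) x, o)
      end
  end.

Definition sconf (c : cmd) := ((pos c + bool) * store)%type.

Definition sstep (c : cmd) (x : sconf c) : sconf c :=
  if x.1 is inl p then
    let: (y, o) := trans p (heads x.2) in (y, fun i => act (o i) (x.2 i))
  else x.

Definition reach (c : cmd) (n : nat) (x y : sconf c) :=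
  exists2 m, m <= n & iter m (@sstep c) x = y.

Definition exec (c : cmd) (n : nat) (s : store) (b : bool) (s' : store) :=
  reach n (inl (entry c), s) (inr b, s').

Lemma reach_trans c n1 n2 (x y z : sconf c) :
  reach n1 x y -> reach n2 y z -> reach (n1 + n2) x z.
Proof.
move=> [m1 le1 <-] [m2 le2 <-]; exists (m1 + m2); first exact: leq_add.
by rewrite addnC iterD.
Qed.

Lemma reach_leq c m n (x y : sconf c) : m <= n -> reach m x y -> reach n x y.
Proof. by move=> le_mn [k le_k E]; exists k => //; apply: leq_trans le_mn. Qed.

Lemma reach_step c n (x y : sconf c) : reach n (sstep x) y -> reach n.+1 x y.
Proof. by move=> [m le_m E]; exists m.+1; rewrite // iterSr. Qed.

Lemma iter_done c n b s : iter n (@sstep c) (inr b, s) = (inr b, s).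
Proof. by elim: n => //= n ->. Qed.

(** Final configurations are fixed points, so performing both iterations, in either order, ends in
    each of them. *)
Lemma reach_done c m n (x : sconf c) b s b' s' :
  reach m x (inr b, s) -> reach n x (inr b', s') -> b = b' /\ s = s'.
Proof.
move=> [k _ Ek] [l _ El].
have: iter l (@sstep c) (iter k (@sstep c) x)
    = iter k (@sstep c) (iter l (@sstep c) x) by rewrite -!iterD addnC.
by rewrite Ek El !iter_done => -[-> ->].
Qed.

Lemma exec_inj c m n s b s1 b' s2 :
  exec c m s b s1 -> exec c n s b' s2 -> b = b' /\ s1 = s2.
Proof. exact: reach_done. Qed.

Lemma exec_leq c m n s b s' : m <= n -> exec c m s b s' -> exec c n s b s'.
Proof. exact: reach_leq. Qed.

(** Redirecting an exit costs no step, so the bound [n] of the subprogram carries over unchanged. *)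
Lemma reach_relink c c' (e : pos c -> pos c') k n p s b s' :
  (forall p h, trans (e p) h = let: (x, o) := trans p h in (relink e k x, o)) ->
  reach n (inl p, s) (inr b, s') ->
  reach n (inl (e p), s) (if b then k else inr false, s').
Proof.
move=> He [m le_mn E]; apply: reach_leq le_mn _; elim: m p s E => // m IH p s.
rewrite iterSr /sstep /=; have := He p (heads s); case: (trans p (heads s)) => x o Ee.
case: x Ee => [q|b'] Ee => [/IH Hr|].
  by apply: reach_step; rewrite /sstep /= Ee.
rewrite iter_done => -[<- <-]; exists 1 => //; rewrite /sstep /= Ee /=.
by case: (b').
Qed.

Lemma exec_act_ok f s o : f (heads s) = Some o ->
  exec (Act f) 1 s true (fun i => act (o i) (s i)).
Proof. by move=> E; exists 1; rewrite // /sstep /= E. Qed.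

Lemma exec_act_fail f s : f (heads s) = None -> exec (Act f) 1 s false s.
Proof. by move=> E; exists 1; rewrite // /sstep /= E. Qed.

Lemma exec_seq c1 c2 n1 n2 s s1 b s' :
  exec c1 n1 s true s1 -> exec c2 n2 s1 b s' ->
  exec (Seq c1 c2) (n1 + n2) s b s'.
Proof.
move=> H1 H2; apply: reach_trans.
  exact: (@reach_relink c1 (Seq c1 c2) inl (inl (inr (entry c2))) _ _ _ _ _ _ H1).
have := @reach_relink c2 (Seq c1 c2) inr (inr true) _ _ _ _ _ _ H2.
by case: b H2 => H2; apply.
Qed.

Lemma exec_seq_fail c1 c2 n s s' :
  exec c1 n s false s' -> exec (Seq c1 c2) n s false s'.
Proof.
exact: (@reach_relink c1 (Seq c1 c2) inl (inl (inr (entry c2))) _ _ _ false).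
Qed.

Lemma exec_cond (b : (I -> option A) -> bool) c1 c2 n s r s' :
  exec (if b (heads s) then c1 else c2) n s r s' ->
  exec (Cond b c1 c2) n.+1 s r s'.
Proof.
move=> H; apply: reach_step; rewrite /sstep /=; case: (b _) H => H /=.
  have := @reach_relink c1 (Cond b c1 c2) (Some \o inl) (inr true) _ _ _ _ _ _ H.
  by case: r H => H; apply.
have := @reach_relink c2 (Cond b c1 c2) (Some \o inr) (inr true) _ _ _ _ _ _ H.
by case: r H => H; apply.
Qed.

Lemma exec_while_done (b : (I -> option A) -> bool) c s : ~~ b (heads s) ->
  exec (While b c) 1 s true s.
Proof. by move=> /negPf nb; exists 1; rewrite // /sstep /= nb. Qed.

Lemma exec_while_fail (b : (I -> option A) -> bool) c n s s' :
  b (heads s) -> exec c n s false s' -> exec (While b c) n.+1 s false s'.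
Proof.
move=> hb H; apply: reach_step; rewrite /sstep /= hb.
exact: (@reach_relink c (While b c) Some (inl None) _ _ _ _ _ _ H).
Qed.

Lemma exec_while_step (b : (I -> option A) -> bool) c n1 n2 s s1 r s' :
  b (heads s) -> exec c n1 s true s1 -> exec (While b c) n2 s1 r s' ->
  exec (While b c) (n1 + n2).+1 s r s'.
Proof.
move=> hb H1 H2; apply: reach_step; rewrite /sstep /= hb; apply: reach_trans H2.
exact: (@reach_relink c (While b c) Some (inl None) _ _ _ _ _ _ H1).
Qed.

End StackPrograms.

Arguments Keep {A}.
Arguments Pop {A}.

(** * Stack programs as multi-tape machines *)

Section Compilation.

Variables (G : finType) (I : finType) (r0 r1 : I).
Hypothesis neq_r : r0 != r1.
Local Notation A := (token + G)%type.
Variable c : cmd I A.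

(** The two input registers are listed first because [init] writes the arguments on the first two
    tapes. *)
Let regs := [:: r0, r1 & [seq i <- enum I | (i != r0) && (i != r1)]].
Let K := size [seq i <- enum I | (i != r0) && (i != r1)].

Let reg (i : 'I_K.+2) : I := nth r0 regs i.
Let idx (i : I) : 'I_K.+2 := inord (index i regs).

Lemma mem_regs i : i \in regs.
Proof. by rewrite !inE mem_filter mem_enum; case: eqP; case: eqP. Qed.

Lemma idxK : cancel idx reg.
Proof.
move=> i; have lt_i : index i regs < K.+2 by rewrite index_mem mem_regs.
by rewrite /reg /idx inordK // nth_index ?mem_regs.
Qed.

(* A stack operation takes two steps of the machine, so as to allow for
   writing, moving, and writing again. *)
Definition phase (o : op A) (a : option A) : (option A * move) * option A :=
  match o with
  | Keep => ((a, Stay), None)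
  | Pop => ((None, Right), None)
  | Put b => ((Some b, Stay), None)
  | Push b => if a is Some _ then ((a, Left), Some b) else ((Some b, Stay), None)
  | Put2 b b' => ((Some b', Left), Some b)
  end.

Definition rewrite_scan (w : option A) (a : option A) : option A * move :=
  (if w is Some b then Some b else a, Stay).

(** The optional vector holds the second writes still due: [(x, Some w)] is the middle of the two
    machine steps for one stack operation. *)
Definition cstate : finType :=
  ((pos c + bool) * option {ffun 'I_K.+2 -> option A})%type.

Definition cdelta (q : cstate) (a : {ffun 'I_K.+2 -> option A}) :
    cstate * {ffun 'I_K.+2 -> option A * move} :=
  match q with
  | (x, Some w) => ((x, None), [ffun i => rewrite_scan (w i) (a i)])
  | (inl p, None) =>
      let: (x, o) := trans p (fun r => a (idx r)) in
      ((x, Some [ffun i => (phase (o (reg i)) (a i)).2]),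
       [ffun i => (phase (o (reg i)) (a i)).1])
  | (inr _, None) => (q, [ffun i => (a i, Stay)])
  end.

Definition compiled : machine :=
  @Machine K.+1 G cstate (inl (entry c), None)
    (fun q => if q is (inr _, None) then true else false)
    (fun q => if q is (inr true, _) then true else false) cdelta.

(** The top of the stack is under the head, with blanks to its left. Stack letters are never blank,
    so an empty stack shows as a blank; comparison by [nth] ignores trailing blanks. *)
Definition represents (t : tape G) (w : seq A) :=
  (forall i, nth None t.1 i = None) /\
  (forall i, nth None t.2 i = nth None (map Some w) i).

Lemma represents_scan t w : represents t w -> scan t = ohead w.
Proof. by case=> _ /(_ 0); rewrite /scan nth0 => ->; case: w. Qed.

Lemma nth_head_behead (T : Type) (x : T) r i :
  nth x (head x r :: behead r) i = nth x r i.
Proof. by case: r => [|a r] //; case: i => // i; rewrite /= nth_nil. Qed.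

Lemma nth_behead_map (w : seq A) i :
  nth None (map Some w) i.+1 = nth None (map Some (behead w)) i.
Proof. by case: w => //=; rewrite !nth_nil. Qed.

(** [Pop] erases the cell before moving right, and a left move enters a blank cell that the second
    write fills, so the part left of the head stays blank. *)
Lemma represents_phase t w o : represents t w ->
  let t1 := update t (phase o (scan t)).1 in
  represents (update t1 (rewrite_scan (phase o (scan t)).2 (scan t1))) (act o w).
Proof.
move=> tw; rewrite (represents_scan tw); case: t w tw => l r w [/= Hl Hr].
case: o => [||b|b|b b'] /=.
- split=> // i; case: i => [|i] /=; first by case: (w).
  by rewrite nth_behead Hr.
- split=> [[|i]|i] //=; rewrite -nth_behead_map -Hr -nth_behead.
  exact: nth_head_behead.
- by split=> // -[|i] //=; rewrite nth_behead Hr nth_behead_map.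
- case: w Hr => [|a w] Hr /=; split=> i //=.
  + case: i => [|i] /=; first by [].
    by rewrite nth_behead Hr /= !nth_nil.
  + by rewrite nth_behead.
  + by case: i => [|[|i]] //=; rewrite nth_behead Hr.
- split=> i /=; first by rewrite nth_behead.
  by case: i => [|[|i]] //=; rewrite nth_behead Hr nth_behead_map.
Qed.

Definition simulated (x : sconf c) (k : config compiled) :=
  control k = (x.1, None) /\ forall i, represents (tapes k (idx i)) (x.2 i).

Lemma simulated_step x k :
  simulated x k -> simulated (sstep x) (step (step k)).
Proof.
case: x k => -[p|b] s [q t] [/= -> Ht]; last by rewrite /step /=.
rewrite /step /=; rewrite (_ : (fun r => _) = heads s); last first.
  by apply: functional_extensionality => i; rewrite ffunE (represents_scan (Ht i)).
rewrite /sstep /=; case: (trans p (heads s)) => -[q'|b] o; split=> //= i;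
  by have := represents_phase (o i) (Ht i); rewrite !ffunE idxK.
Qed.

Definition input_store (u v : string) : store I A :=
  fun i => if i == r0 then map inl u else if i == r1 then map inl v else [::].

Lemma simulated_init u v :
  simulated (inl (entry c), input_store u v) (init compiled [:: u; v]).
Proof.
split=> //= i; rewrite ffunE /represents /=; split=> j; first by rewrite nth_nil.
rewrite /input_store -{2 3}(idxK i); case: (idx i) => -[|[|m]] lt_m.
- by rewrite /reg /= eqxx -map_comp.
- by rewrite /reg /= eq_sym (negPf neq_r) eqxx -map_comp.
(* The other tapes start blank, and their registers lie behind the first two in [regs], hence differ
   from [r0] and [r1]. *)
rewrite /= !nth_nil; have: reg (Ordinal lt_m) \in drop 2 regs.
  by rewrite /reg /= drop0 mem_nth.
by rewrite /= drop0 mem_filter => /andP[/andP[/negPf-> /negPf->] _]; rewrite nth_nil.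
Qed.

Lemma polytime_decidable2_exec (V : string -> string -> Prop) (T : nat -> nat) :
  pbounded T ->
  (forall u v, exists b s',
     exec c (T (size u + size v)) (input_store u v) b s' /\ (b <-> V u v)) ->
  polytime_decidable2 V.
Proof.
(* Twice the program time, since each stack step takes two machine steps. *)
move=> bT H; have [p le_p] := pbounded_add bT bT.
exists compiled, p => u v; have [b [s' [[m le_m E] Vb]]] := H u v.
set k := run _ _ _; suff [ck _]: simulated (inr b, s') k.
  rewrite /= ck; by split=> //; rewrite -Vb; case: (b).
have sim n : simulated (iter n (@sstep _ _ c) (inl (entry c), input_store u v))
   (iter n.*2 (@step compiled) (init compiled [:: u; v])).
  elim: n => [|n IH]; first exact: simulated_init.
  by rewrite doubleS !iterS; apply: simulated_step.
have := sim m; rewrite E {E sim} => sm.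
have le_mp : m.*2 <= p.[size u + size v]%R.
  by apply: leq_trans (le_p _); rewrite -addnn leq_add.
(* The clock may run past the end of the program; halted configurations do not change. *)
rewrite /k /run; have [d ->] : exists d, p.[size u + size v]%R = d + m.*2.
  by exists (p.[size u + size v]%R - m.*2); rewrite subnK.
rewrite iterD; elim: d => // n [IH1 IH2].
by rewrite iterS /step IH1 /=.
Qed.

End Compilation.

(** * Simulation of a machine by a stack program *)

Section Transfer.

Variables (I : finType) (A : Type).
Implicit Types (s : store I A) (p : A -> bool) (f : A -> A).

Definition top_sat p (w : seq A) := if w is a :: _ then p a else false.

Definition xfer p f (src : I) (ds : seq I) : cmd I A :=
  While (fun h => if h src is Some a then p a else false)
    (Act (fun h => omap (fun a i => if i == src then Pop else
                                    if i \in ds then Push (f a) else Keep) (h src))).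

Lemma exec_xfer p f src ds s w r :
  s src = w ++ r -> all p w -> ~~ top_sat p r -> src \notin ds ->
  exec (xfer p f src ds) (size w).*2.+1 s true
    (fun i => if i == src then r else
              if i \in ds then catrev (map f w) (s i) else s i).
Proof.
move=> + + nr nds; elim: w s => [|a w IH] s Es.
  move=> _; have -> : (fun i => if i == src then r else
      if i \in ds then catrev (map f [::]) (s i) else s i) = s.
    by apply: functional_extensionality => i; case: eqP => [->|];
      rewrite ?Es ?if_same.
  by apply: exec_while_done; rewrite /heads Es; case: (r) nr.
move=> /= /andP[pa pw]; rewrite doubleS.
set s1 : store I A := fun i => act (if i == src then Pop else
   if i \in ds then Push (f a) else Keep) (s i).
have E1 : s1 src = w ++ r by rewrite /s1 eqxx Es.
apply: (@exec_while_step _ _ _ _ 1 _ _ s1).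
- by rewrite /heads Es.
- by apply: exec_act_ok; rewrite /heads Es.
have -> : (fun i => if i == src then r else
      if i \in ds then catrev (map f (a :: w)) (s i) else s i)
    = (fun i => if i == src then r else
      if i \in ds then catrev (map f w) (s1 i) else s1 i).
  apply: functional_extensionality => i; rewrite /s1; case: eqP => // _.
  by case: ifP.
exact: IH.
Qed.

End Transfer.

Section Simulation.

Variables (B J G : finType) (M : machine).
Local Notation I := (B + J)%type.
Local Notation A := (token + option G)%type.

(* [inr false]: control state; [inr true]: spare register receiving the second
   input of a one-tape machine; [inl (b, t)]: right ([b = true]) and left half
   of tape [t]. *)
Definition block : finType := ((bool * 'I_(ntapes M).+1) + bool)%type.

(** Several machines share one store and one alphabet; each sees only its own registers and symbols,
    through partially invertible embeddings. *)
Variables (jb : block -> J) (kb : J -> option block).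
Hypotheses (jbK : pcancel jb kb) (kbK : ocancel kb jb).
Variables (jg : (aux M + state M) -> G) (kg : G -> option (aux M + state M)).
Hypothesis jgK : pcancel jg kg.

(* The blank is an ordinary stack symbol, [inr None]. *)
Definition emb (x : symbol (aux M)) : A :=
  match x with
  | None => inr None
  | Some (inl a) => inl a
  | Some (inr g) => inr (Some (jg (inl g)))
  end.

Definition unemb (a : option A) : symbol (aux M) :=
  match a with
  | Some (inl a) => Some (inl a)
  | Some (inr (Some z)) => if kg z is Some (inl g) then Some (inr g) else None
  | _ => None
  end.

Lemma embK x : unemb (Some (emb x)) = x.
Proof. by case: x => [[a|g]|] //=; rewrite jgK. Qed.

Definition emb_state (q : state M) : A := inr (Some (jg (inr q))).

Definition unemb_state (a : option A) : option (state M) :=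
  if a is Some (inr (Some z)) then if kg z is Some (inr q) then Some q else None
  else None.

Lemma emb_stateK q : unemb_state (Some (emb_state q)) = Some q.
Proof. by rewrite /= jgK. Qed.

Definition rb (b : block) : I := inr (jb b).
Definition krb (i : I) : option block := if i is inr j then kb j else None.

Lemma rbK b : krb (rb b) = Some b. Proof. exact: jbK. Qed.

Lemma krbK i b : krb i = Some b -> i = rb b.
Proof. by case: i => //= j Ej; have := kbK j; rewrite Ej /rb /= => ->. Qed.

(** The spare register [inr true] keeps its content from [s]: it belongs to the block, but holds
    neither a tape nor the state. *)
Definition loaded (s : store I A) (c : config M) : store I A := fun i =>
  match krb i with
  | Some (inl (b, t)) => map emb (if b then (tapes c t).2 else (tapes c t).1)
  | Some (inr false) => [:: emb_state (control c)]
  | _ => s i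
  end.

(** Both halves of a tape change in the same step, so on a left move the right half must know the
    top of the left one; it is a blank by default, as an exhausted half continues with blanks. *)
Definition tape_op (b : bool) (x : symbol (aux M) * move) (left : option A) : op A :=
  match x.2, b with
  | Stay, false => Keep
  | Stay, true => Put (emb x.1)
  | Left, false => Pop
  | Left, true => Put2 (odflt (emb None) left) (emb x.1)
  | Right, false => Push (emb x.1)
  | Right, true => Pop
  end.

Definition sim_step : cmd I A :=
  Act (fun h => if unemb_state (h (rb (inr false))) is Some q then
    let: (q', a) := delta q [ffun t => unemb (h (rb (inl (true, t))))] in
    Some (fun i => match krb i with
      | Some (inl (b, t)) => tape_op b (a t) (h (rb (inl (false, t))))
      | Some (inr false) => Put (emb_state q')
      | _ => Keep
      end)
    else None).

Definition sim_running (h : I -> option A) : bool :=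
  if unemb_state (h (rb (inr false))) is Some q then ~~ halted q else false.

Definition sim_loop := While sim_running sim_step.

Lemma loaded_state s c : heads (loaded s c) (rb (inr false)) = Some (emb_state
  (control c)).
Proof. by rewrite /heads /loaded rbK. Qed.

Lemma loaded_scan s c :
  [ffun t => unemb (heads (loaded s c) (rb (inl (true, t))))]
  = [ffun t => scan (tapes c t)].
Proof.
apply/ffunP => t; rewrite !ffunE /heads /loaded rbK /scan.
by case: (tapes c t).2 => //= x r; apply: embK.
Qed.

Lemma exec_sim_step s c : ~~ halted (control c) ->
  exec sim_step 1 (loaded s c) true (loaded s (step c)).
Proof.
move=> /negPf nh; case Ed: (delta (control c) [ffun t => scan (tapes c t)]) => [q a].
have -> : loaded s (step c) = fun i => act (match krb i with
      | Some (inl (b, t)) => tape_op b (a t) (heads (loaded s c) (rb (inl (false,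
        t))))
      | Some (inr false) => Put (emb_state q)
      | _ => Keep
      end) (loaded s c i).
  apply: functional_extensionality => i; rewrite /step nh Ed /loaded.
  case Ei: (krb i) => [[[b t]|[]]|] //=.
  rewrite ffunE /heads rbK /tape_op /update.
  case: (tapes c t) (a t) => l r [x []]; case: b {Ei} => /=; case: l => [|y l] //=;
    by case: (r).
by apply: exec_act_ok; rewrite loaded_state emb_stateK loaded_scan Ed.
Qed.

(** The step count is not simulated: halted configurations are fixed, so stopping at the first
    halted state already gives the configuration at time [n]. *)
Lemma exec_sim_loop s c n : halted (control (iter n (@step M) c)) ->
  exec sim_loop n.*2.+1 (loaded s c) true (loaded s (iter n (@step M) c)).
Proof.
elim: n c => [|n IH] c.
  move=> /= h; apply: exec_while_done.
  by rewrite /sim_running loaded_state emb_stateK h.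
case h: (halted (control c)).
  have -> : iter n.+1 (@step M) c = c.
    by elim: (n.+1) => //= k ->; rewrite /step h.
  move=> _; apply: (@exec_leq _ _ _ 1) => //; apply: exec_while_done.
  by rewrite /sim_running loaded_state emb_stateK h.
rewrite iterSr doubleS => /IH; apply: (@exec_while_step _ _ _ _ 1).
  by rewrite /sim_running loaded_state emb_stateK h.
by apply: exec_sim_step; rewrite h.
Qed.

Definition clear_block : cmd I A :=
  While (fun h => [exists b, isSome (h (rb b))])
    (Act (fun _ => Some (fun i => if krb i is Some _ then Pop else Keep))).

(** All registers of the block are popped together, so only the longest one determines the time. *)
Lemma exec_clear_block n s : (forall b, size (s (rb b)) <= n) ->
  exec clear_block n.*2.+1 s true (fun i => if krb i is Some _ then [::] else s i).
Proof.
elim: n s => [|n IH] s Hs.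
  have E b : s (rb b) = [::] by apply: size0nil; apply/eqP; rewrite -leqn0.
  have -> : (fun i => if krb i is Some _ then [::] else s i) = s.
    apply: functional_extensionality => i; case Ei: (krb i) => [b|] //.
    by rewrite (krbK Ei) E.
  apply: exec_while_done; apply/existsP => -[b].
  by rewrite /heads E.
case h: [exists b, isSome (heads s (rb b))]; last first.
  have E b : s (rb b) = [::].
    have := negbT h; rewrite negb_exists => /forallP /(_ b).
    by rewrite /heads; case: (s _).
  have -> : (fun i => if krb i is Some _ then [::] else s i) = s.
    apply: functional_extensionality => i; case Ei: (krb i) => [b|] //.
    by rewrite (krbK Ei) E.
  by apply: (@exec_leq _ _ _ 1) => //; apply: exec_while_done; rewrite h.
rewrite doubleS; set s1 := fun i => act (if krb i is Some _ then Pop else Keep) (s i).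
apply: (@exec_while_step _ _ _ _ 1 _ _ s1) => //; first exact: exec_act_ok.
have -> : (fun i => if krb i is Some _ then [::] else s i)
        = (fun i => if krb i is Some _ then [::] else s1 i).
  by apply: functional_extensionality => i; rewrite /s1; case: (krb i).
by apply: IH => b; rewrite /s1 rbK /= size_behead; have := Hs b; case: (size _).
Qed.

(** A step lengthens a half tape by at most two cells: a left move adds one to the right half, and
    writing on an empty right half adds another. *)
Lemma size_tapes (xs : seq string) n m t b : (forall i, size (nth [::] xs i) <= m) ->
  size (if b : bool then (tapes (run M xs n) t).2 else (tapes (run M xs n) t).1)
    <= m + n.*2.
Proof.
move=> Hm; elim: n t b => [|n IH] t b.
  by rewrite /run /= ffunE addn0; case: b; rewrite //= size_map.
rewrite /run iterS -/(run M xs n) /step; case: (halted _).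
  by apply: leq_trans (IH t b) _; rewrite leq_add2l leq_double.
case: (delta _ _) => q a /=; rewrite ffunE.
have := IH t true; have := IH t false; rewrite /update.
case: (tapes _ t) => l r /=; case: (a t) => x [] /=; case: b;
  rewrite /= ?size_behead; lia.
Qed.

Definition tape_reg (k : nat) : I :=
  rb (if insub k is Some t then inl (true, t) else inr true).

Definition run_sim (P Q : I) : cmd I A :=
  Seq (xfer predT id P [:: tape_reg 0])
 (Seq (xfer predT id Q [:: tape_reg 1])
 (Seq (Act (fun _ => Some (fun i => if i == rb (inr false) then Push (emb_state
   (start M)) else Keep)))
      sim_loop)).

Definition base (v : B -> string) : store I A :=
  fun i => if i is inl r then map inl (v r) else [::].

Definition set2 (v : B -> string) (P Q : B) : B -> string :=
  fun r => if (r == P) || (r == Q) then [::] else v r.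

Lemma rb_eq b c : (rb b == rb c) = (b == c).
Proof. by rewrite (inj_eq (pcan_inj rbK)). Qed.

Lemma base_rb v b : base v (rb b) = [::]. Proof. by []. Qed.

(** Arguments are kept reversed because moving them letter by letter onto the tapes turns them
    round. *)
Lemma exec_run_sim v (P Q : B) z w n : P != Q -> v P = rev z -> v Q = rev w ->
  halted (control (run M [:: z; w] n)) ->
  exec (run_sim (inl P) (inl Q)) ((size z).*2 + (size w).*2 + n.*2 + 4) (base v) true
    (loaded (fun i => if i == rb (inr true) then
                        if 0 < ntapes M then [::] else map inl w
                      else base (set2 v P Q) i) (run M [:: z; w] n)).
Proof.
move=> PQ vP vQ hn.
set s0 := (fun i => if i == rb (inr true) then _ else _).
set s1 : store I A := fun i => if i == inl P then [::] else
   if i \in [:: tape_reg 0] then catrev (map id (map inl (rev z))) (base v i) else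
     base v i.
set s2 : store I A := fun i => if i == inl Q then [::] else
   if i \in [:: tape_reg 1] then catrev (map id (map inl (rev w))) (s1 i) else s1 i.
have Es : loaded s0 (init M [:: z; w])
    = (fun i => act (if i == rb (inr false) then Push (emb_state (start M)) else
      Keep) (s2 i)).
  apply: functional_extensionality => i.
  rewrite /s2 /s1 /s0 !inE !map_id !map_rev !catrevE !revK; case: i => [r|j].
    rewrite /loaded /= /set2 !(inj_eq inl_inj).
    by case: (r == Q); case: (r == P).
  case Ej: (krb (inr j)) => [b|]; last first.
    have nj b : (inr j == rb b :> I) = false.
      by apply/negP => /eqP E; rewrite E rbK in Ej.
    by rewrite /loaded Ej /tape_reg !nj.
  have E0 : insub 0 = Some ord0 :> option 'I_(ntapes M).+1.
    by rewrite insubT //=; congr Some; exact: val_inj.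
  rewrite (krbK Ej) /loaded rbK /tape_reg E0 !rb_eq base_rb {j Ej E0}.
  case: b => [[b t]|[]] /=.
  - rewrite ffunE; case: b; last by case: insubP.
    have tE (u : 'I_(ntapes M).+1) :
      (inl (true, t) == inl (true, u) :> block) = (t == u :> nat) by [].
    rewrite tE; case: insubP => [t1 _ Et1|] /=.
      rewrite tE Et1; case: t {tE} => -[|[|k]] lt_k //=;
      by rewrite ?cats0 ?nth_nil -?map_comp.
    rewrite ltnS -leqNgt => t0; case: t {tE} => -[|k] lt_k /=; last by lia.
    by rewrite ?cats0 -?map_comp.
  - case: insubP => [t1 lt1 Et1|]; first by rewrite /= -ltnS lt1.
    rewrite ltnS -leqNgt leqNgt => /negPf->; by rewrite /= cats0.
  - by case: insubP.
have -> : (size z).*2 + (size w).*2 + n.*2 + 4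
   = (size z).*2.+1 + ((size w).*2.+1 + (1 + n.*2.+1)) by lia.
apply: (@exec_seq _ _ _ _ _ _ _ s1).
  have := @exec_xfer _ _ predT id (inl P) [::
    tape_reg 0] (base v) (map inl (rev z)) [::].
  by rewrite size_map size_rev; apply; rewrite ?all_predT //= ?cats0 ?vP // !inE.
apply: (@exec_seq _ _ _ _ _ _ _ s2).
  have := @exec_xfer _ _ predT id (inl Q) [:: tape_reg 1] s1 (map inl (rev w)) [::].
  rewrite size_map size_rev; apply; rewrite ?all_predT //= ?cats0 ?inE //.
  by rewrite /s1 inE (inj_eq inl_inj) eq_sym (negPf PQ) /= vQ.
apply: exec_seq; first exact: exec_act_ok.
by rewrite -Es; apply: exec_sim_loop.
Qed.

Lemma clear_loaded s c n : (forall t b,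
    size (if b : bool then (tapes c t).2 else (tapes c t).1) <= n) ->
  size (s (rb (inr true))) <= n ->
  exec clear_block n.*2.+3 (loaded s c) true
    (fun i => if krb i is Some _ then [::] else s i).
Proof.
move=> Hn Hs; have := @exec_clear_block n.+1 (loaded s c).
have -> : (fun i => if krb i is Some _ then [::] else loaded s c i)
        = (fun i => if krb i is Some _ then [::] else s i).
  by apply: functional_extensionality => i; rewrite /loaded; case: (krb i).
apply=> -[[b t]|[]]; rewrite /loaded rbK //=; last exact: leqW.
by rewrite size_map; apply: leqW; apply: (Hn t b).
Qed.

Definition accept_check : cmd I A :=
  Act (fun h => if unemb_state (h (rb (inr false))) is Some q then
                  if accepting q then Some (fun=> Keep) else None
                else None).

Definition call_decider (P Q : B) : cmd I A :=
  Seq (run_sim (inl P) (inl Q)) (Seq accept_check clear_block).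

(** A rejecting run makes the whole program fail, so only an accepting one has to leave a clean
    store for the next call. *)
Lemma exec_call_decider v P Q z w n : P != Q -> v P = rev z -> v Q = rev w ->
  halted (control (run M [:: z; w] n)) ->
  exists s', exec (call_decider P Q) (6 * (size z + size w + n) + 10) (base v)
      (accepting (control (run M [:: z; w] n))) s' /\
    (accepting (control (run M [:: z; w] n)) -> s' = base (set2 v P Q)).
Proof.
move=> PQ vP vQ hn; have Er := exec_run_sim PQ vP vQ hn.
set s0 := (fun i => if i == rb (inr true) then _ else _) in Er.
set k := run M [:: z; w] n in hn Er *.
case acc: (accepting (control k)); last first.
  exists (loaded s0 k); split=> //.
  apply: (@exec_leq _ _ _ ((size z).*2 + (size w).*2 + n.*2 + 4 + 1)); first by lia.
  apply: exec_seq Er _; apply: exec_seq_fail; apply: exec_act_fail.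
  by rewrite loaded_state emb_stateK acc.
exists (base (set2 v P Q)); split=> //.
pose m := size z + size w.
apply: (@exec_leq _ _ _
   ((size z).*2 + (size w).*2 + n.*2 + 4 + (1 + (m + n.*2).*2.+3))); first by lia.
apply: exec_seq Er _; apply: (@exec_seq _ _ _ _ _ _ _ (loaded s0 k)).
  have /= := @exec_act_ok I A (fun h => if unemb_state (h (rb (inr false))) is Some q
    then
                  if accepting q then Some (fun=> Keep) else None
                else None) (loaded s0 k) (fun=> Keep).
  by rewrite loaded_state emb_stateK acc => /(_ erefl).
have -> : base (set2 v P Q) = (fun i => if krb i is Some _ then [::] else s0 i).
  apply: functional_extensionality => -[r|j]; first by [].
  case Ej: (krb (inr j)) => [b|] //; rewrite /s0; case: eqP => // E.
  by rewrite E rbK in Ej.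
apply: clear_loaded => [t b|].
  by apply: size_tapes => -[|[|i]]; rewrite /= ?nth_nil /m ?leq_addr ?leq_addl.
by rewrite /s0 eqxx; case: ifP => _ //; rewrite size_map /m; lia.
Qed.

Definition is_letter (a : A) : bool := if a is inl _ then true else false.

Lemma map_emb_read r : exists r',
  map emb r = map inl (read r) ++ r' /\ ~~ top_sat is_letter r'.
Proof.
elim: r => [|x r [r' [Er nr]]]; first by exists [::].
case: x => [[a|g]|] /=; last by exists (inr None :: map emb r).
- by exists r'; rewrite Er.
- by exists (inr (Some (jg (inl g))) :: map emb r).
Qed.

Lemma size_read (T : finType) (r : seq (symbol T)) : size (read r) <= size r.
Proof. by elim: r => //= -[[a|g]|] r IH //=; apply: leqW. Qed.

(** The output is parked on [T] while the block is cleared; being transferred twice, it regains its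
    order. *)
Definition call_function (P Q T R : B) : cmd I A :=
  Seq (run_sim (inl P) (inl Q))
 (Seq (xfer is_letter id (rb (inl (true, ord_max))) [:: inl T])
 (Seq clear_block
      (xfer predT id (inl T) [:: inl R]))).

Lemma exec_call_function v P Q T R z n :
  uniq [:: P; Q; T; R] -> v P = rev z -> v Q = [::] -> v T = [::] -> v R = [::] ->
  halted (control (run M [:: z] n)) ->
  exec (call_function P Q T R) (20 * (size z + n) + 10) (base v) true
    (base (fun r => if r == R then output (run M [:: z] n)
                    else if r == P then [::] else v r)).
Proof.
rewrite /= !inE !negb_or => /andP[/and3P[PQ PT PR] /andP[/andP[QT QR] /andP[TR _]]].
move=> vP vQ vT vR hn.
(* A missing argument and an empty one give the same initial tape, so the two-argument simulation
   applies. *)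
have Ei : init M [:: z] = init M [:: z; [::]].
  by rewrite /init; congr Config; apply/ffunP => t; rewrite !ffunE; case:
    (val t) => [|[|[|]]].
have {}Ei : run M [:: z] n = run M [:: z; [::]] n by rewrite /run Ei.
rewrite Ei in hn *.
have Er := exec_run_sim (w := [::]) PQ vP vQ hn; rewrite addn0 in Er.
set s0 := (fun i => if i == rb (inr true) then _ else _) in Er.
set k := run M [:: z; [::]] n in hn Er *; set y := output k.
have Es0 : s0 = base (set2 v P Q).
  apply: functional_extensionality => i; rewrite /s0; case: eqP => // ->.
  by case: ifP.
have [r' [Ey nr]] := map_emb_read (tapes k ord_max).2.
rewrite -/(output k) -/y in Ey.
have le_tapes t b : size (if b : bool then (tapes k t).2 else (tapes k t).1)
    <= size z + n.*2.
  by apply: size_tapes => -[|[|[|i]]] //=; rewrite nth_nil.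
have le_y : size y <= size z + n.*2.
  by apply: leq_trans (le_tapes ord_max true); apply: size_read.
pose o := rb (inl (true, ord_max)).
pose s1 : store I A := fun i => if i == o then r' else
  if i \in [:: inl T] then catrev (map id (map inl y)) (loaded s0 k i) else loaded s0
    k i.
pose v2 := (fun r => if r == T then rev y else set2 v P Q r).
apply: (@exec_leq _ _ _ ((size z).*2 + n.*2 + 4
  + ((size y).*2.+1 + ((size z + n.*2).*2.+3 + (size y).*2.+1)))); first by lia.
apply: exec_seq Er _; apply: (@exec_seq _ _ _ _ _ _ _ s1).
  have := @exec_xfer _ _ is_letter id o [:: inl T] (loaded s0 k) (map inl y) r'.
  rewrite size_map; apply => //; first by rewrite /loaded rbK.
  by elim: (y).
apply: (@exec_seq _ _ _ _ _ _ _ (base v2)).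
  pose c' := @Config M (control k)
    [ffun t => ((tapes k t).1, if t == ord_max then [::] else (tapes k t).2)].
  have -> : base v2 = (fun i => if krb i is Some _ then [::] else s1 i).
    apply: functional_extensionality => -[r|j].
      rewrite /s1 /loaded /= inE (inj_eq inl_inj) Es0 /v2 /=.
      case: eqP => // -> /=; rewrite map_id catrevE map_rev /base /set2.
      by rewrite vT if_same cats0.
    case Ej: (krb (inr j)) => [b|] //; rewrite /s1 inE /=.
    case: eqP => [E|_]; last by rewrite /loaded Ej Es0.
    by rewrite E rbK in Ej.
  have := @exec_clear_block (size z + n.*2).+1 s1.
  apply=> -[[b t]|[]]; rewrite /s1 inE /=.
  - case: eqP => [_|_].
      have := le_tapes ord_max true; rewrite /= -(size_map emb) Ey size_cat => H.
      by apply: leqW; apply: leq_trans H; rewrite leq_addl.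
    by rewrite /loaded rbK size_map leqW ?(le_tapes t b).
  - by rewrite /o rb_eq /= /loaded rbK Es0.
  - by rewrite /o rb_eq /= /loaded rbK.
have := @exec_xfer _ _ predT id (inl T) [:: inl R] (base v2) (map inl (rev y)) [::].
rewrite size_map size_rev map_id => H.
have -> : base (fun r => if r == R then y else if r == P then [::] else v r) = 
  (fun i => if i == inl T then [::] else
     if i \in [:: inl R] then catrev (map inl (rev y)) (base v2 i) else base v2 i).
  apply: functional_extensionality => -[r|j]; last by [].
  rewrite inE !(inj_eq inl_inj) /= /v2 /set2; case: (r =P T) => [->|rT].
    by rewrite (negPf TR) vT if_same.
  case: (r =P R) => [->|rR].
    by rewrite vR if_same catrevE -map_rev revK cats0.
  by case: (r =P Q) => [->|_]; rewrite ?orbF // vQ orbT if_same.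
apply: H; rewrite ?all_predT // ?inE ?(inj_eq inl_inj) //= /v2 eqxx cats0 //.
Qed.

End Simulation.

(** * Programs on the working registers *)

(* The registers hold: the input [rX]; the certificate [rY]; the string being cut
   [rS]; the arguments [rP] and [rQ] of a simulated machine; the base solution [rU0]
   and a scenario solution [rU1]; the list [rL] of their differences; the bound in
   unary [rM], its part already used [rN], and in binary [rK]; the unary value of a
   polynomial [rC].  The others are scratch. *)
Definition nb := 16.
Definition rX : 'I_nb := @Ordinal nb 0 isT.
Definition rY : 'I_nb := @Ordinal nb 1 isT.
Definition rS : 'I_nb := @Ordinal nb 2 isT.
Definition rP : 'I_nb := @Ordinal nb 3 isT.
Definition rQ : 'I_nb := @Ordinal nb 4 isT.
Definition rP2 : 'I_nb := @Ordinal nb 5 isT.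
Definition rU0 : 'I_nb := @Ordinal nb 6 isT.
Definition rU1 : 'I_nb := @Ordinal nb 7 isT.
Definition rL : 'I_nb := @Ordinal nb 8 isT.
Definition rM : 'I_nb := @Ordinal nb 9 isT.
Definition rN : 'I_nb := @Ordinal nb 10 isT.
Definition rT : 'I_nb := @Ordinal nb 11 isT.
Definition rA : 'I_nb := @Ordinal nb 12 isT.
Definition rK : 'I_nb := @Ordinal nb 13 isT.
Definition rC : 'I_nb := @Ordinal nb 14 isT.
Definition rD : 'I_nb := @Ordinal nb 15 isT.

(** * Judgments on programs over string registers *)

Section BaseLogic.

Variables (J G : finType).
Local Notation I := ('I_nb + J)%type.
Local Notation sym := (token + option G)%type.
Local Notation prog := (cmd I sym).
Implicit Types (b : ('I_nb -> option token) -> bool) (v : seq string) (c : prog) (R :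
  seq string -> Prop).

Definition fn v : 'I_nb -> string := fun r => nth [::] v r.
Definition bs v : store I sym := @base _ J G (fn v).

(** [sound] concerns arbitrary data: within [t] steps the program fails or succeeds with [R]. [succ]
    records a successful run of unspecified length. In all three, the registers of the simulated
    machines are empty at the start and after success. *)
Definition det c v t v' := exec c t (bs v) true (bs v').
Definition succ c v v' := exists t, det c v t v'.
Definition sound c v t R := exists (b : bool) s', exec c t (bs v) b s' /\
  (b -> exists2 v', s' = bs v' & R v').

Lemma fn_set v (r : 'I_nb) w i :
  fn (set_nth [::] v r w) i = if i == r then w else fn v i.
Proof. by rewrite /fn nth_set_nth /=. Qed.

Lemma bs_eq v v' : fn v =1 fn v' -> bs v = bs v'.
Proof. by move=> E; apply: functional_extensionality => -[r|j] //=; rewrite E. Qed.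

Lemma det_succ c v t v' : det c v t v' -> succ c v v'.
Proof. by exists t. Qed.

Lemma det_seq c1 c2 v t1 t2 v1 v2 :
  det c1 v t1 v1 -> det c2 v1 t2 v2 -> det (Seq c1 c2) v (t1 + t2) v2.
Proof. exact: exec_seq. Qed.

Lemma det_leq c v t t' v' : t <= t' -> det c v t v' -> det c v t' v'.
Proof. exact: exec_leq. Qed.

Lemma sound_det c v t v' R : det c v t v' -> R v' -> sound c v t R.
Proof. by move=> H Rv; exists true, (bs v'); split=> //; exists v'. Qed.

(** Different lists may denote the same store, for instance by padding with empty strings, so [R']
    may be established for another list. *)
Lemma sound_leq c v t t' R R' :
  t <= t' -> (forall v', R v' -> exists2 v'', bs v' = bs v'' & R' v'') ->
  sound c v t R -> sound c v t' R'.
Proof.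
move=> le_t HR [b [s' [H Hb]]]; exists b, s'; split; first exact: exec_leq H.
by move=> /Hb[v' -> /HR].
Qed.

Lemma sound_weak c v t t' R R' :
  t <= t' -> (forall v', R v' -> R' v') -> sound c v t R -> sound c v t' R'.
Proof. by move=> le_t HR; apply: sound_leq => // v' /HR; exists v'. Qed.

Lemma sound_seq c1 c2 v t1 t2 R1 R :
  sound c1 v t1 R1 -> (forall v1, R1 v1 -> sound c2 v1 t2 R) ->
  sound (Seq c1 c2) v (t1 + t2) R.
Proof.
move=> [[] [s1 [H1 Hb]]] H2; last first.
  exists false, s1; split=> //; apply: exec_leq (exec_seq_fail _ H1).
  exact: leq_addr.
have [v1 E1 /H2[b [s' [H3 Hb3]]]] := Hb isT; exists b, s'; split=> //.
by rewrite E1 in H1; apply: exec_seq H1 H3.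
Qed.

Lemma succ_seq c1 c2 v v1 v2 :
  succ c1 v v1 -> succ c2 v1 v2 -> succ (Seq c1 c2) v v2.
Proof. by move=> [t1 H1] [t2 H2]; exists (t1 + t2); apply: det_seq H1 H2. Qed.

(** By determinism the successful run is the one described by [sound]; the stores then agree, though
    not necessarily the lists. *)
Lemma sound_succ c v t R v' : sound c v t R -> succ c v v' ->
  exists2 v'', bs v' = bs v'' & R v''.
Proof.
move=> [b [s' [H Hb]]] [t' H']; have [Eb Es] := exec_inj H H'.
by move: Hb; rewrite Eb Es => /(_ isT).
Qed.

Definition tok (a : option sym) : option token :=
  if a is Some (inl x) then Some x else None.

Definition map_op (o : op token) : op sym :=
  match o with
  | Keep => Keep | Pop => Pop | Put a => Put (inl a) | Push a => Push (inl a)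
  | Put2 a b => Put2 (inl a) (inl b)
  end.

Definition ops (l : seq ('I_nb * op token)) (i : I) : op sym :=
  if i is inl r then map_op (nth Keep (map snd l) (index r (map fst l))) else Keep.

Definition bact (f : ('I_nb -> option token) -> option (seq ('I_nb * op token))) :
  prog :=
  Act (fun h => omap ops (f (fun r => tok (h (inl r))))).

Definition bcond (b : ('I_nb -> option token) -> bool) : prog -> prog -> prog :=
  Cond (fun h => b (fun r => tok (h (inl r)))).

Definition bwhile (b : ('I_nb -> option token) -> bool) : prog -> prog :=
  While (fun h => b (fun r => tok (h (inl r)))).

Definition tops v : 'I_nb -> option token := fun r => ohead (nth [::] v r).

Definition upd (l : seq ('I_nb * op token)) v : seq string :=
  foldr (fun (x : 'I_nb * op token) v => set_nth [::] v x.1 (act x.2 (nth [::] v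
    x.1))) v l.

Lemma tok_heads v : (fun r => tok (heads (bs v) (inl r))) = tops v.
Proof.
apply: functional_extensionality => r; rewrite /heads /tops /= /fn.
by case: (nth _ _ _).
Qed.

(** [upd] composes all entries of a register while the lookup takes the first one; they agree when
    no register is listed twice. *)
Lemma fn_upd l v r : uniq (map fst l) ->
  fn (upd l v) r = act (nth Keep (map snd l) (index r (map fst l))) (fn v r).
Proof.
elim: l => //= -[q o] l IH /= /andP[nq ul]; rewrite fn_set.
have {}IH := IH ul; rewrite eq_sym; case: eqP => [E|_]; last exact: IH.
subst q; rewrite -[nth _ _ _]/(fn (upd l v) r) IH.
have Ei : index r (map fst l) = size (map snd l).
  by rewrite [RHS]size_map -[RHS](size_map fst); apply: memNindex nq.
by rewrite Ei nth_default.
Qed.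

Lemma det_act f v l : f (tops v) = Some l -> uniq (map fst l) ->
  det (bact f) v 1 (upd l v).
Proof.
move=> E ul; rewrite /det.
have -> : bs (upd l v) = (fun i => act (ops l i) (bs v i)).
  apply: functional_extensionality => -[r|j] //=; rewrite fn_upd //.
  by case: (nth _ _ _) => [||a|a|a b] //=; case: (fn v r).
by apply: exec_act_ok; rewrite tok_heads E.
Qed.

Lemma sound_act f v R :
  (if f (tops v) is Some l then uniq (map fst l) /\ R (upd l v) else True) ->
  sound (bact f) v 1 R.
Proof.
case E: (f (tops v)) => [l|] H.
  by case: H => ul Rl; apply: sound_det Rl; apply: det_act.
by exists false, (bs v); split=> //; apply: exec_act_fail; rewrite tok_heads E.
Qed.

Lemma succ_act f v l : f (tops v) = Some l -> uniq (map fst l) ->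
  succ (bact f) v (upd l v).
Proof. by move=> E ul; exists 1; apply: det_act. Qed.

Lemma sound_cond b c1 c2 v t R :
  sound (if b (tops v) then c1 else c2) v t R -> sound (bcond b c1 c2) v t.+1 R.
Proof.
move=> [r [s' [H Hr]]]; exists r, s'; split=> //.
by apply: exec_cond; rewrite tok_heads.
Qed.

Lemma succ_cond b c1 c2 v v' :
  succ (if b (tops v) then c1 else c2) v v' -> succ (bcond b c1 c2) v v'.
Proof. by move=> [t H]; exists t.+1; apply: exec_cond; rewrite tok_heads. Qed.

Lemma det_while_done b c v : ~~ b (tops v) -> det (bwhile b c) v 1 v.
Proof. by move=> nb'; apply: exec_while_done; rewrite tok_heads. Qed.

Lemma det_while_step b c v t1 t2 v1 v2 : b (tops v) ->
  det c v t1 v1 -> det (bwhile b c) v1 t2 v2 ->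
  det (bwhile b c) v (t1 + t2).+1 v2.
Proof. by move=> hb; apply: exec_while_step; rewrite tok_heads. Qed.

Lemma succ_while_done b c v : ~~ b (tops v) -> succ (bwhile b c) v v.
Proof. by move/det_while_done => H; exists 1. Qed.

Lemma succ_while_step b c v v1 v2 : b (tops v) ->
  succ c v v1 -> succ (bwhile b c) v1 v2 -> succ (bwhile b c) v v2.
Proof.
move=> hb [t1 H1] [t2 H2]; exists (t1 + t2).+1.
exact: det_while_step H1 H2.
Qed.

(** The index of the invariant is a strictly decreasing variant, so a common bound [t] on the rounds
    bounds the whole loop. *)
Lemma sound_while b c (Inv : nat -> seq string -> Prop) t v k :
  (forall k' v', Inv k' v' -> b (tops v') ->
     sound c v' t (fun v'' => exists2 k'', k'' < k' & Inv k'' v'')) ->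
  Inv k v ->
  sound (bwhile b c) v (k.+1 * t.+1).+1
    (fun v' => ~~ b (tops v') /\ exists2 k', k' <= k & Inv k' v').
Proof.
move=> step; elim/ltn_ind: k v => k IH v Hv.
case hb: (b (tops v)); last first.
  apply: (@sound_det _ _ _ v); last by rewrite hb; split=> //; exists k.
  by apply: (@det_leq _ _ 1) => //; apply: det_while_done; rewrite hb.
have [r [s1 [H1 Hr]]] := step k v Hv hb.
case: r H1 Hr => H1 Hr; last first.
  exists false, s1; split=> //; apply: (@exec_leq _ _ _ t.+1); first by lia.
  by apply: exec_while_fail H1; rewrite tok_heads.
have [v1 E1 [k1 lt_k Hv1]] := Hr isT; subst s1.
have [r [s2 [H2 Hr2]]] := IH k1 lt_k v1 Hv1.
exists r, s2; split; last first.
  by move=> /Hr2[v2 -> [nb' [k2 le_k Hv2]]]; exists v2 => //; split=> //;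
    exists k2 => //; lia.
apply: (@exec_leq _ _ _ (t + (k1.+1 * t.+1).+1).+1); first by nia.
by apply: (exec_while_step _ H1) => //; rewrite tok_heads.
Qed.

End BaseLogic.

(** * Moving words and reading the certificate *)

Section Moves.

Variables (J G : finType).
Local Notation prog := (cmd ('I_nb + J)%type (token + option G)%type).
Implicit Types (v : seq string) (c : prog) (src : 'I_nb) (ds : seq 'I_nb).

Definition pushes ds (w : string) v : seq string :=
  foldr (fun (d : 'I_nb) v' => set_nth [::] v' d (w ++ nth [::] v d)) v ds.

Lemma fn_pushes ds w v r :
  fn (pushes ds w v) r = if r \in ds then w ++ fn v r else fn v r.
Proof.
by elim: ds => //= d ds IH; rewrite fn_set inE IH; case: eqP => //= ->.
Qed.

Definition move_ops (f : token -> token) src ds (h : 'I_nb -> option token) :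
    seq ('I_nb * op token) :=
  if h src is Some a then (src, Pop) :: [seq (d, Push (f a)) | d <- ds] else [::].

Lemma unzip1_const (T1 T2 : Type) (y : T2) (xs : seq T1) :
  map fst [seq (x, y) | x <- xs] = xs.
Proof. by elim: xs => //= x xs ->. Qed.

Lemma uniq_move_ops f src ds h :
  uniq (src :: ds) -> uniq (map fst (move_ops f src ds h)).
Proof. by rewrite /move_ops; case: (h src) => //= a; rewrite unzip1_const. Qed.

Lemma fn_move f src ds v r : uniq (src :: ds) ->
  fn (upd (move_ops f src ds (tops v)) v) r =
    if r == src then behead (fn v r) else
    if r \in ds then map f (take 1 (fn v src)) ++ fn v r else fn v r.
Proof.
move=> u; rewrite fn_upd ?uniq_move_ops // /move_ops /tops -/(fn v src).
case Es: (fn v src) => [|a w] /=.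
  by case: eqP => [->|]; rewrite ?Es // if_same.
rewrite unzip1_const eq_sym take0; case: eqP => //= _.
elim: (ds) => //= d ds' IH; rewrite inE eq_sym.
by case: eqP.
Qed.

Definition bmv f src ds : prog := bact J G (fun h => Some (move_ops f src ds h)).

Lemma det_bmv f src ds v : uniq (src :: ds) ->
  det (bmv f src ds) v 1 (upd (move_ops f src ds (tops v)) v).
Proof. by move=> u; apply: det_act => //; apply: uniq_move_ops. Qed.

Definition bxfer (p : token -> bool) f src ds : prog :=
  bwhile (fun h => if h src is Some a then p a else false) (bmv f src ds).

Lemma det_eq c v t v1 v2 : fn v1 =1 fn v2 -> det c v t v1 -> det c v t v2.
Proof. by move=> /(bs_eq J G) E; rewrite /det E. Qed.

Lemma det_bxfer p f src ds v w r : nth [::] v src = w ++ r ->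
  all p w -> ~~ top_sat p r -> uniq (src :: ds) ->
  det (bxfer p f src ds) v (size w).*2.+1
    (set_nth [::] (pushes ds (rev (map f w)) v) src r).
Proof.
move=> + + nr u; elim: w v => [|a w IH] v Es.
  move=> _; apply: (@det_eq _ _ _ v) => [i|].
    by rewrite fn_set fn_pushes if_same; case: eqP => // ->; rewrite /fn Es.
  by apply: det_while_done; rewrite /tops Es; case: (r) nr.
move=> /andP[pa pw]; rewrite doubleS.
have := det_bmv f v u; set v1 := upd _ v => H1.
have F i := fn_move f v i u; rewrite -/v1 /fn Es /= take0 in F.
have E1 : nth [::] v1 src = w ++ r by rewrite F eqxx Es.
apply: (@det_while_step _ _ _ _ _ 1 _ v1) => //; first by rewrite /tops Es.
apply: det_eq (IH v1 E1 pw) => i; rewrite !fn_set !fn_pushes.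
case: eqP => // /eqP ni; rewrite /fn F (negPf ni) /= rev_cons cat_rcons.
by case: (i \in ds).
Qed.

Definition bmove src ds : prog := bxfer predT id src ds.

Lemma det_bmove src ds v : uniq (src :: ds) ->
  det (bmove src ds) v (size (nth [::] v src)).*2.+1
    (set_nth [::] (pushes ds (rev (nth [::] v src)) v) src [::]).
Proof.
move=> u; have := @det_bxfer predT id src ds v (nth [::] v src) [::].
by rewrite map_id; apply; rewrite ?cats0 ?all_predT.
Qed.

Lemma succ_bmove src ds v : uniq (src :: ds) -> succ (bmove src ds) v
    (set_nth [::] (pushes ds (rev (nth [::] v src)) v) src [::]).
Proof. by move=> u; apply: det_succ; apply: det_bmove. Qed.

Lemma succ_eq c v v1 v2 : fn v1 =1 fn v2 -> succ c v v1 -> succ c v v2.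
Proof. by move=> E [t H]; exists t; apply: det_eq H. Qed.

Definition pop_if (t : option token -> bool) (r : 'I_nb) : prog :=
  bact J G (fun h => if t (h r) then Some [:: (r, Pop)] else None).

Definition reads (a : token) (x : option token) : bool := x == Some a.

(* The register [rY] acts as an oracle: a block [true^k false] on it asks for
   [k] symbols of [src] to be moved.  When [src] is [rY] itself, it is a listing of
   the moved symbols, each announced by [true]. *)
Definition fetch src ds : prog :=
  Seq (bwhile (fun h => reads (Bit true) (h rY))
         (Seq (bact J G (fun _ => Some [:: (rY, Pop)])) (bmv id src ds)))
      (pop_if (reads (Bit false)) rY).

Lemma det_pop (r : 'I_nb) v :
  det (bact J G (fun _ => Some [:: (r, Pop)])) v 1 (upd [:: (r, Pop)] v).
Proof. exact: det_act. Qed.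

Lemma fn_pop (r : 'I_nb) v i : fn (upd [::
  (r, Pop)] v) i = if i == r then behead (fn v i) else fn v i.
Proof. by rewrite /= fn_set; case: eqP => // ->. Qed.

Lemma sound_pop_if (t : option token -> bool) (r : 'I_nb) v (k : nat) (R :
  seq string -> Prop) : 0 < k -> (t (ohead (nth [::] v r)) -> R (upd [::
    (r, Pop)] v)) ->
  sound (pop_if t r) v k R.
Proof.
move=> k0 H; apply: (sound_weak k0 (fun _ => id)); apply: sound_act.
by rewrite /tops; case: ifP => // /H.
Qed.

Lemma succ_pop_if (t : option token -> bool) (r : 'I_nb) v :
  t (ohead (nth [::] v r)) ->
  succ (pop_if t r) v (upd [:: (r, Pop)] v).
Proof. by move=> H; apply: succ_act; rewrite // /tops H. Qed.

(** When [src] is [rY], popping the announcement uncovers the symbol to be moved; thus both uses of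
    [fetch] share this step. *)
Lemma det_fetch_body src ds v : uniq (src :: ds) -> rY \notin ds ->
  exists v', det (Seq (bact J G (fun _ => Some [::
    (rY, Pop)])) (bmv id src ds)) v 2 v' /\
   forall i, fn v' i =
    let w := if src == rY then behead (fn v rY) else fn v src in
    if i == src then behead w else
    if i == rY then behead (fn v rY) else
    if i \in ds then take 1 w ++ fn v i else fn v i.
Proof.
move=> u Yds; eexists; split; first exact: det_seq (det_pop rY v) (det_bmv id _ u).
move=> i; rewrite fn_move // !fn_pop map_id.
case: (i =P src) => [->|_] /=; first by case: eqP => // ->.
rewrite (fun_if (fun x => take 1 x)).
case: (i =P rY) => [->|_]; first by rewrite (negPf Yds).
by case: (src =P rY) => [->|].
Qed.

Lemma reads_ohead a (w : string) : reads a (ohead w) -> w = a :: behead w.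
Proof. by case: w => // x w /eqP[->]. Qed.

(** A count exceeding the length of [src] merely empties it. The closing bit must be read, so the
    certificate gets strictly shorter, which makes its length a variant for the loop over the
    scenarios. *)
Lemma sound_fetch src ds v : src != rY -> rY \notin ds -> uniq (src :: ds) ->
  sound (fetch src ds) v (4 * size (nth [::] v rY) + 10) (fun v' => exists w r y,
    [/\ nth [::] v src = w ++ r, size y < size (nth [::] v rY) &
        v' = set_nth [::] (set_nth [::] (pushes ds (rev w) v) src r) rY y]).
Proof.
move=> sY Yds u.
pose Inv k v1 := exists w r y, [/\ nth [::] v src = w ++ r, size y = k,
   k <= size (nth [::] v rY) &
   fn v1 =1 fn (set_nth [::] (set_nth [::] (pushes ds (rev w) v) src r) rY y)].
apply: (@sound_weak _ _ _ _ (((size (nth [::] v rY)).+1 * 3).+1 + 1)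
  _ _ _ _ (fun v' H => H)); first by lia.
apply: sound_seq.
  apply: (@sound_while _ _ _ _ Inv); last first.
    exists [::], (nth [::] v src), (nth [::] v rY); split=> // i.
    rewrite !fn_set fn_pushes /=; case: eqP => [->|_] //.
    by case: eqP => [->|_] //; rewrite if_same.
  move=> k v1 [w [r [y [Es Ek le_k Ev]]]] hY.
  have Yv1 : fn v1 rY = y by rewrite Ev fn_set eqxx.
  have {hY} := reads_ohead hY; rewrite -/(fn v1 rY) Yv1 => Ey.
  have [v2 [H2 F2]] := det_fetch_body v1 u Yds.
  apply: sound_det H2 _; exists (size y).-1; first by rewrite -Ek Ey.
  exists (w ++ take 1 r), (behead r), (behead y); split=> //.
  - by rewrite Es -catA; case: (r) => //= a r'; rewrite take0.
  - by rewrite size_behead.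
  - by lia.
  move=> i; rewrite F2 (negPf sY) !fn_set !Ev !fn_set !fn_pushes !eqxx (negPf sY) /=.
  case: (i =P src) => [->|_]; first by rewrite (negPf sY).
  case: (i == rY) => //; rewrite rev_cat /= -catA.
  by case: (i \in ds) => //; case: (r) => //= a r'; rewrite take0.
move=> v1 [_ [k le_k [w [r [y [Es Ek le_k' Ev]]]]]].
apply: (@sound_leq _ _ _ _ 1 _ (fun v' => v' = upd [:: (rY, Pop)] v1 /\
  nth [::] v1 rY <> [::])) => //.
  move=> v' [-> ne]; exists (set_nth [::] (set_nth [::] (pushes ds (rev w) v) src r)
    rY (behead y)).
    apply: bs_eq => i; rewrite fn_pop Ev !fn_set.
    by case: (i =P rY).
  exists w, r, (behead y); split=> //; rewrite size_behead.
  have : 0 < size y; last by lia.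
  move: ne; rewrite -/(fn v1 rY) Ev fn_set eqxx; by case: (y).
by apply: sound_pop_if => // /reads_ohead E; split=> //; rewrite E.
Qed.

(** A loaded word is taken from the certificate, which bounds its length without any check. *)
Lemma sound_load ds v : rY \notin ds -> uniq ds ->
  sound (fetch rY ds) v (4 * size (nth [::] v rY) + 10) (fun v' => exists w y,
    size w + size y < size (nth [::] v rY) /\
    v' = set_nth [::] (pushes ds (rev w) v) rY y).
Proof.
move=> Yds u; have uY : uniq (rY :: ds) by rewrite /= Yds.
pose Inv k v1 := exists w y, [/\ size w + size y <= size (nth [::] v rY), size y = k &
   fn v1 =1 fn (set_nth [::] (pushes ds (rev w) v) rY y)].
apply: (@sound_weak _ _ _ _ (((size (nth [::] v rY)).+1 * 3).+1 + 1)
  _ _ _ _ (fun v' H => H)); first by lia.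
apply: sound_seq.
  apply: (@sound_while _ _ _ _ Inv); last first.
    exists [::], (nth [::] v rY); split=> // i.
    rewrite !fn_set fn_pushes /=; case: eqP => [->|_] //.
    by rewrite if_same.
  move=> k v1 [w [y [le_k Ek Ev]]] hY.
  have Yv1 : fn v1 rY = y by rewrite Ev fn_set eqxx.
  have {hY} := reads_ohead hY; rewrite -/(fn v1 rY) Yv1 => Ey.
  have [v2 [H2 F2]] := det_fetch_body v1 uY Yds.
  have sy : size (take 1 (behead y)) + size (behead (behead y)) < size y.
    by rewrite Ey /=; case: (behead y) => //= a y'; rewrite take0.
  apply: sound_det H2 _; exists (size (behead (behead y))).
    by rewrite -Ek; apply: leq_ltn_trans sy; apply: leq_addl.
  exists (w ++ take 1 (behead y)), (behead (behead y)); split=> //.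
  - by rewrite size_cat; lia.
  move=> i; rewrite F2 eqxx !fn_set !Ev !fn_set !fn_pushes !eqxx /=.
  case: (i =P rY) => [_|_] //; rewrite rev_cat /= -catA.
  by case: (i \in ds) => //; case: (behead y) => //= a r'; rewrite take0.
move=> v1 [_ [k _ [w [y [le_k' _ Ev]]]]].
apply: (@sound_leq _ _ _ _ 1 _ (fun v' => v' = upd [:: (rY, Pop)] v1 /\
  nth [::] v1 rY <> [::])) => //.
  move=> v' [-> ne]; exists (set_nth [::] (pushes ds (rev w) v) rY (behead y)).
    apply: bs_eq => i; rewrite fn_pop Ev !fn_set.
    by case: (i =P rY).
  exists w, (behead y); split=> //; rewrite size_behead.
  have : 0 < size y; last by lia.
  move: ne; rewrite -/(fn v1 rY) Ev fn_set eqxx; by case: (y).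
by apply: sound_pop_if => // /reads_ohead E; split=> //; rewrite E.
Qed.

Lemma succ_fetch_end v y :
  nth [::] v rY = Bit false :: y ->
  succ (pop_if (reads (Bit false)) rY) v (set_nth [::] v rY y).
Proof.
move=> E; apply: succ_eq (succ_pop_if _); last by rewrite E.
by move=> i; rewrite fn_pop fn_set; case: eqP => // ->; rewrite /fn E.
Qed.

Lemma succ_fetch src ds v w r y : src != rY -> rY \notin ds -> uniq (src :: ds) ->
  nth [::] v src = w ++ r ->
  nth [::] v rY = nseq (size w) (Bit true) ++ Bit false :: y ->
  succ (fetch src ds) v (set_nth [::] (set_nth [::] (pushes ds (rev w) v) src r) rY
    y).
Proof.
move=> sY Yds u Es EY.
apply: (@succ_seq _ _ _ _ _
  (set_nth [::] (set_nth [::] (pushes ds (rev w) v) src r) rY (Bit false :: y)));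
    last first.
  apply: succ_eq (succ_fetch_end (y := y) _); last first.
    by rewrite -/(fn _ rY) fn_set eqxx.
  by move=> i; rewrite !fn_set; case: eqP.
elim: w v Es EY => [|a w IH] v Es EY.
  apply: (@succ_eq _ _ v) => [i|].
    rewrite !fn_set fn_pushes /=; case: eqP => [->|_]; first exact: EY.
    by case: eqP => [->|_]; [exact: Es|rewrite if_same].
  by apply: succ_while_done; rewrite /tops EY.
have [v2 [H2 F2]] := det_fetch_body v u Yds.
have Es2 : nth [::] v2 src = w ++ r.
  by rewrite -/(fn v2 src) F2 eqxx (negPf sY) /fn Es.
have EY2 : nth [::] v2 rY = nseq (size w) (Bit true) ++ Bit false :: y.
  by rewrite -/(fn v2 rY) F2 (negPf sY) (eq_sym rY) (negPf sY) eqxx /fn EY.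
apply: (@succ_while_step _ _ _ _ _ v2).
- by rewrite /tops EY.
- exact: det_succ H2.
apply: succ_eq (IH v2 Es2 EY2) => i.
rewrite !fn_set !fn_pushes F2 (negPf sY) /=; case: (i == rY) => //.
case: (i == src) => //; case: (i \in ds) => //.
by rewrite /fn Es /= take0 rev_cons cat_rcons.
Qed.

Definition esc (w : string) : string :=
  foldr (fun a y => Bit true :: a :: y) [:: Bit false] w.

Lemma size_esc w : size (esc w) = (size w).*2.+1.
Proof. by elim: w => //= a w ->. Qed.

Lemma succ_load ds v w y : rY \notin ds -> uniq ds ->
  nth [::] v rY = esc w ++ y ->
  succ (fetch rY ds) v (set_nth [::] (pushes ds (rev w) v) rY y).
Proof.
move=> Yds u EY; have uY : uniq (rY :: ds) by rewrite /= Yds.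
apply: (@succ_seq _ _ _ _ _
  (set_nth [::] (pushes ds (rev w) v) rY (Bit false :: y))); last first.
  apply: succ_eq (succ_fetch_end (y := y) _); last first.
    by rewrite -/(fn _ rY) fn_set eqxx.
  by move=> i; rewrite !fn_set; case: eqP.
elim: w v EY => [|a w IH] v EY.
  apply: (@succ_eq _ _ v) => [i|].
    rewrite !fn_set fn_pushes /=; case: eqP => [->|_]; first exact: EY.
    by rewrite if_same.
  by apply: succ_while_done; rewrite /tops EY.
have [v2 [H2 F2]] := det_fetch_body v uY Yds.
have EY2 : nth [::] v2 rY = esc w ++ y.
  by rewrite -/(fn v2 rY) F2 eqxx /fn EY.
apply: (@succ_while_step _ _ _ _ _ v2).
- by rewrite /tops EY.
- exact: det_succ H2.
apply: succ_eq (IH v2 EY2) => i.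
rewrite !fn_set !fn_pushes F2 eqxx /=; case: (i == rY) => //.
case: (i \in ds) => //.
by rewrite /fn EY /= take0 rev_cons cat_rcons.
Qed.

End Moves.

(** * Checking a witness *)

Notation st x y s p q p2 u0 u1 l m n t a k c d :=
  [:: x; y; s; p; q; p2; u0; u1; l; m; n; t; a; k; c; d].

Section SizeBound.

Variables (J G : finType).
Local Notation prog := (cmd ('I_nb + J)%type (token + option G)%type).
Implicit Types (x y s p q u l m n t a k c d w z : string).

Lemma sound_then (c1 c2 : prog) v (t1 t2 : nat) v1 (R : seq string -> Prop) :
  det c1 v t1 v1 -> sound c2 v1 t2 R -> sound (Seq c1 c2) v (t1 + t2) R.
Proof.
move=> H1 H2; apply: sound_seq (sound_det H1 (erefl v1)) _ => v' <-.
exact: H2.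
Qed.

Lemma det_actE f v (l : seq ('I_nb * op token)) v' : f (tops v) = Some l ->
  uniq (map fst l) ->
  upd l v = v' -> det (bact J G f) v 1 v'.
Proof. by move=> E u <-; apply: det_act. Qed.

Lemma succ_actE f v (l : seq ('I_nb * op token)) v' : f (tops v) = Some l ->
  uniq (map fst l) ->
  upd l v = v' -> succ (bact J G f) v v'.
Proof. by move=> E u H; apply: det_succ (det_actE E u H). Qed.

Definition nonempty (x : option token) : bool := isSome x.

Definition skip : prog := bact J G (fun _ => Some [::]).
Definition push (r : 'I_nb) (x : token) : prog := bact J G (fun _ => Some [::
  (r, Push x)]).
Definition pop (r : 'I_nb) : prog := bact J G (fun _ => Some [:: (r, Pop)]).

(** [rC] and [rD] are unary counters, of which only the lengths matter. Each round copies [rP] onto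
    [rD] and restores it from [rT]. *)
Definition mul_size : prog :=
  Seq (bwhile (fun h => nonempty (h rC))
         (Seq (pop rC) (Seq (bmove J G rP [:: rT; rD]) (bmove J G rT [:: rP]))))
      (bmove J G rD [:: rC]).

Lemma det_mul_size x y s p q p2 u0 u1 l m n a k c : exists2 c',
  size c' = size c * size p &
  det mul_size (st x y s p q p2 u0 u1 l m n [::] a k c [::])
    (size c * (6 * size p + 4) + 2)
    (st x y s p q p2 u0 u1 l m n [::] a k c' [::]).
Proof.
suff loop d : exists2 d', size d' = size c * size p + size d &
  det (bwhile (fun h => nonempty (h rC))
         (Seq (pop rC) (Seq (bmove J G rP [:: rT; rD]) (bmove J G rT [:: rP]))))
    (st x y s p q p2 u0 u1 l m n [::] a k c d) (size c * (4 * size p + 4) + 1)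
    (st x y s p q p2 u0 u1 l m n [::] a k [::] d').
  have [d' Ed Hd] := loop [::]; rewrite addn0 in Ed.
  exists (rev d'); first by rewrite size_rev.
  have H2 := @det_bmove J G rD [:: rC] (st x y s p q p2 u0 u1 l m n [::] a k [::] d')
    isT.
  rewrite /pushes /= cats0 in H2.
  by apply: det_leq (det_seq Hd H2); nia.
elim: c d => [|e c IH] d.
  by exists d => //; apply: det_while_done.
have [d' Ed Hd] := IH (rev p ++ d).
exists d'; first by rewrite Ed size_cat size_rev /=; lia.
have H1 := @det_bmove J G rP [:: rT; rD] (st x y s p q p2 u0 u1 l m n [::] a k c d)
  isT.
have H2 := @det_bmove J G rT [:: rP] (st x y s [::] q p2 u0 u1 l m n (rev p) a k c
  (rev p ++ d)) isT.
rewrite /pushes /= ?cats0 ?revK in H1 H2.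
apply: det_leq (det_while_step _ (det_seq (t1 := 1) (v1 :=
  st x y s p q p2 u0 u1 l m n [::] a k c d)
   _ (det_seq H1 H2)) Hd) => //=.
  by rewrite size_rev; nia.
exact: det_actE.
Qed.

Fixpoint add_size (i : nat) : prog :=
  if i is i'.+1 then Seq (push rC Hash) (add_size i') else skip.

Lemma det_add_size i x y s p q p2 u0 u1 l m n t a k c d : exists2 c',
  size c' = size c + i &
  det (add_size i) (st x y s p q p2 u0 u1 l m n t a k c d) i.+1
    (st x y s p q p2 u0 u1 l m n t a k c' d).
Proof.
elim: i c => [|i IH] c; first by exists c; [rewrite addn0|exact: det_actE].
have [c' Ec Hc] := IH (Hash :: c); exists c'; first by rewrite Ec addnS.
by apply: (det_seq (t1 := 1)) Hc; apply: det_actE.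
Qed.

(** Horner's scheme in unary is affordable, because the value is itself polynomial in the length of
    [rP]. *)
Fixpoint horner_size (cs : seq nat) : prog :=
  if cs is i :: cs' then Seq (horner_size cs') (Seq mul_size (add_size i)) else skip.

Fixpoint horner_time (cs : seq nat) (z : nat) : nat :=
  if cs is i :: cs' then horner_time cs' z + (hval cs' z * (6 * z + 4) + 2 + i.+1)
    else 1.

Lemma det_horner_size cs x y s p q p2 u0 u1 l m n a k : exists2 c,
  size c = hval cs (size p) &
  det (horner_size cs) (st x y s p q p2 u0 u1 l m n [::] a k [::] [::])
    (horner_time cs (size p)) (st x y s p q p2 u0 u1 l m n [::] a k c [::]).
Proof.
elim: cs => [|i cs [c Ec Hc]] /=; first by exists [::] => //; exact: det_actE.
have [c1 Ec1 Hc1] := det_mul_size x y s p q p2 u0 u1 l m n a k c.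
have [c2 Ec2 Hc2] := det_add_size i x y s p q p2 u0 u1 l m n [::] a k c1 [::].
exists c2; first by rewrite Ec2 Ec1 Ec.
by rewrite -Ec; apply: det_seq Hc (det_seq Hc1 Hc2).
Qed.

Definition spend : prog :=
  bact J G (fun h => match h rQ, h rC with
    | Some b, Some _ => Some [:: (rQ, Pop); (rC, Pop); (rT, Push b)]
    | _, _ => None
    end).

(** Each letter of the witness costs one unit of the polynomial's value, so [spend] fails on too
    long a witness. After the loop the witness is put back and the unspent units are erased. *)
Definition size_check (cs : seq nat) : prog :=
  Seq (horner_size cs)
 (Seq (bwhile (fun h => nonempty (h rQ)) spend)
 (Seq (bmove J G rT [:: rQ]) (bmove J G rC [::]))).

Definition size_check_time (cs : seq nat) (z w : nat) : nat :=
  horner_time cs z + (w.+1 * 2 + 1 + (w.*2 + 1 + ((hval cs z).*2 + 1))).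

Lemma sound_size_check cs x y s p q p2 u0 u1 l m n a k :
  let v := st x y s p q p2 u0 u1 l m n [::] a k [::] [::] in
  sound (size_check cs) v (size_check_time cs (size p) (size q))
    (fun v' => v' = v /\ size q <= hval cs (size p)).
Proof.
have [c Ec Hc] := det_horner_size cs x y s p q p2 u0 u1 l m n a k.
apply: (sound_then Hc); pose Inv i v' := exists q1 q2 c1 c2,
  [/\ q = q1 ++ q2, c = c1 ++ c2, size q1 = size c1, size q2 = i &
    v' = st x y s p q2 p2 u0 u1 l m n (rev q1) a k c2 [::]].
apply: sound_seq.
  rewrite addn1; apply: (@sound_while _ _ _ _ Inv); last first.
    by exists [::], q, [::], c.
  move=> i v' [q1 [q2 [c1 [c2 [Eq Ec' Es Ei ->]]]]] _; apply: sound_act.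
  rewrite /tops /=; case: q2 Eq Ei => //= b q2 Eq Ei; case: c2 Ec' => //= e c2 Ec'.
  split=> //; exists (size q2); first by rewrite -Ei.
  exists (rcons q1 b), q2, (rcons c1 e), c2.
  by rewrite !cat_rcons !size_rcons Es rev_rcons; split.
move=> v1 [nQ [i le_i [q1 [q2 [c1 [c2 [Eq Ec' Es Ei Ev]]]]]]]; subst v1.
move: nQ Eq; rewrite /tops /=; case: q2 {Ei} => //= _; rewrite cats0 => Eq; subst q1.
have H1 := @det_bmove J G rT [:: rQ] (st x y s p [::] p2 u0 u1 l m n (rev q) a k c2
  [::]) isT.
have H2 := @det_bmove J G rC [::] (st x y s p q p2 u0 u1 l m n [::] a k c2 [::]) isT.
rewrite /pushes /= ?cats0 ?revK in H1 H2.
have le_c : size c2 <= hval cs (size p) by rewrite -Ec Ec' size_cat leq_addl.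
apply: sound_det (det_leq _ (det_seq H1 H2)) _.
  by rewrite size_rev; lia.
by split=> //; rewrite -Ec Ec' size_cat Es leq_addr.
Qed.

Lemma succ_size_check cs x y s p q p2 u0 u1 l m n a k :
  size q <= hval cs (size p) ->
  let v := st x y s p q p2 u0 u1 l m n [::] a k [::] [::] in
  succ (size_check cs) v v.
Proof.
move=> le_q; have [c Ec Hc] := det_horner_size cs x y s p q p2 u0 u1 l m n a k.
apply: succ_seq (det_succ Hc) _; rewrite -Ec {Hc Ec} in le_q *.
have loop t : exists c2, succ (bwhile (fun h => nonempty (h rQ)) spend)
   (st x y s p q p2 u0 u1 l m n t a k c [::])
   (st x y s p [::] p2 u0 u1 l m n (rev q ++ t) a k c2 [::]).
  elim: q c le_q t => [|b q IH] c le_q t; first by exists c; apply: succ_while_done.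
  case: c le_q => // e c le_q; have [c2 H2] := IH c le_q (b :: t).
  exists c2; rewrite rev_cons cat_rcons; apply: succ_while_step _ _ H2 => //.
  exact: succ_actE.
have [c2 Hw] := loop [::]; rewrite cats0 in Hw.
have H1 := @succ_bmove J G rT [:: rQ] (st x y s p [::] p2 u0 u1 l m n (rev q) a k c2
  [::]) isT.
have H2 := @succ_bmove J G rC [::] (st x y s p q p2 u0 u1 l m n [::] a k c2 [::]) isT.
rewrite /pushes /= ?cats0 ?revK in H1 H2.
exact: succ_seq Hw (succ_seq H1 H2).
Qed.

Lemma horner_time_mono cs (a b : nat) : a <= b ->
  horner_time cs a <= horner_time cs b.
Proof.
move=> le_ab; elim: cs => //= i cs IH; apply: leq_add => //.
by rewrite !leq_add2r leq_mul ?leq_hval // leq_add2r leq_mul.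
Qed.

Lemma pbounded_horner_time cs f : pbounded f ->
  pbounded (fun i => horner_time cs (f i)).
Proof.
move=> bf; elim: cs => [|i cs IH] /=; first exact: pbounded_const.
apply: pbounded_add => //; apply: pbounded_add (pbounded_const _).
apply: pbounded_add (pbounded_const _); apply: pbounded_mul.
  exact: pbounded_hval.
apply: pbounded_add (pbounded_const _); apply: pbounded_mul bf.
exact: pbounded_const.
Qed.

(* [c] checks a witness, found on [rQ], for the membership of the string on [rP]
   in the language; both are stored in reverse order. *)
Definition np_prog (Lg : string -> Prop) (c : prog) (Tc : nat -> nat) (cs :
  seq nat) :=
  [/\ pbounded Tc, {homo Tc : i j / i <= j},
    forall x y s p q p2 u0 u1 l m n a k,
      sound c (st x y s p q p2 u0 u1 l m n [::] a k [::] [::])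
        (Tc (size p + size q))
        (fun v' => v' = st x y s [::] [::] p2 u0 u1 l m n [::] a k [::] [::] /\
          Lg (rev p))
  & forall z, Lg z -> exists2 w, size w <= hval cs (size z) &
    forall x y s p2 u0 u1 l m n a k,
      succ c (st x y s (rev z) (rev w) p2 u0 u1 l m n [::] a k [::] [::])
             (st x y s [::] [::] p2 u0 u1 l m n [::] a k [::] [::])].

End SizeBound.

(** The machine is produced before [J] and [G] are given, because these are later assembled from
    several machines. *)
Lemma exists_np_prog Lg : in_NP Lg -> exists M0 : machine,
  forall (J G : finType) (jb : block M0 -> J) kb (jg : aux M0 + state M0 -> G) kg,
  pcancel jb kb -> ocancel kb jb -> pcancel jg kg ->
  exists (c : cmd ('I_nb + J)%type (token + option G)%type) Tc cs, np_prog Lg c Tc cs.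
Proof.
move=> [V [b [[M0 [e HM]] HL]]]; exists M0 => J G jb kb jg kg jbK kbK jgK.
exists (Seq (size_check J G b) (call_decider jb kb jg kg rP rQ)).
(* Both lengths are replaced by their sum, which makes the bound a monotone function of one
   number. *)
exists (fun i => size_check_time b i i + (6 * (i + e.[i]%R) + 10)), b.
have Ecall (x y s p q p2 u0 u1 l m n a k : string) : exists s' :
  store ('I_nb + J)%type (token + option G)%type,
  exec (call_decider jb kb jg kg rP rQ)
    (6 * (size p + size q + e.[size p + size q]%R) + 10)
    (@bs J G (st x y s p q p2 u0 u1 l m n [::] a k [::] [::]))
    (accepting (control (run M0 [:: rev p; rev q] e.[size p + size q]%R))) s' /\
  (accepting (control (run M0 [:: rev p; rev q] e.[size p + size q]%R)) ->
   s' = @bs J G (st x y s [::] [::] p2 u0 u1 l m n [::] a k [::] [::])).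
  have := @exec_call_decider _ _ G _ jb kb jbK kbK jg kg jgK
    (fn (st x y s p q p2 u0 u1 l m n [::] a k [::] [::])) rP rQ (rev p) (rev q)
    e.[size p + size q]%R isT.
  rewrite !revK !size_rev => /(_ erefl erefl).
  have [] := HM (rev p) (rev q); rewrite !size_rev => -> _ /(_ isT)[s' [H1 H2]].
  exists s'; split=> // /H2->; apply: functional_extensionality => -[r|j] //=.
  by case: r => i Hi; do 16 (case: i Hi => [|i] Hi //).
split.
- have bi := pbounded_id; have bc := pbounded_const.
  have bh := pbounded_hval b bi; have be := pbounded_hval e bi.
  apply: pbounded_add.
    apply: pbounded_add (pbounded_horner_time b bi) _.
    apply: (@pbounded_le _ (fun i => 4 * i + 2 * hval b i + 10)); first by move=> i;
      lia.
    by apply: pbounded_add (bc _); apply: pbounded_add; apply: pbounded_mul (bc _) _.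
  apply: pbounded_add (bc _); apply: pbounded_mul (bc _) _; apply: pbounded_add bi _.
  by apply: pbounded_le be => i; rewrite hornerE_nat.
- move=> i j le_ij; rewrite !hornerE_nat /size_check_time.
  have := horner_time_mono b le_ij; have := leq_hval b le_ij; have :=
    leq_hval e le_ij.
  by lia.
- move=> x y s p q p2 u0 u1 l m n a k.
  have t1 : size_check_time b (size p) (size q) <=
      size_check_time b (size p + size q) (size p + size q).
    rewrite /size_check_time; have le_p := leq_addr (size q) (size p).
    by have := horner_time_mono b le_p; have := leq_hval b le_p; lia.
  apply: sound_seq (sound_weak t1 (fun _ => id) (sound_size_check J G b _ _ _ _ _ _ _
    _ _ _ _ _ _)) _.
  move=> v1 [-> le_q]; have [s' [H1 H2]] := Ecall x y s p q p2 u0 u1 l m n a k.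
  exists (accepting (control (run M0 [:: rev p; rev q] e.[size p + size q]%R))), s'.
  split=> // acc; rewrite (H2 acc); eexists; first by [].
  split=> //; apply/HL; exists (rev q).
    by rewrite hornerE_nat !size_rev.
  by have [_ /iffLR] := HM (rev p) (rev q); rewrite !size_rev; apply.
move=> z /HL[w le_w Vzw]; rewrite hornerE_nat in le_w; exists w => //.
move=> x y s p2 u0 u1 l m n a k.
apply: succ_seq (succ_size_check _ _ _ _ _ _ _ _ _ _ _ _ _ _) _;
  first by rewrite !size_rev.
have [s' [H1 H2]] := Ecall x y s (rev z) (rev w) p2 u0 u1 l m n a k.
have acc : accepting (control (run M0 [:: z; w] e.[size z + size w]%R)).
  by have [_ ->] := HM z w.
rewrite !revK !size_rev acc in H1 H2; rewrite (H2 isT) in H1.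
by eexists; apply: H1.
Qed.

(** * Names, and the bound on the distance *)

Definition isbit (a : token) : bool := if a is Bit _ then true else false.

Lemma all_isbit_map bs : all isbit (map Bit bs).
Proof. by rewrite all_map; apply/allP. Qed.

Lemma split_bits w : exists bs r, w = map Bit bs ++ r /\ ~~ top_sat isbit r.
Proof.
elim: w => [|[b|||] w [bs [r [-> nr]]]]; first by exists [::], [::].
- by exists (b :: bs), r.
- by exists [::], (Hash :: map Bit bs ++ r).
- by exists [::], (Open :: map Bit bs ++ r).
- by exists [::], (Close :: map Bit bs ++ r).
Qed.

(** Least significant bit first, leading zeros allowed: decrementing keeps the length and may create
    such zeros. *)
Definition val_bits (bs : seq bool) : nat := foldr (fun (b :
  bool) i => b + i.*2) 0 bs.

Fixpoint bitpre (w : string) : seq bool :=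
  if w is Bit b :: w' then b :: bitpre w' else [::].

(** Atoms are read off the flat string, as the bit runs after [Hash], so comparing sets of atoms
    never requires parsing the nesting of terms. *)
Fixpoint names (w : string) : seq (seq bool) :=
  match w with
  | [::] => [::]
  | Hash :: w' => bitpre w' :: names w'
  | _ :: w' => names w'
  end.

Lemma bitpre_cat bs r : ~~ top_sat isbit r -> bitpre (map Bit bs ++ r) = bs.
Proof. by move=> nr; elim: bs => [|b bs /= ->] //; case: r nr => [|[]]. Qed.

Lemma names_bits bs r : names (map Bit bs ++ r) = names r.
Proof. by elim: bs. Qed.

Lemma size_names w : size (names w) = count_mem Hash w.
Proof.
have neqH a : a != Hash -> (a == Hash) = false by move/negPf.
elim: w => //= a w <-; case: a => [b|||].
- by rewrite neqH.
- by rewrite eqxx.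
- by rewrite neqH //; apply/eqP.
- by rewrite neqH //; apply/eqP.
Qed.

(** A second part starting with a bit could prolong the last name of the first. *)
Lemma names_cat w r : ~~ top_sat isbit r -> names (w ++ r) = names w ++ names r.
Proof.
move=> nr; elim: w => [|a w IH] //=; case: a; rewrite IH //=; congr cons.
elim: w {IH} => [|[b|||] w IHw] //=; last by rewrite IHw.
by case: r nr => [|[]].
Qed.

Lemma mem_namesP bs w : bs \in names w ->
  exists w1 r, w = w1 ++ Hash :: map Bit bs ++ r /\ ~~ top_sat isbit r.
Proof.
elim: w => [|a w IH] //; have H: bs \in names w -> exists w1 r,
   a :: w = w1 ++ Hash :: map Bit bs ++ r /\ ~~ top_sat isbit r.
  by move=> /IH[w1 [r [-> nr]]]; exists (a :: w1), r.
case: a H => [b|||] H //=; rewrite inE => /orP[/eqP->|/H//].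
have [cs [r [-> nr]]] := split_bits w; exists [::], r.
by rewrite bitpre_cat.
Qed.

Lemma mem_names w1 bs r : ~~ top_sat isbit r ->
  bs \in names (w1 ++ Hash :: map Bit bs ++ r).
Proof.
move=> nr; rewrite names_cat // mem_cat /= bitpre_cat // inE eqxx orbT //.
Qed.

Section Routines.

Variables (J G : finType).
Local Notation prog := (cmd ('I_nb + J)%type (token + option G)%type).
Implicit Types (x y s p q u l m n t a k c d w z : string).

Local Notation bmove := (bmove J G).
Local Notation bxfer := (bxfer J G).
Local Notation bact := (bact J G).
Local Notation pop_if := (pop_if J G).
Local Notation det_bmove := (@det_bmove J G).
Local Notation det_bxfer := (@det_bxfer J G).

Definition check (t : option token -> bool) (r : 'I_nb) : prog :=
  bact (fun h => if t (h r) then Some [::] else None).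

Lemma sound_check (t : option token -> bool) (r : 'I_nb) v :
  sound (check t r) v 1 (fun v' => v' = v /\ t (ohead (nth [::] v r))).
Proof. by apply: sound_act; rewrite /tops; case: ifP. Qed.

Lemma succ_check (t : option token -> bool) (r : 'I_nb) v :
  t (ohead (nth [::] v r)) -> succ (check t r) v v.
Proof. by move=> H; apply: (@succ_actE J G _ _ [::] _) => //; rewrite /tops H. Qed.

Definition swap : prog :=
  Seq (bmove rU0 [:: rT]) (Seq (bmove rU1 [:: rD]) (Seq (bmove rT [::
    rU1]) (bmove rD [:: rU0]))).

Lemma det_swap x y s p q p2 u0 u1 l m n a k c :
  det swap (st x y s p q p2 u0 u1 l m n [::] a k c [::])
    (4 * (size u0 + size u1) + 4)
    (st x y s p q p2 u1 u0 l m n [::] a k c [::]).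
Proof.
have H1 := @det_bmove rU0 [:: rT] (st x y s p q p2 u0 u1 l m n [::] a k c [::]) isT.
have H2 := @det_bmove rU1 [:: rD] (st x y s p q p2 [::] u1 l m n (rev u0) a k c [::])
  isT.
have H3 := @det_bmove rT [:: rU1] (st x y s p q p2 [::] [::] l m n (rev u0) a k c
  (rev u1)) isT.
have H4 := @det_bmove rD [:: rU0] (st x y s p q p2 [::] u0 l m n [::] a k c (rev u1))
  isT.
rewrite /pushes /= ?cats0 ?revK ?size_rev in H1 H2 H3 H4.
by apply: det_leq (det_seq H1 (det_seq H2 (det_seq H3 H4))); lia.
Qed.

(** After the transfer the top of [rT] is the most significant bit. Refusing a zero there leaves
    only the numerals produced by [bits], including the empty one for zero. *)
Definition parse_bound : prog :=
  Seq (pop_if (reads Hash) rS)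
 (Seq (bxfer isbit id rS [:: rT])
 (Seq (check (fun o => ~~ reads (Bit false) o) rT)
 (Seq (pop_if (reads Close) rS)
 (Seq (bmove rT [:: rK]) (bmove rS [::]))))).

Lemma top_rev_bits bs :
  reads (Bit false) (ohead (rev (map Bit bs))) = ~~ last true bs.
Proof.
case/lastP: bs => // bs b; rewrite map_rcons rev_rcons last_rcons /reads /=.
by case: b.
Qed.

Lemma sound_parse_bound x y s p q p2 u0 u1 l m n a c d :
  sound parse_bound (st x y s p q p2 u0 u1 l m n [::] a [::] c d) (6 * size s + 10)
    (fun v' => exists bs w, [/\ s = Hash :: map Bit bs ++ Close :: w, last true bs &
      v' = st x y [::] p q p2 u0 u1 l m n [::] a (map Bit bs) c d]).
Proof.
case: s => [|h s]; first by exists false; eexists; split=> //;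
  apply: (@exec_leq _ _ _ 1) => //; apply: exec_seq_fail; apply: exec_act_fail.
have [bs [r [Es nr]]] := split_bits s; subst s.
have H2 := @det_bxfer isbit id rS [:: rT] (st x y (map Bit bs ++ r) p q p2 u0 u1 l m
  n [::] a [::] c d) _ _ erefl (all_isbit_map bs) nr isT.
rewrite /pushes /= map_id ?cats0 ?size_map in H2.
apply: (sound_weak (R := fun v' => exists w, [/\ h :: map Bit bs ++ r =
   Hash :: map Bit bs ++ Close :: w, last true bs &
      v' = st x y [::] p q p2 u0 u1 l m n [::] a (map Bit bs) c d]) (t :=
   1 + ((size bs).*2.+1 + (1 + (1 + ((size bs).*2.+1 + (size r).*2.+1)))))).
- by rewrite /= size_cat size_map; lia.
- by move=> v' [w ?]; exists bs, w.
apply: (@sound_seq _ _ _ _ _ _ _ (fun v' => h = Hash /\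
   v' = st x y (map Bit bs ++ r) p q p2 u0 u1 l m n [::] a [::] c d)).
  by apply: sound_pop_if => // /eqP[->].
move=> v' [-> ->]; apply: (sound_then H2).
apply: sound_seq (sound_check _ _ _) _ => v'' [-> /=].
rewrite top_rev_bits negbK => lbs.
case: r {nr H2} => [|h' w].
  exists false; eexists; split=> //.
  by apply: (@exec_leq _ _ _ 1) => //; apply: exec_seq_fail; apply: exec_act_fail.
apply: (@sound_seq _ _ _ _ _ _ _ (fun v' => h' = Close /\
   v' = st x y w p q p2 u0 u1 l m n (rev (map Bit bs)) a [::] c d)).
  by apply: sound_pop_if => // /eqP[->].
move=> v3 [-> ->].
have H3 := @det_bmove rT [:: rK] (st x y w p q p2 u0 u1 l m n (rev (map Bit bs)) a
  [::] c d) isT.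
have H4 := @det_bmove rS [::] (st x y w p q p2 u0 u1 l m n [::] a (map Bit bs) c d)
  isT.
rewrite /pushes /= ?cats0 ?revK ?size_rev ?size_map in H3 H4.
apply: sound_det (det_leq _ (det_seq H3 H4)) _; first by rewrite /=; lia.
by exists w.
Qed.

Lemma succ_pop_ifE (a' : token) (r : 'I_nb) v w v' : nth [::] v r = a' :: w ->
  set_nth [::] v r w = v' -> succ (pop_if (reads a') r) v v'.
Proof.
move=> E <-; apply: (@succ_actE J G _ _ [:: (r, Pop)] _) => //.
  by rewrite /tops E /= /reads eqxx.
by rewrite /= E.
Qed.

Lemma succ_parse_bound x y bs w p q p2 u0 u1 l m n a c d : last true bs ->
  succ parse_bound
    (st x y (Hash :: map Bit bs ++ Close :: w) p q p2 u0 u1 l m n [::] a [::] c d)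
    (st x y [::] p q p2 u0 u1 l m n [::] a (map Bit bs) c d).
Proof.
move=> lbs.
have H2 := @det_bxfer isbit id rS [:: rT] (st x y (map Bit bs ++ Close ::
  w) p q p2 u0 u1 l m n [::] a [::] c d) _ _ erefl (all_isbit_map bs) isT isT.
have H3 := @det_bmove rT [:: rK] (st x y w p q p2 u0 u1 l m n (rev (map Bit bs)) a
  [::] c d) isT.
have H4 := @det_bmove rS [::] (st x y w p q p2 u0 u1 l m n [::] a (map Bit bs) c d)
  isT.
rewrite /pushes /= ?map_id ?cats0 ?revK in H2 H3 H4.
apply: succ_seq (succ_pop_ifE _ erefl) _; first by [].
apply: succ_seq (det_succ H2) _; apply: succ_seq (succ_check _) _.
  by rewrite /= top_rev_bits negbK.
apply: succ_seq (succ_pop_ifE _ erefl) _; first by [].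
exact: det_succ (det_seq H3 H4).
Qed.

(** Binary borrow: the low zeros become ones and the lowest one becomes a zero. If there is no one,
    the number is zero and the program fails. *)
Definition decr : prog :=
  Seq (bxfer (pred1 (Bit false)) (fun _ => Bit true) rK [:: rT])
 (Seq (bact (fun h => if reads (Bit true) (h rK) then Some [::
   (rK, Put (Bit false))] else None))
      (bmove rT [:: rK])).

Lemma val_borrow i bs : val_bits (nseq i false ++ true :: bs) =
  (val_bits (nseq i true ++ false :: bs)).+1.
Proof. by elim: i => [|i IH] //=; rewrite IH; lia. Qed.

Lemma split_false bs : exists i, bs = nseq i false \/
  exists r, bs = nseq i false ++ true :: r.
Proof.
elim: bs => [|[] bs [i IH]]; first by exists 0; left.
- by exists 0; right; exists bs.
- by exists i.+1; case: IH => [->|[r ->]]; [left|right; exists r].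
Qed.

Lemma det_decr1 i r x y s p q p2 u0 u1 l m n a c d :
  ~~ top_sat (pred1 (Bit false)) r ->
  det (bxfer (pred1 (Bit false)) (fun _ => Bit true) rK [:: rT])
    (st x y s p q p2 u0 u1 l m n [::] a (nseq i (Bit false) ++ r) c d) i.*2.+1
    (st x y s p q p2 u0 u1 l m n (nseq i (Bit true)) a r c d).
Proof.
move=> nr.
have H := @det_bxfer (pred1 (Bit false)) (fun _ => Bit true) rK [::
  rT] (st x y s p q p2 u0 u1 l m n [::] a (nseq i (Bit false) ++ r) c d) _ _ erefl _
    nr isT.
rewrite /pushes /= ?cats0 size_nseq map_nseq rev_nseq in H.
by apply: H; rewrite all_nseq /= eqxx orbT.
Qed.

Lemma det_decr2 i r x y s p q p2 u0 u1 l m n a c d :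
  det (Seq (bact (fun h => if reads (Bit true) (h rK) then Some [::
    (rK, Put (Bit false))] else None))
      (bmove rT [:: rK]))
    (st x y s p q p2 u0 u1 l m n (nseq i (Bit true)) a (Bit true :: r) c d) (i.*2 + 2)
    (st x y s p q p2 u0 u1 l m n [::] a (nseq i (Bit true) ++ Bit false :: r) c d).
Proof.
have H := @det_bmove rT [:: rK] (st x y s p q p2 u0 u1 l m n (nseq i (Bit true)) a
  (Bit false :: r) c d) isT.
rewrite /pushes /= ?cats0 size_nseq rev_nseq in H.
by apply: det_leq (det_seq (t1 := 1) _ H); [lia | apply: det_actE].
Qed.

Lemma sound_decr x y s p q p2 u0 u1 l m n a bs c d :
  sound decr (st x y s p q p2 u0 u1 l m n [::] a (map Bit bs) c d) (4 * size bs + 4)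
   (fun v' => exists bs', [/\ size bs' = size bs, val_bits bs = (val_bits bs').+1 &
      v' = st x y s p q p2 u0 u1 l m n [::] a (map Bit bs') c d]).
Proof.
have [i [->|[r ->]]] := split_false bs.
  rewrite map_nseq; have H := @det_decr1 i [::] x y s p q p2 u0 u1 l m n a c d isT.
  rewrite cats0 in H; exists false; eexists; split=> //.
  apply: (@exec_leq _ _ _ (i.*2.+1 + 1)); first by rewrite size_nseq; lia.
  by apply: exec_seq H _; apply: exec_seq_fail; apply: exec_act_fail.
rewrite map_cat map_nseq /=.
have H1 := @det_decr1 i (Bit true :: map Bit r) x y s p q p2 u0 u1 l m n a c d isT.
have H2 := @det_decr2 i (map Bit r) x y s p q p2 u0 u1 l m n a c d.
apply: sound_det (det_leq _ (det_seq H1 H2)) _;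
  first by rewrite size_cat size_nseq /=; lia.
exists (nseq i true ++ false :: r); rewrite val_borrow map_cat map_nseq /=.
by rewrite !size_cat !size_nseq.
Qed.

Lemma succ_decr x y s p q p2 u0 u1 l m n a bs c d : 0 < val_bits bs ->
  exists2 bs', val_bits bs = (val_bits bs').+1 &
  succ decr (st x y s p q p2 u0 u1 l m n [::] a (map Bit bs) c d)
    (st x y s p q p2 u0 u1 l m n [::] a (map Bit bs') c d).
Proof.
have [i [->|[r ->]]] := split_false bs; first by have -> :
  val_bits (nseq i false) = 0 by elim: i => //= i ->.
move=> _; exists (nseq i true ++ false :: r); first exact: val_borrow.
rewrite !map_cat !map_nseq /=.
have H1 := @det_decr1 i (Bit true :: map Bit r) x y s p q p2 u0 u1 l m n a c d isT.
have H2 := @det_decr2 i (map Bit r) x y s p q p2 u0 u1 l m n a c d.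
exact: det_succ (det_seq H1 H2).
Qed.

(** Writing the bound in unary could take exponential time. The certificate decides how far to count
    instead, and since [decr] fails at zero, the count never exceeds the bound. *)
Definition guess : prog :=
  Seq (bwhile (fun h => reads (Bit true) (h rY))
         (Seq (bact (fun _ => Some [:: (rY, Pop); (rM, Push Hash)])) decr))
 (Seq (pop_if (reads (Bit false)) rY) (bmove rK [::])).

Lemma sound_guess x y s p q p2 u0 u1 l n a bs c d :
  sound guess (st x y s p q p2 u0 u1 l [::] n [::] a (map Bit bs) c d)
    ((size y).+1 * (4 * size bs + 6) + 2 * size bs + 3)
   (fun v' => exists y' m, [/\ size m <= val_bits bs, size m + size y' < size y &
      v' = st x y' s p q p2 u0 u1 l m n [::] a [::] c d]).
Proof.
pose Inv i v' := exists y' m bs', [/\ size y' = i, size m + size y' <= size y,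
   size bs' = size bs, size m + val_bits bs' = val_bits bs &
   v' = st x y' s p q p2 u0 u1 l m n [::] a (map Bit bs') c d].
apply: (sound_weak (t := ((size y).+1 * (1 + (4 * size bs + 4)).+1).+1 + (1 + (size
  bs).*2.+1))) => [||].
- by lia.
- by move=> v'; exact: id.
apply: sound_seq.
  apply: (@sound_while _ _ _ _ Inv); last by exists y, [::], bs.
  move=> i v' [y' [m [bs' [Ei le_m Eb Ev ->]]]] /reads_ohead /= Ey.
  apply: (sound_then (v1 := st x (behead y') s p q p2 u0 u1 l (Hash ::
    m) n [::] a (map Bit bs') c d)).
    by rewrite Ey; apply: det_actE.
  apply: (sound_weak _ _ (sound_decr _ _ _ _ _ _ _ _ _ _ _ _ _ _ _));
    first by rewrite Eb.
  move=> v'' [bs2 [Es2 Ev2 ->]]; exists (size (behead y')).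
    by rewrite -Ei Ey.
  exists (behead y'), (Hash :: m), bs2; split=> //=.
  - by move: le_m; rewrite {1}Ey /=; lia.
  - by rewrite Es2.
  - by lia.
move=> v' [_ [i _ [y' [m [bs' [Ei le_m Eb Ev ->]]]]]].
apply: (sound_seq (R1 := fun v'' => exists2 y2, y' = Bit false :: y2 &
   v'' = st x y2 s p q p2 u0 u1 l m n [::] a (map Bit bs') c d)).
  apply: sound_pop_if => // /reads_ohead /= Ey; exists (behead y') => //.
move=> v'' [y2 Ey ->].
have H := @det_bmove rK [::] (st x y2 s p q p2 u0 u1 l m n [::] a (map Bit bs') c d)
  isT.
rewrite /pushes /= size_map Eb in H.
apply: sound_det H _; exists y2, m; split=> //.
- by rewrite -Ev leq_addr.
- by move: le_m; rewrite Ey /=; lia.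
Qed.

Lemma succ_guess j x y s p q p2 u0 u1 l n a bs c d : j <= val_bits bs ->
  succ guess (st x (nseq j (Bit true) ++ Bit false ::
    y) s p q p2 u0 u1 l [::] n [::] a (map Bit bs) c d)
   (st x y s p q p2 u0 u1 l (nseq j Hash) n [::] a [::] c d).
Proof.
move=> le_j.
have loop m : exists bs', succ (bwhile (fun h => reads (Bit true) (h rY))
         (Seq (bact (fun _ => Some [:: (rY, Pop); (rM, Push Hash)])) decr))
   (st x (nseq j (Bit true) ++ Bit false :: y) s p q p2 u0 u1 l m n [::] a (map Bit
     bs) c d)
   (st x (Bit false :: y) s p q p2 u0 u1 l (nseq j Hash ++ m) n [::] a (map Bit bs')
     c d).
  elim: j bs m le_j => [|j IH] bs m le_j; first by exists bs; apply: succ_while_done.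
  have [|bs1 E1 H1] := @succ_decr x (nseq j (Bit true) ++ Bit false ::
    y) s p q p2 u0 u1 l (Hash :: m) n a bs c d.
    by apply: leq_trans le_j.
  rewrite E1 in le_j; have [bs2 H2] := IH bs1 (Hash :: m) le_j.
  exists bs2; have -> : nseq j.+1 Hash ++ m = nseq j Hash ++ Hash :: m.
    by rewrite -cat_rcons; congr cat; elim: j {IH H1 H2 le_j} => //= j <-.
  apply: succ_while_step _ _ H2 => //.
  by apply: succ_seq H1; apply: succ_actE.
have [bs' Hw] := loop [::]; rewrite cats0 in Hw.
apply: succ_seq Hw _; apply: succ_seq (succ_pop_ifE _ erefl) _; first by [].
exact: det_succ (@det_bmove rK [::] _ isT).
Qed.

End Routines.

(** * Comparing two solutions *)

Section Comparison.

Variables (J G : finType).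
Local Notation prog := (cmd ('I_nb + J)%type (token + option G)%type).
Implicit Types (x y s p q u l m n t a k c d w z : string).

Local Notation bmove := (bmove J G).
Local Notation bact := (bact J G).
Local Notation fetch := (fetch J G).
Local Notation det_bmove := (@det_bmove J G).

(** Each name starts with [Hash], so paying for these symbols with units of [rM] limits the number
    of listed differences; the units spent wait on [rN] to be restored for the next scenario. *)
Definition count_move : prog :=
  bact (fun h => match h rT, h rM with
    | Some Hash, Some b => Some [:: (rT, Pop); (rL, Push Hash); (rM, Pop);
      (rN, Push b)]
    | Some Hash, None => None
    | Some a, _ => Some [:: (rT, Pop); (rL, Push a)]
    | None, _ => None
    end).

Definition load_list : prog :=
  Seq (fetch rY [:: rT])
 (Seq (bwhile (fun h => nonempty (h rT)) count_move) (bmove rN [:: rM])).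

Lemma sound_load_list x y s p q p2 u0 u1 m a k c d :
  sound load_list (st x y s p q p2 u0 u1 [::] m [::] [::] a k c d)
    (6 * size y + 2 * size m + 20)
    (fun v' => exists w y', [/\ size w + size y' < size y, count_mem Hash w <= size m
      &
      v' = st x y' s p q p2 u0 u1 w m [::] [::] a k c d]).
Proof.
apply: (sound_weak (t := (4 * size y + 10) + ((size y).+1 * 2 + 1 + (size m).*2.+1))).
- by lia.
- by move=> v'; exact: id.
apply: sound_seq; first exact: (@sound_load J G [:: rT]).
move=> v [w [y' [/= le_y ->]]]; rewrite /pushes /= cats0.
pose Inv i v' := exists w1 w2 m1 m2, [/\ w = w1 ++ w2, m = m1 ++ m2,
   size w1 = i, size m1 = count_mem Hash w2 &
   v' = st x y' s p q p2 u0 u1 w2 m2 (rev m1) (rev w1) a k c d].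
apply: (sound_seq (R1 := fun v' => exists m1 m2, [/\
  m = m1 ++ m2, size m1 = count_mem Hash w &
   v' = st x y' s p q p2 u0 u1 w m2 (rev m1) [::] a k c d])).
  rewrite addn1; apply: (sound_weak (t := ((size w).+1 * 2).+1)); last first.
  - apply: (@sound_while _ _ _ _ Inv); last by exists w, [::], [::], m; rewrite cats0.
    move=> i v' [w1 [w2 [m1 [m2 [Ew Em Ei Ec ->]]]]] _; apply: sound_act.
    rewrite /tops /=; case/lastP: w1 Ew Ei => // w1 b Ew Ei; rewrite rev_rcons /=.
    rewrite size_rcons in Ei; rewrite cat_rcons in Ew.
    have H : b != Hash -> exists2 k'', k'' < i & Inv k'' (st x y' s p q p2 u0 u1 (b
      :: w2) m2 (rev m1) (rev w1) a k c d).
      move=> /negPf nb; exists (size w1); first by rewrite -Ei.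
      by exists w1, (b :: w2), m1, m2; rewrite /= nb.
    case: b Ew H => [b|||] Ew H; try by split=> //; apply: H; apply/eqP.
    case: m2 Em {H} => // e m2 Em; split=> //; exists (size w1); first by rewrite -Ei.
    exists w1, (Hash :: w2), (rcons m1 e), m2.
    by rewrite cat_rcons size_rcons rev_rcons /= Ec eqxx.
  - move=> v' [nT [i _ [w1 [w2 [m1 [m2 [Ew Em _ Ec Ev]]]]]]]; subst v'.
    move: nT Ew; rewrite /tops /=; case/lastP: w1 => [_ /= Ew|w1 b];
      last by rewrite rev_rcons.
    by exists m1, m2; rewrite Ew.
  - by lia.
move=> v' [m1 [m2 [Em Ec ->]]].
have H := @det_bmove rN [:: rM] (st x y' s p q p2 u0 u1 w m2 (rev m1) [::] a k c d)
  isT.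
rewrite /pushes /= revK size_rev -Em in H.
apply: sound_det (det_leq _ H) _; first by rewrite Em size_cat; lia.
by exists w, y'; rewrite -Ec Em size_cat leq_addr.
Qed.

Lemma succ_load_list w x y s p q p2 u0 u1 m a k c d : count_mem Hash w <= size m ->
  succ load_list (st x (esc w ++ y) s p q p2 u0 u1 [::] m [::] [::] a k c d)
    (st x y s p q p2 u0 u1 w m [::] [::] a k c d).
Proof.
move=> le_m; have H1 := @succ_load J G [::
  rT] (st x (esc w ++ y) s p q p2 u0 u1 [::] m [::] [::] a k c d) w y isT isT erefl.
rewrite /pushes /= cats0 in H1; apply: succ_seq H1 _.
(* [catrev n m] is constant along the loop, so moving [rN] back rebuilds the original bound. *)
have loop w1 w2 m1 n : count_mem Hash w1 <= size m1 -> exists m2 n2,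
   catrev n2 m2 = catrev n m1 /\
   succ (bwhile (fun h => nonempty (h rT)) count_move)
    (st x y s p q p2 u0 u1 w2 m1 n (rev w1) a k c d)
    (st x y s p q p2 u0 u1 (w1 ++ w2) m2 n2 [::] a k c d).
  elim/last_ind: w1 w2 m1 n => [|w1 b IH] w2 m1 n.
    by exists m1, n; split=> //; apply: succ_while_done.
  rewrite -cats1 count_cat /= addn0 cats1 rev_rcons cat_rcons.
  case: (b =P Hash) => [->|/eqP nb] le_m1.
    case: m1 le_m1 => [|e m1] le_m1; first by rewrite addn1 in le_m1.
    rewrite addn1 /= ltnS in le_m1.
    have [m2 [n2 [Em H]]] := IH (Hash :: w2) m1 (e :: n) le_m1.
    exists m2, n2; split=> //; apply: succ_while_step _ _ H => //.
    exact: succ_actE.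
  rewrite addn0 in le_m1; have [m2 [n2 [Em H]]] := IH (b :: w2) m1 n le_m1.
  exists m2, n2; split=> //; apply: succ_while_step _ _ H => //.
  by case: b nb => [e|||]; rewrite ?eqxx // => _; apply: succ_actE.
have [m2 [n2 [Em H2]]] := loop w [::] m [::] le_m; rewrite cats0 in H2.
apply: succ_seq H2 _.
have H3 := @det_bmove rN [:: rM] (st x y s p q p2 u0 u1 w m2 n2 [::] a k c d) isT.
by rewrite /pushes /= -catrevE Em /= in H3; apply: det_succ H3.
Qed.

Definition target (b : bool) : 'I_nb := if b then rU1 else rL.

Definition same_bit (x y : option token) : bool :=
  match x, y with Some (Bit b), Some (Bit b') => b == b' | _, _ => false end.

Definition match_move (t : option token -> option token -> bool) (b : bool) : prog :=
  bact (fun h => if t (h rU0) (h (target b)) then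
      if h rU0 is Some e then
        Some [:: (rU0, Pop); (rA, Push e); (target b, Pop); (rT, Push e)]
      else None
    else None).

(** The certificate gives the position of the name in the target, so nothing is searched. The test
    after the loop makes both names end together, which excludes a proper prefix. *)
Definition match_name (b : bool) : prog :=
  Seq (fetch (target b) [:: rT])
 (Seq (match_move (fun e e' => reads Hash e && reads Hash e') b)
 (Seq (bwhile (fun h => same_bit (h rU0) (h (target b))) (match_move same_bit b))
 (Seq (bact (fun h => if top_sat isbit (seq_of_opt (h rU0)) || top_sat isbit
   (seq_of_opt (h (target b)))
                      then None else Some [::]))
      (bmove rT [:: target b])))).

(** Puts [w] on the register [target b], so that both targets are treated in one proof. *)
Definition stU x y s p q p2 u0 u1 l m n t a k c d (b : bool) w :=
  st x y s p q p2 u0 (if b then w else u1) (if b then l else w) m n t a k c d.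

Lemma same_bitP e w f w' : same_bit (ohead (e : string)) (ohead (f : string)) ->
  e = w -> f = w' -> exists b r r', w = Bit b :: r /\ w' = Bit b :: r'.
Proof.
move=> + <- <-; case: e => [|[b|||] e] //=; case: f => [|[b'|||] f] //= /eqP<-.
by exists b, e, f.
Qed.

Lemma sound_match_name b x y s p q p2 u0 u1 l m n a k c d :
  sound (match_name b) (st x y s p q p2 u0 u1 l m n [::] a k c d)
    (4 * size y + 2 * size u0 + 2 * (size u1 + size l) + 30)
    (fun v' => exists bs r y', [/\ u0 = Hash :: map Bit bs ++ r, ~~ top_sat isbit r,
       bs \in names (if b then u1 else l), size y' < size y &
       v' = st x y' s p q p2 r u1 l m n [::] (rev (Hash :: map Bit bs) ++ a) k c d]).
Proof.
set o := if b then u1 else l.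
have le_o : size o <= size u1 + size l by rewrite /o; case: (b); lia.
pose stO y' w u0' t' a' := stU x y' s p q p2 u0' u1 l m n t' a' k c d b w.
have -> : st x y s p q p2 u0 u1 l m n [::] a k c d = stO y o u0 [::] a.
  by rewrite /stO /stU /o; case: (b).
apply: (sound_weak (t := (4 * size y + 10) + (1 + (((size u0).+1 * 2).+1 + (1 + (size
  o).*2.+1))))).
- by lia.
- by move=> v'; exact: id.
apply: (sound_seq (R1 := fun v' => exists w1 w2 y', [/\
  o = w1 ++ w2, size y' < size y &
    v' = stO y' w2 u0 (rev w1) a])).
  have H := @sound_fetch J G (target b) [:: rT] (stO y o u0 [::] a).
  rewrite /stO /stU /target /o; move: H; rewrite /stO /stU /target /o.
  case: (b) => H; apply: sound_weak (H isT isT isT) => // v' [w [r [y' [/= E1 E2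
    ->]]]];
    by exists w, r, y'; rewrite /pushes /= cats0.
move=> v [w1 [w2 [y1 [Eo le_y ->]]]].
apply: (sound_seq (R1 := fun v' => exists f u, [/\ u0 = Hash :: u, w2 = Hash :: f &
    v' = stO y1 f u (rev (rcons w1 Hash)) (Hash :: a)])).
  apply: sound_act; rewrite rev_rcons.
  case Ec: (reads Hash _ && reads Hash _) => //; move/andP:
    Ec => [/reads_ohead /= Eu].
  rewrite /tops /stO /stU /target; case: (b) => /= /reads_ohead Ew; rewrite Eu Ew /=;
    by split=> //; exists (behead w2), (behead u0).
move=> v' [f [u [Eu Ef ->]]].
pose Inv i v' := exists bs f' u', [/\ u = map Bit bs ++ u', f = map Bit bs ++ f',
  size u' = i &
   v' = stO y1 f' u' (rev (rcons w1 Hash ++ map Bit bs)) (rev (map Bit bs) ++ Hash ::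
     a)].
apply: sound_seq.
  apply: (sound_weak (t := ((size u).+1 * 2).+1)); last first.
  - apply: (@sound_while _ _ _ _ Inv); last first.
      by exists [::], f, u; rewrite cats0.
    move=> i v2 [bs [f' [u' [Eu' Ef' Ei ->]]]] sb; apply: sound_act.
    rewrite sb; have [e [r [r' [E1 E2]]]] : exists e r r', u' = Bit e :: r /\
      f' = Bit e :: r'.
      move: sb; rewrite /tops /stO /stU /target; case: (b) => /= sb; exact:
        same_bitP sb _ _.
    have -> : tops (stO y1 f' u' (rev (rcons w1 Hash ++ map Bit bs)) (rev (map Bit
      bs) ++ Hash :: a)) rU0 = Some (Bit e).
      by rewrite /tops /= E1.
    split; first by rewrite /target; case: (b).
    exists (size r); first by rewrite -Ei E1.
    exists (rcons bs e), r', r; rewrite map_rcons; split=> //.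
    - by rewrite cat_rcons -E1.
    - by rewrite cat_rcons -E2.
    by rewrite -rcons_cat !rev_rcons /stO /stU /target E1 E2; case: (b).
  - by move=> v2; exact: id.
  - by rewrite Eu /=; lia.
move=> v2 [nb [i _ [bs [f' [u' [Eu' Ef' _ Ev]]]]]]; subst v2.
apply: (sound_seq (R1 := fun v2 => [/\ ~~ top_sat isbit u', ~~ top_sat isbit f' &
  v2 = stO y1 f' u' (rev (rcons w1 Hash ++ map Bit bs)) (rev (map Bit bs) ++ Hash ::
    a)])).
  apply: sound_act; case: ifP => // /negbT; rewrite negb_or /tops /stO /stU /target
    /= => /andP[H1 H2].
  split=> //; split=> //; first by case: (u') H1.
  by move: H2; case: (b) => /=; case: (f').
move=> v2 [nu nf ->].
have H := @det_bmove rT [:: target b] (stO y1 f' u' (rev (rcons w1 Hash ++ map Bit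
  bs)) (rev (map Bit bs) ++ Hash :: a)).
have Eo' : rcons w1 Hash ++ map Bit bs ++ f' = o by rewrite cat_rcons Eo Ef Ef'.
have {}H : det (bmove rT [:: target b]) (stO y1 f' u' (rev (rcons w1 Hash ++ map Bit
  bs)) (rev (map Bit bs) ++ Hash :: a))
   (size o).*2.+1 (stO y1 o u' [::] (rev (map Bit bs) ++ Hash :: a)).
  move: H; rewrite /stO /stU /target; case: (b) => /(_ isT);
    rewrite /pushes /= revK size_rev -catA Eo';
  by apply: det_leq; rewrite -Eo' !size_cat; lia.
apply: sound_det H _; exists bs, u', y1; split=> //.
- by rewrite Eu Eu'.
- by rewrite -Eo' cat_rcons; apply: mem_names.
- by rewrite /stO /stU /o rev_cons cat_rcons; case: (b).
Qed.

Lemma succ_match_name b bs w1 r f x y s p q p2 u1 l m n a k c d :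
  (if b then u1 else l) = w1 ++ Hash :: map Bit bs ++ f ->
  ~~ top_sat isbit f -> ~~ top_sat isbit r ->
  succ (match_name b)
    (st x (nseq (size w1) (Bit true) ++ Bit false :: y) s p q p2
       (Hash :: map Bit bs ++ r) u1 l m n [::] a k c d)
    (st x y s p q p2 r u1 l m n [::] (rev (Hash :: map Bit bs) ++ a) k c d).
Proof.
set o := if b then u1 else l => Eo nf nr.
pose stO y' w u0' t' a' := stU x y' s p q p2 u0' u1 l m n t' a' k c d b w.
have E y' u0' t' a' : st x y' s p q p2 u0' u1 l m n t' a' k c d = stO y' o u0' t' a'.
  by rewrite /stO /stU /o; case: (b).
rewrite !E; apply: (succ_seq (v1 := stO y (Hash :: map Bit bs ++ f) (Hash ::
  map Bit bs ++ r) (rev w1) a)).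
  have := @succ_fetch J G (target b) [:: rT]
    (stO (nseq (size w1) (Bit true) ++ Bit false :: y) o (Hash ::
      map Bit bs ++ r) [::] a)
    w1 (Hash :: map Bit bs ++ f) y.
  by rewrite /stO /stU /target /pushes; case: (b) => /(_ isT isT isT Eo erefl) /=;
    rewrite cats0.
apply: (succ_seq (v1 := stO y (map Bit bs ++ f) (map Bit bs ++ r) (rev (rcons w1
  Hash)) (Hash :: a))).
  rewrite rev_rcons.
  apply: (@succ_actE J G _ _ [:: (rU0, Pop); (rA, Push Hash); (target b, Pop);
    (rT, Push Hash)] _);
    rewrite /tops /stO /stU /target.
  - by case: (b) => /=; rewrite /reads eqxx.
  - by case: (b).
  - by case: (b).
apply: (succ_seq (v1 := stO y f r (rev (rcons w1 Hash ++ map Bit bs)) (rev (map Bit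
  bs) ++ Hash :: a))).
  rewrite rev_cat; move: (rev (rcons w1 Hash)) (Hash :: a) => t a'.
  elim: bs t a' {Eo} => [|e bs IH] t a'.
    apply: succ_while_done; rewrite /tops /stO /stU /target.
    by case: (b) => /=; case: (r) nr => [|[e|||] r'] //=.
  have := IH (Bit e :: t) (Bit e :: a'); rewrite /= !rev_cons !cat_rcons.
  apply: succ_while_step.
    by rewrite /tops /stO /stU /target; case: (b) => /=.
  apply: (@succ_actE J G _ _ [:: (rU0, Pop); (rA, Push (Bit e)); (target b, Pop);
    (rT, Push (Bit e))] _);
    rewrite /tops /stO /stU /target; by case: (b) => //=; rewrite eqxx.
apply: (succ_seq (v1 := stO y f r (rev (rcons w1 Hash ++ map Bit bs)) (rev (map Bit
  bs) ++ Hash :: a))).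
  apply: (@succ_actE J G _ _ [::] _) => //; rewrite /tops /stO /stU /target /=.
  by case: (b) => /=; case: (f) nf => [|[e|||] f'] //=; case: (r) nr => [|[e'|||] r'].
have := @succ_bmove J G rT [:: target b] (stO y f r (rev (rcons w1 Hash ++ map Bit
  bs)) (rev (map Bit bs) ++ Hash :: a)).
rewrite /stO /stU /target /pushes rev_cons cat_rcons Eo.
by case: (b) => /(_ isT) /=; rewrite revK cat_rcons -catA.
Qed.

End Comparison.

(** * Equality of atom sets up to listed differences *)

Section Distance.

Variables (J G : finType).
Local Notation prog := (cmd ('I_nb + J)%type (token + option G)%type).
Implicit Types (x y s p q u l m n t a k c d w z : string).

Local Notation bmove := (bmove J G).
Local Notation bmv := (bmv J G).
Local Notation pop := (pop J G).
Local Notation match_name := (match_name J G).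
Local Notation det_bmove := (@det_bmove J G).
Local Notation swap := (swap J G).
Local Notation load_list := (load_list J G).

(** One bit of the certificate tells whether the next name is to be found in the other solution or
    in the list of differences. *)
Definition subset_loop : prog :=
  bwhile (fun h => nonempty (h rU0))
    (bcond (fun h => reads Hash (h rU0))
      (bcond (fun h => reads (Bit true) (h rY))
         (Seq (pop rY) (match_name true)) (Seq (pop rY) (match_name false)))
      (bmv id rU0 [:: rA])).

Definition subset_check : prog := Seq subset_loop (bmove rA [:: rU0]).

Definition subset_time (u v y : nat) : nat :=
  u.+1 * (4 * y + 2 * u + 2 * v + 40) + 2 * u + 2.

Lemma sound_subset_check x y s p q p2 u0 u1 l m n k c d :
  sound subset_check (st x y s p q p2 u0 u1 l m n [::] [::] k c d)
    (subset_time (size u0) (size u1 + size l) (size y))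
    (fun v' => exists y', [/\ size y' <= size y,
       {subset names u0 <= names u1 ++ names l} &
       v' = st x y' s p q p2 u0 u1 l m n [::] [::] k c d]).
Proof.
(* 33 is 30 from matching a name, one for the preceding pop and two for the nested conditionals. *)
pose t := 4 * size y + 2 * size u0 + 2 * (size u1 + size l) + 33.
apply: (sound_weak (t := ((size u0).+1 * t.+1).+1 + (size u0).*2.+1)).
- by rewrite /subset_time /t; nia.
- by move=> v'; exact: id.
(* The names of [w2] are still to be matched: the inclusion is trivial at the start and is the goal
   once [w2] is empty. *)
pose Inv i v' := exists w1 w2 y', [/\ u0 = w1 ++ w2, size w2 = i, size y' <= size y,
   {subset names u0 <= names u1 ++ names l ++ names w2} &
   v' = st x y' s p q p2 w2 u1 l m n [::] (rev w1) k c d].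
apply: sound_seq.
  apply: (@sound_while _ _ _ _ Inv); last first.
    exists [::], u0, y; split=> // e He; by rewrite !mem_cat He !orbT.
  move=> i v' [w1 [w2 [y' [Eu Ei le_y Hs ->]]]]; rewrite /tops /=.
  case: w2 Eu Ei Hs => // e w2 Eu Ei Hs _.
  have le_w : size (e :: w2) <= size u0 by rewrite Eu size_cat leq_addl.
  have Hmatch b : sound (Seq (pop rY) (match_name b))
     (st x y' s p q p2 (e :: w2) u1 l m n [::] (rev w1) k c d) (t - 2)
     (fun v'' => exists2 k'', k'' < i & Inv k'' v'').
    apply: (sound_weak (t := 1 + (4 * size y + 2 * size (e ::
      w2) + 2 * (size u1 + size l) + 30))).
    - by rewrite /t; lia.
    - by move=> v''; exact: id.
    apply: (sound_then (v1 := st x (behead y') s p q p2 (e ::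
      w2) u1 l m n [::] (rev w1) k c d)).
      exact: det_actE.
    have le_y2 : size (behead y') <= size y by rewrite size_behead; lia.
    apply: (sound_weak _ _ (sound_match_name _ _ b _ _ _ _ _ _ _ _ _ _ _ _ _ _ _)).
      by lia.
    move=> v'' [bs [r [y2 [Ew nr Hbs le_y3 ->]]]].
    exists (size r); first by rewrite -Ei Ew /= size_cat; lia.
    exists (w1 ++ Hash :: map Bit bs), r, y2; split=> //.
    - by rewrite Eu Ew -catA.
    - by lia.
    - move=> f /Hs; rewrite Ew !mem_cat /= names_bits bitpre_cat // inE.
      case/or3P=> [->//|->|]; rewrite ?orbT //.
      case/orP=> [/eqP->|->]; last by rewrite !orbT.
      by case: (b) Hbs => ->; rewrite ?orbT.
    by rewrite rev_cat.
  have -> : t = (t - 1).+1 by rewrite /t; lia.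
  apply: sound_cond; rewrite /tops /=; case: ifP => he.
    have -> : t - 1 = (t - 2).+1 by rewrite /t; lia.
    by apply: sound_cond; case: ifP => _; apply: Hmatch.
  apply: sound_weak (sound_det (@det_bmv J G id rU0 [:: rA] _ isT) (erefl _)).
    by rewrite /t; lia.
  move=> v'' <-; exists (size w2); first by rewrite -Ei.
  exists (rcons w1 e), w2, y'; split=> //.
  - by rewrite cat_rcons.
  - move=> f /Hs; rewrite !mem_cat; case/or3P=> [->//|->|]; rewrite ?orbT //.
    by case: e he {Eu Ei Hs le_w Hmatch} => [b|||] /=;
      rewrite /reads ?eqxx // => _ ->; rewrite !orbT.
  by rewrite rev_rcons.
move=> v' [nU [i _ [w1 [w2 [y' [Eu _ le_y Hs Ev]]]]]]; subst v'.
case: w2 Eu Hs nU => // Eu Hs _; rewrite cats0 in Eu; subst w1.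
have H := @det_bmove rA [:: rU0] (st x y' s p q p2 [::] u1 l m n [::] (rev u0) k c d)
  isT.
rewrite /pushes /= cats0 revK size_rev in H.
by apply: sound_det H _; exists y'; split=> // f /Hs; rewrite !cats0.
Qed.

(** A name costs a bit for the target, a position in unary and a closing bit, hence at most
    [size u1 + size l + 1] symbols. *)
Lemma succ_subset_check u0 u1 l : {subset names u0 <= names u1 ++ names l} ->
  exists2 g, size g <= size u0 * (size u1 + size l + 1) &
  forall x y s p q p2 m n k c d,
  succ subset_check (st x (g ++ y) s p q p2 u0 u1 l m n [::] [::] k c d)
    (st x y s p q p2 u0 u1 l m n [::] [::] k c d).
Proof.
move=> Hs; suff [g le_g Hg] : exists2 g, size g <= size u0 * (size u1 + size l + 1) &
  forall x y s p q p2 m n k c d a,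
  succ subset_loop (st x (g ++ y) s p q p2 u0 u1 l m n [::] a k c d)
    (st x y s p q p2 [::] u1 l m n [::] (rev u0 ++ a) k c d).
  exists g => // x y s p q p2 m n k c d.
  apply: succ_seq (Hg _ _ _ _ _ _ _ _ _ _ _ _) _; rewrite cats0.
  have H := @succ_bmove J G rA [:: rU0] (st x y s p q p2 [::] u1 l m n [::] (rev u0)
    k c d) isT.
  by rewrite /pushes /= cats0 revK in H.
(* Induction on a length bound, because matching a name removes many letters at once. *)
have [N le_N] : exists N, size u0 <= N by exists (size u0).
elim: N u0 le_N Hs => [|N IH] [|e u0] //=.
- by exists [::] => // *; apply: succ_while_done.
- by exists [::] => // *; apply: succ_while_done.
rewrite ltnS => le_N; case: (e =P Hash) => [->|/eqP ne] /= Hs; last first.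
  have {}Hs : {subset names u0 <= names u1 ++ names l}.
    by case: e ne Hs => // /eqP.
  have [g le_g Hg] := IH u0 le_N Hs; exists g.
    by apply: leq_trans le_g _; rewrite leq_mul2r leqnSn orbT.
  move=> x y s p q p2 m n k c d a.
  have H := Hg x y s p q p2 m n k c d (e :: a).
  rewrite rev_cons cat_rcons; apply: succ_while_step _ _ H => //.
  apply: succ_cond; rewrite /tops /= /reads (inj_eq Some_inj) (negPf ne).
  exact: succ_actE.
have [bs [r [Eu nr]]] := split_bits u0; subst u0.
rewrite bitpre_cat // names_bits in Hs.
have le_r : size r <= N by apply: leq_trans le_N; rewrite size_cat leq_addl.
have {IH}[g le_g Hg] := IH r le_r (fun f Hf => Hs f (mem_behead (s := _ :: _) Hf)).
have [b Hb] : exists b : bool, bs \in names (if b then u1 else l).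
  by have := Hs bs (mem_head _ _); rewrite mem_cat => /orP[];
    [exists true|exists false].
have [w1 [f [Eo nf]]] := mem_namesP Hb.
have le_w1 : size w1 < size u1 + size l.
  have : size w1 < size (if b then u1 else l) by rewrite Eo size_cat /= addnS ltnS
    leq_addr.
  by case: (b); lia.
exists (Bit b :: nseq (size w1) (Bit true) ++ Bit false :: g).
  rewrite /= size_cat size_nseq /= size_cat mulSn mulnDl; lia.
move=> x y s p q p2 m n k c d a.
have -> : rev (Hash :: map Bit bs ++ r) ++ a = rev r ++ (rev (Hash ::
  map Bit bs) ++ a).
  by rewrite -cat_cons rev_cat catA.
apply: succ_while_step _ _ (Hg x y s p q p2 m n k c d _) => //.
apply: succ_cond; rewrite /tops /= /reads eqxx; apply: succ_cond.
have Hm := @succ_match_name J G b bs w1 r f x (g ++ y) s p q p2 u1 l m n a k c d Eo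
  nf nr.
have Hp : succ (pop rY)
  (st x (Bit b :: nseq (size w1) (Bit true) ++ Bit false :: g ++ y) s p q p2 (Hash ::
    map Bit bs ++ r) u1 l m n [::] a k c d)
  (st x (nseq (size w1) (Bit true) ++ Bit false :: g ++ y) s p q p2 (Hash ::
    map Bit bs ++ r) u1 l m n [::] a k c d).
  exact: succ_actE.
rewrite -catA /tops /=; case: (b) Hm Hp => Hm Hp.
  by rewrite /reads eqxx; apply: succ_seq Hp Hm.
exact: succ_seq Hp Hm.
Qed.

(** Both inclusions use the same list of differences; swapping the solutions lets one program check
    them both. *)
Definition distance_check : prog :=
  Seq load_list
 (Seq subset_check (Seq swap (Seq subset_check (Seq swap
 (Seq (bmove rL [::]) (bmove rU1 [::])))))).

Definition distance_time (i : nat) : nat :=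
  (8 * i + 20) + (subset_time i (2 * i) i + ((8 * i + 4) + (subset_time i (2 * i) i +
    ((8 * i + 4) + (4 * i + 4))))).

Lemma subset_time_mono i i' j j' (e e' : nat) : i <= i' -> j <= j' -> e <= e' ->
  subset_time i j e <= subset_time i' j' e'.
Proof.
by move=> Hi Hj Hk; rewrite /subset_time !leq_add // ?leq_mul // !leq_add // ?leq_mul.
Qed.

Lemma sound_distance_check i x y s p q p2 u0 u1 m k c :
  size y <= i -> size u0 <= i -> size u1 <= i -> size m <= i ->
  sound distance_check (st x y s p q p2 u0 u1 [::] m [::] [::] [::] k c [::])
    (distance_time i)
    (fun v' => exists w y', [/\ size y' < size y, size (names w) <= size m,
       {subset names u0 <= names u1 ++ names w} /\
       {subset names u1 <= names u0 ++ names w} &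
       v' = st x y' s p q p2 u0 [::] [::] m [::] [::] [::] k c [::]]).
Proof.
move=> le_y le_u0 le_u1 le_m.
apply: sound_seq.
  apply: (sound_weak _ (fun _ => id) (sound_load_list _ _ _ _ _ _ _ _ _ _ _ _ _ _
    _)); lia.
move=> v [w [y1 [le_y1 le_w ->]]].
apply: sound_seq.
  apply: (sound_weak _ (fun _ => id) (sound_subset_check _ _ _ _ _ _ _ _ _ _ _ _ _
    _)).
  by apply: subset_time_mono => //; lia.
move=> v' [y2 [le_y2 H1 ->]].
apply: (sound_then (det_leq _ (det_swap _ _ _ _ _ _ _ _ _ _ _ _ _ _ _ _)));
  first by lia.
apply: sound_seq.
  apply: (sound_weak _ (fun _ => id) (sound_subset_check _ _ _ _ _ _ _ _ _ _ _ _ _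
    _)).
  by apply: subset_time_mono => //; lia.
move=> v'' [y3 [le_y3 H2 ->]].
apply: (sound_then (det_leq _ (det_swap _ _ _ _ _ _ _ _ _ _ _ _ _ _ _ _)));
  first by lia.
have H3 := @det_bmove rL [::] (st x y3 s p q p2 u0 u1 w m [::] [::] [::] k c [::])
  isT.
have H4 := @det_bmove rU1 [::] (st x y3 s p q p2 u0 u1 [::] m [::] [::] [::] k c
  [::]) isT.
rewrite /pushes /= in H3 H4.
apply: sound_det (det_leq _ (det_seq H3 H4)) _; first by lia.
by exists w, y3; rewrite size_names; split=> //; lia.
Qed.

Lemma succ_distance_check w u0 u1 :
  {subset names u0 <= names u1 ++ names w} ->
  {subset names u1 <= names u0 ++ names w} ->
  exists2 g, size g <= 2 * size w + 1 + (size u0 + size u1) * (size u0 + size u1 +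
    size w + 1) &
  forall x y s p q p2 m k c, size (names w) <= size m ->
  succ distance_check (st x (g ++ y) s p q p2 u0 u1 [::] m [::] [::] [::] k c [::])
    (st x y s p q p2 u0 [::] [::] m [::] [::] [::] k c [::]).
Proof.
move=> /succ_subset_check[g1 le_g1 H1] /succ_subset_check[g2 le_g2 H2].
exists (esc w ++ g1 ++ g2); first by rewrite !size_cat size_esc; nia.
move=> x y s p q p2 m k c; rewrite size_names => le_m; rewrite -!catA.
apply: succ_seq (succ_load_list _ _ _ _ _ _ _ _ _ _ _ _ _ _ le_m) _.
apply: succ_seq (H1 _ _ _ _ _ _ _ _ _ _ _) _.
apply: succ_seq (det_succ (det_swap _ _ _ _ _ _ _ _ _ _ _ _ _ _ _ _)) _.
apply: succ_seq (H2 _ _ _ _ _ _ _ _ _ _ _) _.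
apply: succ_seq (det_succ (det_swap _ _ _ _ _ _ _ _ _ _ _ _ _ _ _ _)) _.
have H3 := @det_bmove rL [::] (st x y s p q p2 u0 u1 w m [::] [::] [::] k c [::]) isT.
have H4 := @det_bmove rU1 [::] (st x y s p q p2 u0 u1 [::] m [::] [::] [::] k c [::])
  isT.
rewrite /pushes /= in H3 H4.
exact: det_succ (det_seq H3 H4).
Qed.

End Distance.

(** * The verifier *)

Section Verifier.

Variables (J G : finType).
Local Notation prog := (cmd ('I_nb + J)%type (token + option G)%type).
Implicit Types (x y s p q u l m n t a k c d w z : string).

Local Notation bmove := (bmove J G).
Local Notation push := (push J G).
Local Notation pop_if := (pop_if J G).
Local Notation fetch := (fetch J G).
Local Notation det_bmove := (@det_bmove J G).
Local Notation swap := (swap J G).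
Local Notation distance_check := (distance_check J G).
Local Notation parse_bound := (parse_bound J G).
Local Notation guess := (guess J G).

Variables (Ls Ly : string -> Prop) (csol cyes : prog) (Ts Ty : nat -> nat) (ps py :
  seq nat).
Hypothesis Hsol : np_prog Ls csol Ts ps.
Hypothesis Hyes : np_prog Ly cyes Ty py.

(** [Open] and [Close] around the two pieces form the code of a pair, which is tested for the
    solution language. The copy of the instance on [rP2] survives [csol] and is then tested for the
    yes-language. *)
Definition fetch_solution : prog :=
  Seq (push rP Open) (Seq (fetch rS [:: rP; rP2]) (Seq (fetch rY [:: rP; rT])
 (Seq (push rP Close) (Seq (bmove rT [:: rU1]) (Seq (fetch rY [:: rQ]) (Seq csol
 (Seq (bmove rP2 [:: rT]) (Seq (bmove rT [:: rP]) (Seq (fetch rY [::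
   rQ]) cyes))))))))).

Definition fetch_time (i : nat) : nat :=
  1 + ((4 * i + 10) + ((4 * i + 10) + (1 + ((2 * i + 1) + ((4 * i + 10) + (Ts (3 * i
    + 2) +
    ((2 * i + 1) + ((2 * i + 1) + ((4 * i + 10) + Ty (2 * i)))))))))).

Lemma sound_fetch_solution i x y s u0 l m n a k : size y <= i -> size s <= i ->
  sound fetch_solution (st x y s [::] [::] [::] u0 [::] l m n [::] a k [::] [::])
    (fetch_time i)
    (fun v' => exists t u s' y', [/\ s = t ++ s', size y' < size y /\ size u < size y,
       Ls (Open :: t ++ rcons u Close), Ly t &
       v' = st x y' s' [::] [::] [::] u0 u l m n [::] a k [::] [::]]).
Proof.
move=> le_y le_s; have [_ mTs sS _] := Hsol; have [_ mTy sY _] := Hyes.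
apply: (sound_then (v1 := st x y s [:: Open] [::] [::] u0 [::] l m n [::] a k [::]
  [::])).
  exact: det_actE.
apply: sound_seq.
  apply: (sound_weak _ (fun _ => id) (@sound_fetch J G rS [:: rP;
    rP2] _ isT isT isT)) => /=; lia.
move=> v [t [s' [y1 [/= Es le_y1 ->]]]]; rewrite /pushes /= ?cats0.
apply: sound_seq.
  apply: (sound_weak _ (fun _ => id) (@sound_load J G [:: rP; rT] _ isT isT)) => /=;
    lia.
move=> v' [u [y2 [/= le_y2 ->]]]; rewrite /pushes /= ?cats0.
apply: (sound_then (v1 := st x y2 s' (Close :: rev u ++ rev t ++ [::
  Open]) [::] (rev t) u0 [::] l m n (rev u) a k [::] [::])).
  exact: det_actE.
have H1 := @det_bmove rT [:: rU1] (st x y2 s' (Close :: rev u ++ rev t ++ [::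
  Open]) [::] (rev t) u0 [::] l m n (rev u) a k [::] [::]) isT.
rewrite /pushes /= ?cats0 revK size_rev in H1.
apply: (sound_then (det_leq _ H1)); first by lia.
apply: sound_seq.
  apply: (sound_weak _ (fun _ => id) (@sound_load J G [:: rQ] _ isT isT)) => /=; lia.
move=> v'' [w [y3 [/= le_y3 ->]]]; rewrite /pushes /= ?cats0.
apply: sound_seq.
  apply: (sound_weak _ (fun _ => id) (sS _ _ _ _ _ _ _ _ _ _ _ _ _)).
  apply: mTs; rewrite /= !size_cat !size_rev /=.
  by move: (f_equal size Es); rewrite size_cat; lia.
move=> v3 [-> Lst].
have H2 := @det_bmove rP2 [:: rT] (st x y3 s' [::] [::] (rev t) u0 u l m n [::] a k
  [::] [::]) isT.
have H3 := @det_bmove rT [:: rP] (st x y3 s' [::] [::] [::] u0 u l m n t a k [::]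
  [::]) isT.
rewrite /pushes /= ?cats0 ?revK ?size_rev in H2 H3.
have le_t : size t <= i by move: (f_equal size Es); rewrite size_cat; lia.
apply: (sound_then (det_leq _ H2)); first by lia.
apply: (sound_then (det_leq _ H3)); first by lia.
apply: sound_seq.
  apply: (sound_weak _ (fun _ => id) (@sound_load J G [:: rQ] _ isT isT)) => /=; lia.
move=> v4 [w' [y4 [/= le_y4 ->]]]; rewrite /pushes /= ?cats0.
apply: (sound_weak _ _ (sY _ _ _ _ _ _ _ _ _ _ _ _ _)).
  by apply: mTy; rewrite !size_rev; lia.
move=> v5 [-> Lyt]; rewrite revK in Lyt; exists t, u, s', y4; split=> //;
  first by lia.
have -> : Open :: t ++ rcons u Close = rev (Close :: rev u ++ rev t ++ [:: Open]).
  by rewrite rev_cons !rev_cat !revK /rev /= rcons_cat.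
exact: Lst.
Qed.

(** A count of at most [i] for the instance, two symbols per letter for the solution and the two
    witnesses, and four closing bits; [2 * i + 2] is the length of the code of the pair. *)
Definition fetch_bound (i : nat) : nat :=
  3 * i + 4 + 2 * hval ps (2 * i + 2) + 2 * hval py i.

Lemma succ_fetch_solution i t u : Ls (Open :: t ++ rcons u Close) -> Ly t ->
  size t <= i -> size u <= i ->
  exists2 g, size g <= fetch_bound i & forall x y s u0 l m n a k,
  succ fetch_solution (st x (g ++ y) (t ++ s) [::] [::] [::] u0 [::] l m n [::] a k
    [::] [::])
    (st x y s [::] [::] [::] u0 u l m n [::] a k [::] [::]).
Proof.
move=> Lst Lyt le_t le_u.
have [_ _ _ /(_ _ Lst)[w le_w Hw]] := Hsol; have [_ _ _ /(_ _ Lyt)[w' le_w' Hw']] :=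
  Hyes.
exists (nseq (size t) (Bit true) ++ Bit false :: esc u ++ esc w ++ esc w').
  rewrite !(size_cat, size_nseq, size_esc) /= !(size_cat, size_nseq, size_esc).
  have H1 : size w <= hval ps (2 * i + 2).
    apply: leq_trans le_w _; apply: leq_hval; rewrite /= size_cat size_rcons; lia.
  have H2 : size w' <= hval py i by apply: leq_trans le_w' _; apply: leq_hval.
  rewrite /fetch_bound; lia.
move=> x y s u0 l m n a k; rewrite -catA /= -!catA.
apply: (succ_seq (v1 := st x _ (t ++ s) [::
  Open] [::] [::] u0 [::] l m n [::] a k [::] [::])).
  exact: succ_actE.
apply: succ_seq.
  by apply: (@succ_fetch J G rS [:: rP; rP2] _ t s).
rewrite /pushes /= ?cats0; apply: succ_seq.
  by apply: (@succ_load J G [:: rP; rT] _ u).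
rewrite /pushes /= ?cats0.
apply: (succ_seq (v1 := st x _ s (Close :: rev u ++ rev t ++ [::
  Open]) [::] (rev t) u0 [::] l m n (rev u) a k [::] [::])).
  exact: succ_actE.
have H1 z := @det_bmove rT [:: rU1] (st x z s (Close :: rev u ++ rev t ++ [::
  Open]) [::] (rev t) u0 [::] l m n (rev u) a k [::] [::]) isT.
rewrite /pushes /= ?cats0 revK in H1; apply: succ_seq (det_succ (H1 _)) _.
apply: succ_seq.
  by apply: (@succ_load J G [:: rQ] _ w).
rewrite /pushes /= ?cats0.
have -> : Close :: rev u ++ rev t ++ [:: Open] = rev (Open :: t ++ rcons u Close).
  by rewrite rev_cons rev_cat rev_rcons -cats1 /= -catA.
apply: succ_seq (Hw _ _ _ _ _ _ _ _ _ _ _) _.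
have H2 z := @det_bmove rP2 [:: rT] (st x z s [::] [::] (rev t) u0 u l m n [::] a k
  [::] [::]) isT.
have H3 z := @det_bmove rT [:: rP] (st x z s [::] [::] [::] u0 u l m n t a k [::]
  [::]) isT.
rewrite /pushes /= ?cats0 ?revK in H2 H3.
apply: succ_seq (det_succ (H2 _)) _; apply: succ_seq (det_succ (H3 _)) _.
apply: succ_seq.
  by apply: (@succ_load J G [:: rQ] _ w').
rewrite /pushes /= ?cats0; exact: Hw'.
Qed.

Variables (g : string -> string) (cg : prog) (Tg : nat -> nat).

(** [Tg] also bounds the output, hence the total length of the scenarios. *)
Definition function_prog :=
  [/\ pbounded Tg, {homo Tg : i j / i <= j}, forall z, size (g z) <= Tg (size z) &
    forall x y p2 u0 u1 l m n a k z,
      det cg (st x y [::] (rev z) [::] p2 u0 u1 l m n [::] a k [::] [::]) (Tg (size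
        z))
             (st x y (g z) [::] [::] p2 u0 u1 l m n [::] a k [::] [::])].

Hypothesis Hg : function_prog.

(** Codes of tuples start with [Open], so the first other symbol marks the end of the list of
    scenarios. *)
Definition main_loop : prog :=
  bwhile (fun h => reads Open (h rS)) (Seq fetch_solution distance_check).

(** The first [Open] popped opens the pair of base instance and bound, the second the list of
    scenarios; an invalid description has an empty image and fails at the second. *)
Definition verifier : prog :=
  Seq (bmove rX [:: rT]) (Seq (bmove rT [:: rX; rS]) (Seq (pop_if (reads Open) rS)
 (Seq fetch_solution (Seq parse_bound (Seq swap (Seq guess
 (Seq (bmove rX [:: rP]) (Seq cg (Seq (pop_if (reads Open) rS) main_loop))))))))).

(* [u] and [m] stand for the base solution and the recoverability bound,
   [t] for a scenario. *)
Definition recoverable u (m : nat) t : Prop :=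
  Ly t /\ exists u' w, [/\ Ls (Open :: t ++ rcons u' Close), size (names w) <= m,
    {subset names u <= names u' ++ names w} &
    {subset names u' <= names u ++ names w}].

Definition loop_time (i j : nat) : nat := (i.+1 * (fetch_time j + distance_time
  i).+1).+1.

(** The variant is the length of the certificate, not that of the scenario string, so the number of
    rounds depends on [i] alone. *)
Lemma sound_main_loop i j y s u m :
  size y <= i -> size u <= i -> size m <= i -> size s <= j -> i <= j ->
  sound main_loop (st [::] y s [::] [::] [::] u [::] [::] m [::] [::] [::] [::] [::]
    [::])
    (loop_time i j)
    (fun _ => exists ts s', [/\ s = flatten ts ++ s', ~~ reads Open (ohead s') &
       forall t, t \in ts -> recoverable u (size m) t]).
Proof.
move=> le_y le_u le_m le_s le_ij.
pose Inv e v := exists ts s' y', [/\ s = flatten ts ++ s', size y' = e, e <= size y,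
   forall t, t \in ts -> recoverable u (size m) t &
   v = st [::] y' s' [::] [::] [::] u [::] [::] m [::] [::] [::] [::] [::] [::]].
apply: (sound_weak (t := ((size y).+1 * (fetch_time j + distance_time i).+1).+1));
  last first.
- apply: (@sound_while _ _ _ _ Inv); last by exists [::], s, y.
  move=> e v [ts [s' [y' [Es Ee le_e Hts ->]]]] _.
  apply: sound_seq.
    apply: (sound_fetch_solution (i := j)); first by lia.
    by move: (f_equal size Es); rewrite size_cat; lia.
  move=> v' [t [u' [s2 [y2 [Es' [le_y2 le_u'] Lst Lyt ->]]]]].
  apply: sound_weak (leqnn _) _ (@sound_distance_check J G i [::] y2 s2 [::] [::]
    [::] u u' m [::] [::] _ _ _ _); try lia.
  move=> v2 [w [y3 [le_y3 le_w [H1 H2] ->]]]; exists (size y3); first by lia.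
  exists (rcons ts t), s2, y3; split=> //.
  - by rewrite Es Es' flatten_rcons catA.
  - by lia.
  move=> t'; rewrite mem_rcons inE => /orP[/eqP->|/Hts//].
  by split=> //; exists u', w.
- move=> v [nO [e _ [ts [s' [y' [Es _ _ Hts Ev]]]]]]; subst v.
  by exists ts, s'.
- by rewrite /loop_time ltnS leq_mul2r orbC ltnS le_y.
Qed.

Definition verifier_time (i : nat) : nat :=
  (2 * i + 1) + ((2 * i + 1) + (1 + (fetch_time i + ((6 * i + 10) + ((8 * i + 4) +
   ((i.+1 * (4 * i + 6) + 2 * i + 3) + ((2 * i + 1) + (Tg i + (1 +
    loop_time i (i + Tg i)))))))))).

(** A statement about strings only: [ts] are the pieces cut out by the certificate, not yet known to
    be the listed scenarios. *)
Definition accepts x : Prop := exists t u bs w (m : nat) (ts : seq string) s,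
  [/\ [/\ x = Open :: t ++ Hash :: map Bit bs ++ Close :: w, last true bs,
          Ls (Open :: t ++ rcons u Close) & Ly t],
      m <= val_bits bs, g x = Open :: flatten ts ++ s, ~~ reads Open (ohead s) &
      forall t', t' \in ts -> recoverable u m t'].

Lemma sound_verifier x y :
  sound verifier (st x y [::] [::] [::] [::] [::] [::] [::] [::] [::] [::] [::] [::]
    [::] [::])
    (verifier_time (size x + size y)) (fun _ => accepts x).
Proof.
set i := size x + size y; have [_ mTg le_g dg] := Hg.
have H1 := @det_bmove rX [:: rT] (st x y [::] [::] [::] [::] [::] [::] [::] [::] [::]
  [::] [::] [::] [::] [::]) isT.
have H2 := @det_bmove rT [:: rX; rS] (st [::] y [::] [::] [::] [::] [::] [::] [::]
  [::] [::] (rev x) [::] [::] [::] [::]) isT.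
rewrite /pushes /= ?cats0 ?revK ?size_rev in H1 H2.
apply: (sound_then (det_leq _ H1)); first by rewrite /i; lia.
apply: (sound_then (det_leq _ H2)); first by rewrite /i; lia.
apply: (sound_seq (R1 := fun v => exists2 s, x = Open :: s & v =
   st x y s [::] [::] [::] [::] [::] [::] [::] [::] [::] [::] [::] [::] [::])).
  by apply: sound_pop_if => // /reads_ohead /= Ex; exists (behead x).
move=> v [s Ex ->].
have le_s : size s <= i by rewrite /i Ex /=; lia.
apply: sound_seq; first by apply: (sound_fetch_solution (i := i));
  rewrite // /i leq_addl.
move=> v1 [t [u [s1 [y1 [Es [le_y1 le_u] Lst Lyt ->]]]]].
have le_s1 : size s1 <= i by move: le_s; rewrite Es size_cat; lia.
apply: sound_seq.
  apply: (sound_weak _ (fun _ => id) (sound_parse_bound _ _ _ _ _ _ _ _ _ _ _ _ _ _ _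
    _)).
  by lia.
move=> v2 [bs [w [Es1 lbs ->]]].
apply: (sound_then (det_leq _ (det_swap _ _ _ _ _ _ _ _ _ _ _ _ _ _ _ _))).
  by rewrite /i /=; lia.
have le_bs : size bs <= i by move: le_s1; rewrite Es1 /= size_cat size_map /=; lia.
apply: sound_seq.
  apply: (sound_weak _ (fun _ => id) (sound_guess _ _ _ _ _ _ _ _ _ _ _ _ _ _ _ _)).
  rewrite !leq_add2r; apply: leq_add; last by rewrite leq_mul2l.
  by apply: leq_mul; rewrite /i; lia.
move=> v3 [y2 [m [le_m le_y2 ->]]].
have H3 := @det_bmove rX [:: rP] (st x y2 [::] [::] [::] [::] u [::] [::] m [::] [::]
  [::] [::] [::] [::]) isT.
rewrite /pushes /= ?cats0 in H3.
apply: (sound_then (det_leq _ H3)); first by rewrite /i; lia.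
apply: (sound_then (det_leq _ (dg _ _ _ _ _ _ _ _ _ _ _))).
  by apply: mTg; rewrite /i leq_addr.
apply: (sound_seq (R1 := fun v => exists2 s, g x = Open :: s & v =
   st [::] y2 s [::] [::] [::] u [::] [::] m [::] [::] [::] [::] [::] [::])).
  by apply: sound_pop_if => // /reads_ohead /= Ex'; exists (behead (g x)).
move=> v4 [s2 Eg ->].
have le_s2 : size s2 <= i + Tg i.
  have := le_g x; rewrite Eg /=; have : Tg (size x) <= Tg i by apply: mTg;
    rewrite leq_addr.
  by lia.
apply: sound_weak (leqnn _) _ (sound_main_loop (i := i) _ _ _ le_s2 (leq_addr _ _));
  try by rewrite /i; lia.
move=> v5 [ts [s3 [Es2 nO Hts]]].
exists t, u, bs, w, (size m), ts, s3; split=> //; last by rewrite Eg Es2.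
by split=> //; rewrite Ex Es Es1.
Qed.

(** The bound of [succ_distance_check] for three strings of length at most [i]. *)
Definition distance_bound (i : nat) : nat :=
  2 * i + 1 + 2 * i * (3 * i + 1).

Lemma succ_main_loop i u ts s m : size u <= i -> ~~ reads Open (ohead s) ->
  (forall t, t \in ts -> [/\ reads Open (ohead t), Ly t, size t <= i &
    exists u' w, [/\ Ls (Open :: t ++ rcons u' Close), size (names w) <= size m,
      size u' <= i /\ size w <= i,
      {subset names u <= names u' ++ names w} &
      {subset names u' <= names u ++ names w}]]) ->
  exists2 y, size y <= size ts * (fetch_bound i + distance_bound i) &
  succ main_loop
   (st [::] y (flatten ts ++ s) [::] [::] [::] u [::] [::] m [::] [::] [::] [::] [::]
     [::])
   (st [::] [::] s [::] [::] [::] u [::] [::] m [::] [::] [::] [::] [::] [::]).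
Proof.
move=> le_u nO; elim: ts => [|t ts IH] Hts.
  by exists [::] => //; apply: succ_while_done.
have [|y le_y Hy] := IH; first by move=> t' Ht'; apply: Hts; rewrite inE Ht' orbT.
have [Ot Lyt le_t [u' [w [Lst le_w [le_u' le_w'] H1 H2]]]] := Hts t (mem_head _ _).
have [g1 le_g1 Hg1] := succ_fetch_solution Lst Lyt le_t le_u'.
have [g2 le_g2 Hg2] := succ_distance_check J G H1 H2.
exists (g1 ++ g2 ++ y).
  have le_g : size g2 <= distance_bound i.
    apply: leq_trans le_g2 _; rewrite /distance_bound; apply: leq_add; first by lia.
    by apply: leq_mul; lia.
  by rewrite !size_cat mulSn -addnA; apply: leq_add le_g1 (leq_add le_g le_y).
rewrite /= -catA; apply: succ_while_step _ _ Hy.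
  by rewrite /tops /=; case: (t) Ot.
exact: succ_seq (Hg1 _ _ _ _ _ _ _ _ _) (Hg2 _ _ _ _ _ _ _ _ _ le_w).
Qed.

Definition certificate_bound (i : nat) : nat :=
  fetch_bound i + (i + 1) + i * (fetch_bound i + distance_bound i).

Lemma succ_verifier i x t u bs w (m : nat) (ts : seq string) s :
  x = Open :: t ++ Hash :: map Bit bs ++ Close :: w -> last true bs ->
  Ls (Open :: t ++ rcons u Close) -> Ly t -> m <= val_bits bs ->
  g x = Open :: flatten ts ++ s -> ~~ reads Open (ohead s) ->
  size t <= i -> size u <= i -> m <= i -> size ts <= i ->
  (forall t', t' \in ts -> [/\ reads Open (ohead t'), Ly t', size t' <= i &
    exists u' w, [/\ Ls (Open :: t' ++ rcons u' Close), size (names w) <= m,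
      size u' <= i /\ size w <= i,
      {subset names u <= names u' ++ names w} &
      {subset names u' <= names u ++ names w}]]) ->
  exists2 y, size y <= certificate_bound i & exists v',
  succ verifier
    (st x y [::] [::] [::] [::] [::] [::] [::] [::] [::] [::] [::] [::] [::] [::]) v'.
Proof.
move=> Ex lbs Lst Lyt le_m Eg nO le_t le_u le_mi le_ts Hts.
have [_ _ _ dg] := Hg; have [g1 le_g1 Hg1] := succ_fetch_solution Lst Lyt le_t le_u.
rewrite -[m](size_nseq m Hash) in Hts.
have [y le_y Hy] := succ_main_loop le_u nO Hts.
exists (g1 ++ nseq m (Bit true) ++ Bit false :: y).
  rewrite /certificate_bound !size_cat size_nseq /= -addnA addnS -addSn.
  apply: leq_add le_g1 (leq_add _ _); first by rewrite addn1.
  by apply: leq_trans le_y _; apply: leq_mul.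
have H1 z := @det_bmove rX [:: rT] (st x z [::] [::] [::] [::] [::] [::] [::] [::]
  [::] [::] [::] [::] [::] [::]) isT.
have H2 z := @det_bmove rT [:: rX; rS] (st [::] z [::] [::] [::] [::] [::] [::] [::]
  [::] [::] (rev x) [::] [::] [::] [::]) isT.
have H3 z := @det_bmove rX [:: rP] (st x z [::] [::] [::] [::] u [::] [::] (nseq m
  Hash) [::] [::] [::] [::] [::] [::]) isT.
rewrite /pushes /= ?cats0 ?revK in H1 H2 H3.
eexists; apply: succ_seq (det_succ (H1 _)) _; apply: succ_seq (det_succ (H2 _)) _.
rewrite {2}Ex; apply: succ_seq (succ_pop_ifE _ _ _ erefl) _; first by [].
rewrite /=; apply: succ_seq (Hg1 _ _ _ _ _ _ _ _ _) _.
apply: succ_seq (succ_parse_bound _ _ _ _ _ _ _ _ _ _ _ _ _ _ _ _ lbs) _.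
apply: succ_seq (det_succ (det_swap _ _ _ _ _ _ _ _ _ _ _ _ _ _ _ _)) _.
apply: succ_seq (succ_guess _ _ _ _ _ _ _ _ _ _ _ _ _ _ _ le_m) _.
apply: succ_seq (det_succ (H3 _)) _.
apply: succ_seq (det_succ (dg _ _ _ _ _ _ _ _ _ _ _)) _.
rewrite Eg; apply: succ_seq (succ_pop_ifE _ _ _ erefl) _; first by [].
exact: Hy.
Qed.

(** * Polynomial bounds on time and certificates *)

Lemma pbounded_verifier_time : pbounded verifier_time.
Proof.
have [bTs mTs _ _] := Hsol; have [bTy mTy _ _] := Hyes; have [bTg mTg _ _] := Hg.
have bc := pbounded_const; have bi := pbounded_id.
(* [f] is taken monotone because the inner function is only majorized by a polynomial. *)
have comp (f h : nat -> nat) : {homo f : i0 i1 / i0 <= i1} -> pbounded f ->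
  pbounded h -> pbounded (fun i0 : nat => f (h i0 : nat)).
  move=> mf [e He] [e' He']; apply: (@pbounded_le _ (fun i0 => hval e (hval e' i0))).
    move=> i0; rewrite -hornerE_nat; apply: leq_trans (He _); apply: mf.
    by rewrite -hornerE_nat.
  by apply: pbounded_hval; apply: pbounded_hval.
have bl (h : nat -> nat) (e : nat) : pbounded h ->
  pbounded (fun i0 => e * h i0) by apply: pbounded_mul.
have bfetch (h : nat -> nat) : pbounded h -> pbounded (fun i0 => fetch_time (h i0)).
  move=> bh; rewrite /fetch_time.
  by repeat first [exact: bc | exact: bh | apply: (comp Ts) => // | apply:
    (comp Ty) => // | apply: pbounded_add | apply: bl].
have bdist : pbounded distance_time.
  rewrite /distance_time /subset_time.
  apply: (@pbounded_le _ (fun i0 => (8 * i0 + 20) + (2 * ((i0 + 1) * (10 * i0 + 40) +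
    2 * i0 + 2) + (20 * i0 + 12)))).
    by move=> i0; nia.
  by repeat first [exact: bc | exact: bi | apply: pbounded_add | apply: pbounded_mul].
rewrite /verifier_time /loop_time.
apply: (@pbounded_le _ (fun i => (2 * i + 1) + ((2 * i + 1) + (1 + (fetch_time i +
  ((6 * i + 10) + ((8 * i + 4) +
   (((i + 1) * (4 * i + 6) + 2 * i + 3) + ((2 * i + 1) + (Tg i + (1 +
    (((i + 1) * (fetch_time (i + Tg i) + distance_time i + 1)) + 1)))))))))))).
  by move=> i; rewrite !addn1.
by repeat first [exact: bc | exact: bi | exact: bTg | exact: bdist | apply:
  bfetch | apply: pbounded_add | apply: pbounded_mul].
Qed.

Lemma pbounded_certificate_bound f : pbounded f ->
  pbounded (fun i => certificate_bound (f i)).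
Proof.
move=> bf; have bc := pbounded_const; rewrite /certificate_bound /fetch_bound
  /distance_bound.
by repeat first [exact: bc | exact: bf | apply: pbounded_hval | apply:
  pbounded_add | apply: pbounded_mul].
Qed.

End Verifier.

(** * Encodings *)

Lemma exists_function_prog (g : string -> string) : polytime_computable g ->
  exists M0 : machine,
  forall (J G : finType) (jb : block M0 -> J) kb (jg : aux M0 + state M0 -> G) kg,
  pcancel jb kb -> ocancel kb jb -> pcancel jg kg ->
  exists (c : cmd ('I_nb + J)%type (token + option G)%type) Tc, function_prog g c Tc.
Proof.
move=> [M0 [e HM]]; exists M0 => J G jb kb jg kg jbK kbK jgK.
exists (call_function jb kb jg kg rP rQ rT rS), (fun i => 20 * (i + hval e i) + 10).
have bi := pbounded_id; have bc := pbounded_const.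
split.
- apply: pbounded_add (bc _); apply: pbounded_mul (bc _) _.
  by apply: (pbounded_add bi); apply: (pbounded_hval _ bi).
- by move=> i j le_ij; have := leq_hval e le_ij; lia.
- move=> z; have [_ <-] := HM z; rewrite /output.
  apply: leq_trans (size_read _) _.
  have := @size_tapes M0 [:: z] (hval e (size z)) (size z) ord_max true.
  rewrite -hornerE_nat => /(_ _)/leq_trans; apply; first by case=> [|[|i]].
  by rewrite hornerE_nat; lia.
move=> x y p2 u0 u1 l m n a k z; have [hz gz] := HM z; rewrite hornerE_nat in hz gz.
have := @exec_call_function _ _ G _ jb kb jbK kbK jg kg jgK
  (fn (st x y [::] (rev z) [::] p2 u0 u1 l m n [::] a k [::] [::])) rP rQ rT rS z
  (hval e (size z)) isT erefl erefl erefl erefl hz.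
rewrite gz /det /bs; set v1 := fn _; set v2 := (fun r => _); set v3 := fn _.
suff -> : v2 = v3 by [].
apply: functional_extensionality => -[i Hi]; rewrite /v2 /v3.
by do 16 (case: i Hi => [|i] Hi //).
Qed.

(** The occurrence of [term] inside [seq term] calls for a hypothesis on every member of a tuple. *)
Lemma term_nested_ind (Pr : term -> Prop) :
  (forall n, Pr (Atom n)) -> (forall ts, (forall t, t \in ts -> Pr t) ->
    Pr (Tup ts)) ->
  forall t, Pr t.
Proof.
move=> HA HT; fix IH 1 => -[n|ts]; first exact: HA.
apply: HT; elim: ts => [|t ts IHts] t'; first by rewrite in_nil => H; discriminate H.
rewrite inE => /orP[/eqP->|Ht]; [exact: (IH t)|exact: (IHts t' Ht)].
Qed.

(** * Numerals and unique decoding of terms *)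

Lemma val_bitsK n : val_bits (bits n) = n.
Proof.
rewrite /bits -[RHS]bin_of_natK; case: (bin_of_nat n) => //= p.
by elim: p => //= p ->; rewrite NatTrec.doubleE.
Qed.

Lemma bits_inj : injective bits.
Proof. exact: can_inj val_bitsK. Qed.

(** Lets the numeral accepted by [parse_bound] be read as some [bits kappa]. *)
Lemma last_true_bits bs : last true bs -> exists n, bs = bits n.
Proof.
case: bs => [|b bs]; first by exists 0.
move=> lb; suff [p Ep] : exists p, b :: bs = pos_bits p.
  by exists (nat_of_pos p); rewrite /bits -[nat_of_pos p]/(nat_of_bin (BinNums.Npos
    p)) nat_of_binK.
elim: bs b lb => [|b' bs IH] b /= lb; first by exists BinNums.xH; rewrite lb.
have [p Ep] := IH b' lb; rewrite Ep.
by case: b {lb}; [exists (BinNums.xI p)|exists (BinNums.xO p)].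
Qed.

Lemma last_bits n : last true (bits n).
Proof.
rewrite /bits; case: (bin_of_nat n) => //= p; elim: p true => //= p IH b; exact: IH.
Qed.

Lemma bits_cat_inj b1 b2 a b : ~~ top_sat isbit a -> ~~ top_sat isbit b ->
  map Bit b1 ++ a = map Bit b2 ++ b -> b1 = b2 /\ a = b.
Proof.
move=> na nb'; elim: b1 b2 => [|e b1 IH] [|e' b2] //=.
- by move=> Ea; rewrite Ea in na.
- by move=> Eb; rewrite -Eb in nb'.
- by case=> -> /IH[-> ->].
Qed.

Lemma top_str t r : ~~ top_sat isbit (str t ++ r).
Proof. by case: t. Qed.

Lemma top_strs ts a : ~~ top_sat isbit (flatten (map str ts) ++ Close :: a).
Proof. by case: ts => //= t ts; rewrite -catA top_str. Qed.

(** The code of an atom has no terminator, so decoding is unique only if what follows does not start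
    with a bit. *)
Definition prefix_code (t : term) := forall t' a b,
  ~~ top_sat isbit a -> ~~ top_sat isbit b ->
  str t ++ a = str t' ++ b -> t = t' /\ a = b.

Lemma prefix_code_seq ts ts' a b : (forall t, t \in ts -> prefix_code t) ->
  flatten (map str ts) ++ Close :: a = flatten (map str ts') ++ Close :: b ->
  ts = ts' /\ a = b.
Proof.
elim: ts ts' => [|t ts IH] [|t' ts'] Hts /=.
- by case.
- by case: t'.
- by case: t {Hts}.
rewrite -!catA => /(Hts t (mem_head _ _) _ _ _ (top_strs _ _) (top_strs _ _))[-> E].
have [|-> ->] // := IH ts' _ E.
by move=> t'' Ht; apply: Hts; rewrite inE Ht orbT.
Qed.

Lemma str_prefix_code t : prefix_code t.
Proof.
elim/term_nested_ind: t => [n|ts IH] [n'|ts'] a b na nb' //=.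
  by case=> /(bits_cat_inj na nb')[/bits_inj-> ->].
by case; rewrite -!catA => /(prefix_code_seq IH)[-> ->].
Qed.

Lemma names_str t r : ~~ top_sat isbit r ->
  names (str t ++ r) = map bits (leaves t) ++ names r.
Proof.
elim/term_nested_ind: t r => [n|ts IH] r nr /=;
  first by rewrite bitpre_cat // names_bits.
rewrite -catA /=; elim: ts IH => [|t ts IHts] IH //=.
rewrite -catA IH ?mem_head ?top_strs // map_cat -catA IHts // => t' Ht'.
by apply: IH; rewrite inE Ht' orbT.
Qed.

Lemma names_str1 t : names (str t) = map bits (leaves t).
Proof. by have := @names_str t [::] isT; rewrite !cats0. Qed.

Section Encodings.

Local Open Scope fset_scope.

Lemma encodes_Tup R t : encodes R t -> exists ts, t = Tup ts.
Proof. by case=> ts -> _; exists ts. Qed.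

Lemma encodes_set_inj A B t : encodes_set A t -> encodes_set B t -> A = B.
Proof.
move=> [l -> [_ lA]] [l' [<-] [_ lB]]; apply/fsetP => x.
by rewrite -lA lB.
Qed.

(** A tuple has many encodings, but an encoding determines its tuple; so a solution found for an
    encoding of a scenario is a solution of that scenario. *)
Lemma encodes_inj R R' t : encodes R t -> encodes R' t -> R = R'.
Proof.
move=> [ts -> [Es H]] [ts' [<-] [Es' H']]; apply: (@eq_from_nth _ fset0).
  by rewrite -Es.
move=> i lt_i; apply: encodes_set_inj (H i lt_i) (H' i _).
by rewrite -Es' Es.
Qed.

Lemma exists_encoding R : exists t, encodes R t.
Proof.
exists (Tup [seq Tup (enum_fset A) | A : {fset term} <- R]).
exists [seq Tup (enum_fset A) | A : {fset term} <- R] => //.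
rewrite size_map; split=> // i lt_i; rewrite (nth_map fset0) //.
by exists (enum_fset (nth fset0 R i)); rewrite // fset_uniq.
Qed.

Lemma mem_occurring s n :
  reflect (exists (A : {fset term}) t, [/\ A \in s, t \in A & n \in leaves t]) (n \in
    occurring s).
Proof.
rewrite /occurring !inE /=; apply: (iffP flattenP) => [[l]|[B [t [sB Bt tn]]]].
  by move=> /allpairsPdep[B [t [sB Bt ->]]] ln; exists B, t.
by exists (leaves t) => //; apply/allpairsPdep; exists B, t.
Qed.

Lemma encodes_leaves s u : encodes s u -> occurring s =i leaves u.
Proof.
move=> [ts -> [Es H]] n; apply/mem_occurring/flattenP => /=.
  move=> [B [t [sB Bt tn]]]; have lt_i : index B s < size s by rewrite index_mem.
  have [l El [_ lB]] := H _ lt_i; rewrite nth_index // in lB.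
  exists (leaves (Tup l)).
    by apply/mapP; exists (Tup l); rewrite // -El mem_nth // Es.
  by apply/flattenP; exists (leaves t) => //; apply: map_f; rewrite lB.
move=> [l0 /mapP[t0 t0s ->] nt0].
have lt_i : index t0 ts < size s by rewrite -Es index_mem.
have [l El [_ lB]] := H _ lt_i; rewrite nth_index // in El; subst t0.
have /flattenP[l1 /mapP[t tl ->] nt] := nt0.
by exists (nth fset0 s (index (Tup l) ts)), t; rewrite mem_nth // -lB.
Qed.

(** Every element of the symmetric difference must have its name in [l], and distinct elements have
    distinct names. *)
Lemma hamming_leq (B B' : {fset nat}) (l : seq (seq bool)) :
  {subset map bits (enum_fset B) <= map bits (enum_fset B') ++ l} ->
  {subset map bits (enum_fset B') <= map bits (enum_fset B) ++ l} ->
  hamming B B' <= size l.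
Proof.
move=> H1 H2; rewrite /hamming cardfE cardE -(size_map (bits \o val)).
apply: uniq_leq_size.
  rewrite map_inj_uniq ?enum_uniq //; exact: inj_comp bits_inj val_inj.
move=> b /mapP[[n Hn] _ ->] /=; move: Hn; rewrite !inE => /orP[] /andP[nB' nB].
  have := H1 (bits n); rewrite mem_cat (mem_map bits_inj) => /(_ nB) /orP[|//].
  by rewrite (mem_map bits_inj) => nB''; rewrite nB'' in nB'.
have := H2 (bits n); rewrite mem_cat (mem_map bits_inj) => /(_ nB) /orP[|//].
by rewrite (mem_map bits_inj) => nB''; rewrite nB'' in nB'.
Qed.

Lemma recoverable_hamming s0 u0 s u (w : string) :
  encodes s0 u0 -> encodes s u ->
  {subset names (str u0) <= names (str u) ++ names w} ->
  {subset names (str u) <= names (str u0) ++ names w} ->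
  hamming (occurring s0) (occurring s) <= size (names w).
Proof.
move=> Eu0 Eu; rewrite !names_str1 => H1 H2.
have E v t : encodes v t -> map bits (enum_fset (occurring v)) =i map bits (leaves t).
  by move=> /encodes_leaves Evt; apply: eq_mem_map => n; rewrite -Evt.
apply: hamming_leq => b; rewrite mem_cat (E _ _ Eu) (E _ _ Eu0).
  by move=> /H1; rewrite mem_cat.
by move=> /H2; rewrite mem_cat.
Qed.

Definition name_list (l : seq nat) : string := flatten [seq Hash ::
  map Bit (bits n) | n <- l].

Lemma names_name_list l : names (name_list l) = map bits l.
Proof.
elim: l => //= n l IH; have nl : ~~ top_sat isbit (name_list l) by case: (l).
by rewrite bitpre_cat // names_bits -IH.
Qed.

Lemma size_name_list l i : (forall n, n \in l -> size (bits n) < i) ->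
  size (name_list l) <= size l * i.
Proof.
elim: l => //= n l IH Hl; rewrite /name_list /= size_cat size_map -/(name_list l).
rewrite mulSn; apply: (@leq_add (size (bits n)).+1); first exact: Hl (mem_head _ _).
by apply: IH => n' Hn'; apply: Hl; rewrite inE Hn' orbT.
Qed.

Lemma size_bits_leaf t n : n \in leaves t -> size (bits n) < size (str t).
Proof.
move=> /(map_f bits); rewrite -names_str1 => /mem_namesP[w1 [r [-> _]]].
by rewrite size_cat /= size_cat size_map; lia.
Qed.

Lemma size_leaves t : size (leaves t) <= size (str t).
Proof. by rewrite -(size_map bits) -names_str1 size_names count_size. Qed.

(** The list is the symmetric difference itself: at most [2 * i] atoms, all of them leaves of [u0]
    or [u], each written with at most [i] letters. *)
Lemma exists_difference s0 u0 s u i : encodes s0 u0 -> encodes s u ->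
  size (str u0) <= i -> size (str u) <= i ->
  exists w : string, [/\ size (names w) = hamming (occurring s0) (occurring s),
    size (names w) <= 2 * i, size w <= 2 * i * i,
    {subset names (str u0) <= names (str u) ++ names w} &
    {subset names (str u) <= names (str u0) ++ names w}].
Proof.
move=> Eu0 Eu le0 le1; set B := occurring s0; set B' := occurring s.
pose F := (B `\` B') `|` (B' `\` B); exists (name_list (enum_fset F)).
rewrite names_name_list size_map.
have EB := encodes_leaves Eu0; have EB' := encodes_leaves Eu;
  rewrite -/B -/B' in EB EB'.
have sF : size (enum_fset F) <= 2 * i.
  have: size (enum_fset F) <= size (leaves u0 ++ leaves u).
    apply: uniq_leq_size (fset_uniq _) _ => n; rewrite mem_cat -EB -EB' !inE.
    by case/orP=> /andP[_ ->]; rewrite ?orbT.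
  by rewrite size_cat; have := size_leaves u0; have := size_leaves u; lia.
have mF n : (n \in enum_fset F) = (n \in B) && (n \notin B') || (n \in B') && (n
  \notin B).
  rewrite -[_ \in enum_fset F]/(n \in F) /F in_fsetU !in_fsetD.
  by case: (n \in B); case: (n \in B').
split=> //.
- apply: (@leq_trans (size (enum_fset F) * i)); last by rewrite leq_mul2r sF orbT.
  apply: size_name_list => n; rewrite mF => /orP[] /andP[].
    by rewrite EB => /size_bits_leaf/leq_trans->.
  by rewrite EB' => /size_bits_leaf/leq_trans->.
- rewrite !names_str1 => b /mapP[n]; rewrite -EB => nB ->.
  rewrite mem_cat !(mem_map bits_inj) -EB' mF nB.
  by case: (n \in B').
rewrite !names_str1 => b /mapP[n]; rewrite -EB' => nB ->.
rewrite mem_cat !(mem_map bits_inj) -EB mF nB.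
by case: (n \in B).
Qed.

End Encodings.

(** * Correctness of the verifier *)

Lemma size_flatten_mem (T : eqType) (ts : seq (seq T)) t : t \in ts ->
  size t <= size (flatten ts).
Proof.
elim: ts => //= t' ts IH; rewrite inE size_cat => /orP[/eqP->|/IH]; lia.
Qed.

Lemma size_flatten_leq (ts : seq term) : size ts <= size (flatten (map str ts)).
Proof. by elim: ts => //= t ts IH; rewrite size_cat; case: t => /=; lia. Qed.

Section Correctness.

Variables (Pb : comb_problem) (E : scenario_encoding Pb) (g : string -> string).
Local Notation Ls := (solution_language Pb).
Local Notation Ly := (yes_language Pb).

Hypothesis Hg : forall R0 t0 kappa c, encodes R0 t0 -> is_instance Pb R0 ->
  if scenarios E R0 c is Some scs
  then encodes_scenarios scs (g (hdrr_input t0 kappa c))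
  else g (hdrr_input t0 kappa c) = [::].

Lemma solution_string R t s u : encodes R t -> encodes s u -> is_instance Pb R ->
  feasible Pb R s -> Ls (Open :: str t ++ rcons (str u) Close).
Proof.
move=> Et Eu iR fs; exists R, t, s, u; split=> //=.
by rewrite cats0 -catA cats1.
Qed.

(* Membership of the first string in the yes-language delimits the instance,
   hence also the solution, in the second one. *)
Lemma solution_decode t w : Ly t -> Ls (Open :: t ++ rcons w Close) ->
  exists R t' s u, [/\ t = str t' /\ w = str u, encodes R t', encodes s u,
    is_instance Pb R & feasible Pb R s].
Proof.
move=> [R0 [t0 [Et0 -> _ _]]] [R [t1 [s [u [Et1 Eu Es iR fs]]]]].
have [ts0 E0] := encodes_Tup Et0; have [ts1 E1] := encodes_Tup Et1; subst t0 t1.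
move: Es; rewrite [str (Tup [:: _; _])]/= cats0 -/(str (Tup ts1)) => -[].
rewrite -!cats1 -!catA /= => /(prefix_code_seq (fun t _ => @str_prefix_code t))[Ets].
rewrite !cats1 => /rcons_inj[Ew]; subst ts1.
by exists R, (Tup ts0), s, u; split=> //; split=> //; rewrite /= cats1.
Qed.

Lemma hdrr_input_eq t0 kappa w :
  hdrr_input t0 kappa w = Open :: str t0 ++ Hash :: map Bit (bits kappa) ++ Close ::
    w.
Proof. by rewrite /hdrr_input /= cats0 -!catA. Qed.

Lemma hdrr_accepts x : accepts Ls Ly g x -> hdrr E x.
Proof.
move=> [t [u [bs [w [m [ts [s [[Ex lbs Lst Lyt] le_m Eg nO Hts]]]]]]]].
have [R0 [t0 [s0 [u0 [[Et Eu] Et0 Eu0 iR0 fs0]]]]] := solution_decode Lyt Lst.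
have [kappa Ek] := last_true_bits lbs; subst bs t u.
rewrite -hdrr_input_eq in Ex; rewrite val_bitsK in le_m.
have := Hg kappa w Et0 iR0; rewrite -Ex Eg; case Esc:
  (scenarios E R0 w) => [scs|] // Hscs.
have [ts' [Ets sub sup]] := Hscs.
exists R0, t0, kappa, w, scs; split=> //; exists s0 => // R Rscs.
have [t' t'ts Et'] := sup R Rscs.
(* Pieces and listed scenarios agree one by one: each piece is the code of a tuple, by the
   yes-language, and such codes are uniquely decodable whatever follows. The cutting cannot have
   stopped early, since a remaining scenario would start with [Open]. *)
have Hin : str t' \in ts.
  have Hsub : forall t1, t1 \in ts' -> exists l, t1 = Tup l.
    by move=> t1 /sub[R1 _ /encodes_Tup].
  case: Ets => {Eg sub sup Hscs}; elim: ts ts' t'ts Hsub Hts => [|t1 ts IH] ts' t'ts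
    Hsub Hts.
    case: ts' t'ts Hsub => // t2 ts' _ Hsub; have [l ->] := Hsub t2 (mem_head _ _).
    by move=> /= Es; rewrite Es /= /reads eqxx in nO.
  have [[R1 [t2 [Et2 Et1 _ _]]] _] := Hts t1 (mem_head _ _); subst t1.
  have [l2 E2] := encodes_Tup Et2; subst t2.
  case: ts' t'ts Hsub => // t3 ts' t'ts Hsub; have [l3 E3] := Hsub t3 (mem_head _ _).
  subst t3 => -[]; rewrite -!catA /=.
  move=> /(prefix_code_seq (fun t _ => @str_prefix_code t))[El Es]; subst l3.
  move: t'ts; rewrite !inE => /orP[/eqP->|t'ts]; first by rewrite eqxx.
  rewrite (IH ts') ?orbT // => t4 Ht4; first by apply: Hsub; rewrite inE Ht4 orbT.
  by apply: Hts; rewrite inE Ht4 orbT.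
have [Lyt' [u' [w' [Lst' le_w H1 H2]]]] := Hts _ Hin.
have [R1 [t1 [s1 [u1 [[Et1 Eu1] Et1' Eu1' iR1 fs1]]]]] := solution_decode Lyt' Lst'.
have {Et1} E1 : t' = t1.
  by have [] := @str_prefix_code t' t1 [::] [::] isT isT; rewrite ?Et1.
subst t1 u'; have ER := encodes_inj Et' Et1'; subst R1.
exists s1 => //; apply: leq_trans (recoverable_hamming Eu0 Eu1' H1 H2) _.
exact: leq_trans le_w le_m.
Qed.

(** [j] bounds the input and [g x], hence the base instance and all scenarios; [h] then bounds the
    solutions; [i] adds room for a list of [2 * h] names of length [h] and for the unary bound. *)
Lemma hdrr_certificate x (Tg : nat -> nat) (q : {poly nat}) (j h i : nat) :
  (forall z, size (g z) <= Tg (size z)) ->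
  (forall R t s u, encodes R t -> encodes s u -> is_instance Pb R ->
     feasible Pb R s -> size (str u) <= q.[size (str t)]%R) ->
  j = size x + Tg (size x) -> h = hval q j -> i = j + 2 * h * h + 2 * h ->
  hdrr E x -> exists t u bs w (m : nat) ts s,
  [/\ [/\ x = Open :: t ++ Hash :: map Bit bs ++ Close :: w, last true bs,
          Ls (Open :: t ++ rcons u Close) & Ly t],
      [/\ m <= val_bits bs, g x = Open :: flatten ts ++ s & ~~ reads Open (ohead s)],
      [/\ size t <= i, size u <= i, m <= i & size ts <= i] &
      forall t', t' \in ts -> [/\ reads Open (ohead t'), Ly t', size t' <= i &
        exists u' w, [/\ Ls (Open :: t' ++ rcons u' Close), size (names w) <= m,
          size u' <= i /\ size w <= i,
          {subset names u <= names u' ++ names w} &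
          {subset names u' <= names u ++ names w}]]].
Proof.
move=> le_g Hq Ej Eh Ei [R0 [t0 [kappa [c [scs [Et0 iR0 Ex Esc [s0 fs0 HS]]]]]]].
have := Hg kappa c Et0 iR0; rewrite Esc -Ex => -[ts [Eg sub sup]].
have iS := scenarios_instance iR0 Esc.
have [u0 Eu0] := exists_encoding s0.
have le_gx : size (g x) <= j by rewrite Ej; apply: leq_trans (le_g x) (leq_addl _ _).
have Egx : g x = Open :: flatten (map str ts) ++ [:: Close] by [].
have le_h R t s u : encodes R t -> encodes s u -> is_instance Pb R ->
    feasible Pb R s -> size (str t) <= j -> size (str u) <= h.
  move=> Et Eu iR fs le_t; apply: leq_trans (Hq _ _ _ _ Et Eu iR fs) _.
  by rewrite hornerE_nat Eh leq_hval.
have le_t0 : size (str t0) <= j.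
  rewrite Ej Ex hdrr_input_eq /= size_cat; lia.
have le_u0 := le_h _ _ _ _ Et0 Eu0 iR0 fs0 le_t0.
have [le_ji le_hi le_2hi] : [/\ j <= i, h <= i & 2 * h <= i] by split; lia.
(* The minimum keeps the unary bound polynomial, and a symmetric difference has at most [2 * h]
   elements anyway. *)
exists (str t0), (str u0), (bits kappa), c, (minn kappa (2 * h)), (map str ts), [::
  Close].
split.
- split; [by rewrite Ex hdrr_input_eq|exact: last_bits|exact:
  solution_string Et0 Eu0 iR0 fs0|].
  by exists R0, t0; split=> //; exists s0.
- by split; rewrite ?val_bitsK ?geq_minl //; apply/eqP.
- split; [exact: leq_trans le_ji|exact: leq_trans le_hi| |].
    by apply: leq_trans le_2hi; rewrite geq_minr.
  rewrite size_map; apply: leq_trans le_ji; apply: leq_trans (size_flatten_leq ts) _.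
  by apply: leq_trans le_gx; rewrite Egx /= size_cat; lia.
move=> t' /mapP[t1 t1s ->]; have [R SR Et1] := sub t1 t1s.
have [s1 fs1 le_d] := HS R SR; have iR := iS R SR.
have [u1 Eu1] := exists_encoding s1.
have le_t1 : size (str t1) <= j.
  apply: leq_trans le_gx; rewrite Egx /= size_cat.
  apply: leqW; apply: leq_trans (size_flatten_mem (map_f str t1s)) (leq_addr _ _).
have le_u1 := le_h _ _ _ _ Et1 Eu1 iR fs1 le_t1.
have [w [Ew le_w1 le_w2 H1 H2]] := exists_difference Eu0 Eu1 le_u0 le_u1.
split.
- by have [l ->] := encodes_Tup Et1; rewrite /= /reads eqxx.
- by exists R, t1; split=> //; exists s1.
- exact: leq_trans le_ji.
exists (str u1), w; split=> //; first exact: solution_string Et1 Eu1 iR fs1.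
  by rewrite leq_min le_w1 Ew le_d.
by split; [exact: leq_trans le_hi|lia].
Qed.

End Correctness.

Lemma input_store_bs (J G : finType) u v :
  input_store (option G : finType) (inl rX) (inl rY) u v =
  @bs J G (st u v [::] [::] [::] [::] [::] [::] [::] [::] [::] [::] [::] [::] [::]
    [::]).
Proof.
apply: functional_extensionality => -[r|j]; rewrite /input_store /bs /base /fn //.
by case: r => i Hi; do 16 (case: i Hi => [|i] Hi //).
Qed.

Theorem theorem8 (P : comb_problem) (E : scenario_encoding P) :
  comb_in_NP P -> polynomially_computable E -> in_NP (hdrr E).
Proof.
move=> [NPy [q Hq] NPs] [g pg Hg].
have [Ms Hs] := exists_np_prog NPs; have [My Hy] := exists_np_prog NPy.
have [Mg Hf] := exists_function_prog pg.
(* Disjoint sums give each of the three machines registers and symbols of its own. *)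
pose J : finType := (block Ms + (block My + block Mg))%type.
pose G : finType :=
  ((aux Ms + state Ms) + ((aux My + state My) + (aux Mg + state Mg)))%type.
have [cs [Ts [ps Ps]]] : exists (c : cmd ('I_nb + J)%type (token + option G)%type) Tc
  cs,
    np_prog (solution_language P) c Tc cs.
  apply: (Hs J G inl (fun z => if z is inl b then Some b else None)
               inl (fun z => if z is inl b then Some b else None)) => //; by case.
have [cy [Ty [py Py]]] : exists (c : cmd ('I_nb + J)%type (token + option G)%type) Tc
  cs,
    np_prog (yes_language P) c Tc cs.
  apply: (Hy J G (inr \o inl) (fun z => if z is inr (inl b) then Some b else None)
               (inr \o inl) (fun z => if z is inr (inl b) then Some b else None)) =>
                 //.
  by case=> [|[]].
have [cg [Tg Pg]] : exists (c : cmd ('I_nb + J)%type (token + option G)%type) Tc,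
    function_prog g c Tc.
  apply: (Hf J G (inr \o inr) (fun z => if z is inr (inr b) then Some b else None)
               (inr \o inr) (fun z => if z is inr (inr b) then Some b else None)) =>
                 //.
  by case=> [|[]].
pose start (u v : string) := st u v [::] [::] [::] [::] [::] [::] [::] [::] [::] [::]
  [::] [::] [::] [::].
pose c := verifier cs cy cg.
(* The verification relation is success of the program itself; it is decidable because the program
   also halts when it fails. *)
pose V u v := exists v', succ c (start u v) v'.
pose j i := i + Tg i; pose h i := hval q (j i).
pose b i := j i + 2 * h i * h i + 2 * h i.
have [bTg _ le_g _] := Pg.
have [p le_p] : pbounded (fun i => certificate_bound ps py (b i)).
  have bj : pbounded j by apply: pbounded_add pbounded_id bTg.
  have bh : pbounded h by apply: pbounded_hval.
  have bc := pbounded_const.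
  by apply: pbounded_certificate_bound; repeat first [exact: bc | exact: bh | exact:
    bj |
    apply: pbounded_add | apply: pbounded_mul].
exists V, p; split.
  have neq_XY : inl rX != inl rY :> ('I_nb + J)%type by [].
  apply: (@polytime_decidable2_exec (option G) _ _ _ neq_XY c _ _
    (pbounded_verifier_time Ps Py Pg)) => u v.
  have [r [s' [H Hr]]] := sound_verifier Ps Py Pg u v.
  exists r, s'; rewrite input_store_bs; split=> //; split.
    move=> /[dup] r1 /Hr[v' Es _]; exists v', (verifier_time Ts Ty Tg (size u + size
      v)).
    by rewrite r1 Es in H.
  (* By determinism the timed run is the given successful one, so it reports success too. *)
  by move=> [v' [t' H']]; have [-> _] := exec_inj H H'.
move=> x; split.
  move=> /(hdrr_certificate Hg le_g Hq (j := j (size x)) (h := h (size x))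
    (i := b (size x)) erefl erefl erefl).
  move=> [t [u [bs [w [m [ts [s [[Ex lbs Lst Lyt] [le_m Eg nO] [le_t le_u le_mb
    le_ts] Hts]]]]]]]].
  have [y le_y Hacc] := succ_verifier Ps Py Pg Ex lbs Lst Lyt le_m Eg nO
    le_t le_u le_mb le_ts Hts.
  by exists y => //; apply: leq_trans le_y (le_p _).
move=> [y _ [v' H]]; apply: (hdrr_accepts Hg).
by have [_ _] := sound_succ (sound_verifier Ps Py Pg x y) H.
Qed.
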